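(* The nonzero graded betti numbers of the minimal free resolution of $S/I(d)$ are given by $b_{12}=d-3$, and for $i\ge 3$ by \[ b_{i-2,i} = {d-3 \choose i} - (d-3){d-3 \choose i-1}+ {d-3 \choose 2} {d-3 \choose i-2}. \]
   Context: Let $P_d$ be a convex polygon with $d\ge 4$ vertices $v_1,\dots,v_d$ (indices mod $d$) over a field $\mathbb{K}$ with no three edge lines concurrent. Set ${\bf v}_i=(v_i,1)$, ${\bf n}_i={\bf v}_i\times{\bf v}_{i+1}$, $\alpha_j=|{\bf v}_{j-1}\,{\bf v}_j\,{\bf v}_{j+1}|$. In $S=\mathbb{K}[x_1,\ldots,x_d]$ let $\tau=\sum x_i{\bf v}_i$ and $\Lambda_k=\frac{x_{k+1}}{\alpha_{k+1}}{\bf n}_{k+1}-\frac{x_k}{\alpha_k}{\bf n}_{k-1}$. $I(d)$ is the ideal generated by the quadrics $\Lambda_2\cdot\tau,\ldots,\Lambda_{d-2}\cdot\tau$ and cubics $|\Lambda_i\,\Lambda_j\,\Lambda_k|$ (distinct $i,j,k$); it equals the ideal $I_{W_d}$ of the Wachspress surface. Here $b_{i,j}$ denotes the number of summands $S(-j)$ in the $i$-th free module of the minimal free resolution of $S/I(d)$ (so $b_{1,2}$ counts quadric generators). *)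

(* Defs.v *)
From HB Require Import structures.
From mathcomp Require Import all_boot all_order all_algebra.
From mathcomp Require Export mpoly.
Set Implicit Arguments. Unset Strict Implicit. Unset Printing Implicit Defensive.
Import Order.TTheory GRing.Theory Num.Theory.
Local Open Scope ring_scope.

Definition v3 (R : Type) := (R * R * R)%type.
Definition mk3 (R : Type) (a b c : R) : v3 R := (a, b, c).
Definition c1 (R : Type) (u : v3 R) := u.1.1.
Definition c2 (R : Type) (u : v3 R) := u.1.2.
Definition c3 (R : Type) (u : v3 R) := u.2.

Definition dot3 (R : comPzRingType) (a b : v3 R) : R :=
  c1 a * c1 b + c2 a * c2 b + c3 a * c3 b.
Definition cross3 (R : comPzRingType) (a b : v3 R) : v3 R :=
  mk3 (c2 a * c3 b - c3 a * c2 b)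
      (c3 a * c1 b - c1 a * c3 b)
      (c1 a * c2 b - c2 a * c1 b).
Definition det3 (R : comPzRingType) (a b c : v3 R) : R := dot3 a (cross3 b c).
Definition scale3 (R : comPzRingType) (s : R) (a : v3 R) : v3 R :=
  mk3 (s * c1 a) (s * c2 a) (s * c3 a).
Definition add3 (R : comPzRingType) (a b : v3 R) : v3 R :=
  mk3 (c1 a + c1 b) (c2 a + c2 b) (c3 a + c3 b).
Definition sub3 (R : comPzRingType) (a b : v3 R) : v3 R :=
  mk3 (c1 a - c1 b) (c2 a - c2 b) (c3 a - c3 b).
Definition map3 (R R' : Type) (f : R -> R') (a : v3 R) : v3 R' :=
  mk3 (f (c1 a)) (f (c2 a)) (f (c3 a)).

(* ---------- the polygon P_d ----------
   The vertices are given by v : nat -> K * K, read modulo d: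
   vertex v_i is v (i %% d)%N (so v_d = v_0). *)
Section Polygon.
Variables (K : realFieldType) (d : nat) (v : nat -> K * K).

Definition bv (i : nat) : v3 K := mk3 (v (i %% d)%N).1 (v (i %% d)%N).2 1.
Definition nvec (i : nat) : v3 K := cross3 (bv i) (bv i.+1).
(* alpha_j = | v_{j-1} v_j v_{j+1} |  (j-1 taken mod d) *)
Definition alpha (j : nat) : K := det3 (bv (j + d).-1) (bv j) (bv j.+1).

(* convexity: the vertices v_1, ..., v_d, in this cyclic order, are the
   vertices of a (strictly) convex polygon: every other vertex lies strictly
   on the same side of each edge line, with the same orientation for all edges. *)
Definition convex_polygon : Prop :=
  (forall i k : 'I_d, (k != i) -> (k != (i.+1 %% d)%N :> nat) ->
     0 < det3 (bv i) (bv i.+1) (bv k)) \/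
  (forall i k : 'I_d, (k != i) -> (k != (i.+1 %% d)%N :> nat) ->
     det3 (bv i) (bv i.+1) (bv k) < 0).

(* no three edge lines (line i through v_i, v_{i+1}, with coordinates n_i)
   are concurrent *)
Definition no_three_edge_lines_concurrent : Prop :=
  forall i j k : 'I_d, i != j -> j != k -> i != k ->
    det3 (nvec i) (nvec j) (nvec k) != 0.

Local Notation S := {mpoly K[d]}.

Definition xv (i : nat) : S := \sum_(k < d | (k : nat) == (i %% d)%N) 'X_k.

Definition Cv (a : v3 K) : v3 S := map3 (fun c : K => c%:MP) a.

Definition tau : v3 S := \big[@add3 S/mk3 0 0 0]_(k < d) scale3 (xv k) (Cv (bv k)).

Definition Lambda (k : nat) : v3 S :=
  sub3 (scale3 (xv k.+1 * (alpha k.+1)^-1%:MP) (Cv (nvec k.+1)))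
       (scale3 (xv k * (alpha k)^-1%:MP) (Cv (nvec (k + d).-1))).

Definition quadrics : seq S := [seq dot3 (Lambda k) tau | k <- iota 2 (d - 3)].

Definition triples : seq (nat * nat * nat) :=
  [seq (ij.1, ij.2, k) | ij <- [seq (i, j) | i <- iota 0 d, j <- iota 0 d],
                          k <- iota 0 d].
Definition distinct3 (t : nat * nat * nat) : bool :=
  [&& t.1.1 != t.1.2, t.1.2 != t.2 & t.1.1 != t.2].
Definition cubics : seq S :=
  [seq det3 (Lambda t.1.1) (Lambda t.1.2) (Lambda t.2) |
     t <- filter distinct3 triples].

Definition gensI : seq S := quadrics ++ cubics.

End Polygon.

Section Resolution.
Variables (K : fieldType) (n : nat).
Local Notation S := {mpoly K[n]}.

Definition in_ideal (gens : seq S) (f : S) : Prop :=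
  exists c : seq S, size c = size gens /\
    f = \sum_(i < size gens) c`_i * gens`_i.

(* A graded free complex
     F_0 <- F_1 <- F_2 <- ...,   F_p = (+)_{l < r p} S(- sh p l),
   with differential F_{p+1} -> F_p given by the matrix phi p (acting on
   column vectors). *)
Record graded_free_complex := GFC {
  rk : nat -> nat;
  sh : forall p : nat, 'I_(rk p) -> nat;
  phi : forall p : nat, 'M[S]_(rk p, rk p.+1)
}.
Arguments rk g p : clear implicits.
Arguments sh g p _ : clear implicits.
Arguments phi g p : clear implicits.

Definition minimal_graded_free_resolution (gens : seq S)
    (C : graded_free_complex) : Prop :=
  [/\ rk C 0 = 1%N,
      (forall l, sh C 0 l = 0%N),
  (* the maps are graded of degree 0 *)
      (forall p (m : 'I_(rk C p)) (l : 'I_(rk C p.+1)),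
         phi C p m l \is (sh C p.+1 l - sh C p m)%N.-homog /\
         ((sh C p.+1 l < sh C p m)%N -> phi C p m l = 0) /\
  (* minimality: all entries lie in the homogeneous maximal ideal *)
         mcoeff 0%MM (phi C p m l) = 0),
      (forall f : S, in_ideal gens f <->
         exists w : 'cV[S]_(rk C 1), forall m : 'I_(rk C 0), f = (phi C 0 *m w) m ord0)
    &
      (forall p (u : 'cV[S]_(rk C p.+1)),
         phi C p *m u = 0 <-> exists w : 'cV[S]_(rk C p.+2), u = phi C p.+1 *m w)].

Definition betti (C : graded_free_complex) (p q : nat) : nat :=
  #|[set l : 'I_(rk C p) | sh C p l == q]|.

End Resolution.

(* Main.v *)
(**
The Wachspress coordinates x_i(p) = alpha_i / ((n_{i-1}.p) (n_i.p)) annihilate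
I(d): Lambda_k(x(p)).p = 0, so three such vectors are dependent, while tau(x(p)) is parallel
to p. Degenerating p to a vertex along a generic path shows that the normal monomials, those
divisible neither by x_1 x_j (2 < j < d) nor by x_i x_j x_k (2 < i < j < k <= d), are linearly
independent modulo I(d).

Conversely, for generic c, the ring S is spanned by 1, x_j, x_i x_j (3 <= i < j < d) modulo
I(d) and the linear forms x_2, \sum_(i != 2) c_i x_i, \sum_(i != 2) i c_i x_i. This is an open
condition on c, and it is checked on the degeneration c_i = s^(-w_i), s -> 0, where the
generators tend to the monomials above. Counting degree by degree, S / I(d) is free over the
polynomial ring in the three linear forms, with this basis. Hence the three forms are a regular
sequence, the Artinian quotient vanishes in degrees > 2, and the Hilbert function is known.

Cutting down by a full system of linear forms, one at a time, bounds the shifts in F_p by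
p + 2. The ideal starts in degree 2, and its quadrics have no linear syzygy (polarize the
cubic relation and evaluate it at e_1, e_d, e_i, e_j), so for p >= 2 the shifts are at least
p + 2. Each F_p is thus concentrated in one degree, except for F_1 which has quadrics and
cubics, and the Betti numbers are the coefficients of (1 - t)^d times the Hilbert series.
*)
Require Import Defs.
From HB Require Import structures.
From mathcomp Require Import all_boot all_order all_algebra.
From mathcomp Require Import mpoly.
From mathcomp Require Import ring zify.
Import Order.TTheory GRing.Theory Num.Theory.
Set Implicit Arguments. Unset Strict Implicit. Unset Printing Implicit Defensive.
Local Open Scope ring_scope.

(** The initial ideal of I(d) is never computed. Independence and spanning are proved for different
    families: independence for the normal monomials, where evaluation at Wachspress points exhibits
    a dominant term, and spanning for the products of basis monomials with linear forms, where
    members of I(d) can be produced explicitly. In each degree both families are indexed by the same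
    finite set, a basis monomial together with three exponents, so writing the first through the
    second gives an invertible square matrix. Spanning survives the passage from s = 0 to some
    nonzero s because multiplication by variables reduces every degree to degrees at most 3, where a
    single determinant decides. In the bound on shifts only the first three forms are regular modulo
    I(d). For the others, vanishing of homology persists in degrees above p + 2, because the
    connecting map of each long exact sequence lowers the homological and the internal degree
    together. *)

Section MPolyGeneralities.
Variables (K : fieldType) (n : nat).
Local Notation S := {mpoly K[n]}.
Implicit Types (f g h : S) (m : 'X_{1..n}).

(** * Homogeneous components, and regular sequences of linear forms *)

Lemma dhomog_mdeg c f m : f \is c.-homog -> m \in msupp f -> mdeg m = c.
Proof. by move=> /dhomogP h /h. Qed.

Lemma pihomogMl c b z g : z \is c.-homog ->
  pihomog mdeg (c + b) (z * g) = z * pihomog mdeg b g.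
Proof.
move=> hz; rewrite {1}(@pihomog_partitionE _ _ mdeg (maxn (msize g) b.+1) g) ?leq_maxl //.
rewrite mulr_sumr raddf_sum /=.
have hb : (b < maxn (msize g) b.+1)%N by rewrite leq_max ltnSn orbT.
rewrite (bigD1 (Ordinal hb)) //= big1 ?addr0 => [|i /eqP ib].
  by rewrite pihomog_dE // dhomogM // pihomogP.
rewrite (@pihomog_ne0 _ _ _ (c + i)) ?dhomogM ?pihomogP //.
by rewrite eqn_add2l; apply/eqP => e; apply: ib; apply: val_inj.
Qed.

Lemma pihomogMl_lt c q z g : z \is c.-homog -> (q < c)%N ->
  pihomog mdeg q (z * g) = 0.
Proof.
move=> hz qa; rewrite (@pihomog_partitionE _ _ mdeg (msize g) g) // mulr_sumr raddf_sum /=.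
apply: big1 => i _; rewrite (@pihomog_ne0 _ _ _ (c + i)) ?dhomogM ?pihomogP //.
by apply/eqP; lia.
Qed.

Lemma pihomog_sum k (J : Type) (r : seq J) (P : pred J) (F : J -> S) :
  pihomog mdeg k (\sum_(j <- r | P j) F j) = \sum_(j <- r | P j) pihomog mdeg k (F j).
Proof. exact: raddf_sum. Qed.

Lemma pihomogZ k c f : pihomog mdeg k (c *: f) = c *: pihomog mdeg k f.
Proof. exact: linearZ. Qed.

Lemma dhomog0_const f : f \is 0.-homog -> f = (f@_0%MM)%:MP.
Proof.
move=> /dhomogP hf; apply/mpolyP => m; rewrite mcoeffC.
have [->|m0] := eqVneq m 0%MM; first by rewrite mulr1.
rewrite mulr0; apply: memN_msupp_eq0; apply/negP => /hf /eqP.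
by rewrite mdeg_eq0 (negbTE m0).
Qed.

Lemma dhomog1_sum f : f \is 1.-homog -> f = \sum_i f@_(U_(i)) *: 'X_i.
Proof.
move=> /dhomogP hf; apply/mpolyP => m; rewrite raddf_sum /=.
have [/hf/eqP/mdeg1P[i /eqP->]|mN] := boolP (m \in msupp f).
  rewrite (bigD1 i) //= big1 ?addr0 => [|j ji]; first by rewrite mcoeffZ mcoeffXU eqxx mulr1.
  by rewrite mcoeffZ mcoeffXU (negbTE ji) mulr0.
rewrite (memN_msupp_eq0 mN) big1 // => i _; rewrite mcoeffZ mcoeffX.
case: eqP => [e|_]; last by rewrite mulr0.
by rewrite e (memN_msupp_eq0 mN) mul0r.
Qed.

Lemma alg_endo_id (phi : {rmorphism S -> S}) :
  (forall c, phi c%:MP = c%:MP) -> (forall i, phi 'X_i = 'X_i) -> phi =1 id.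
Proof.
move=> hC hX f; rewrite [in RHS](mpolyE f) {1}(mpolyE f) raddf_sum /=.
apply: eq_bigr => m _; rewrite -mul_mpolyC rmorphM /= hC; congr (_ * _).
rewrite mpolyXE_id rmorph_prod; apply: eq_bigr => i _.
by rewrite rmorphXn /= hX.
Qed.

Lemma var_idealP (P : pred 'I_n) f :
  (forall m, m \in msupp f -> exists2 i, P i & m i != 0%N) ->
  exists h : 'I_n -> S, f = \sum_(i | P i) 'X_i * h i.
Proof.
(* [pk] assigns to each monomial a single variable of [P] dividing it, so each term of [f] enters
   exactly one [h i]. *)
move=> hf; pose pk m := [pick i | P i && (m i != 0%N)].
exists (fun i => \sum_(m <- msupp f | pk m == Some i) f@_m *: 'X_[m - U_(i)]).
rewrite {1}(mpolyE f).
under [RHS]eq_bigr => i _ do rewrite mulr_sumr big_mkcond.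
rewrite exchange_big /= big_seq [RHS]big_seq; apply: eq_bigr => m mf.
have [i0 e0] : exists i, pk m = Some i.
  rewrite /pk; case: pickP => [i|none]; first by exists i.
  by have [i Pi mi] := hf _ mf; have := none i; rewrite Pi mi.
have [Pi0 mi0] : P i0 /\ m i0 != 0%N.
  by move: e0; rewrite /pk; case: pickP => // i /andP[? ?] [<-].
rewrite (bigD1 i0) //= big1 ?addr0 => [|i /andP[_ ii]].
  by rewrite e0 eqxx -scalerAr -mpolyXD addmC submK // lep1mP.
by case: eqP => // -[e]; rewrite e0 in e; case: e => e; rewrite e eqxx in ii.
Qed.

(** Multiplication by ['X_k] raises only the exponent of a variable outside [P], so divisibility of
    the monomials of [f] by variables in [P] can be tested on the product. *)
Lemma var_regular (P : pred 'I_n) (k : 'I_n) f (g : 'I_n -> S) : ~~ P k ->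
  'X_k * f = \sum_(i | P i) 'X_i * g i ->
  exists h : 'I_n -> S, f = \sum_(i | P i) 'X_i * h i.
Proof.
move=> Pk e; apply: var_idealP => m mf.
have : ('X_k * f)@_(U_(k) + m) != 0.
  by rewrite mulrC (addmC U_(k)%MM) addmC mcoeffMX -mcoeff_msupp.
rewrite e raddf_sum /=.
have [/existsP[i /andP[Pi mi]] _|/existsPn none] :=
  boolP [exists i, P i && (m i != 0%N)]; first by exists i.
rewrite big1 ?eqxx // => i Pi; have := none i; rewrite Pi /= negbK => /eqP mi.
apply: memN_msupp_eq0; rewrite mulrC; apply/negP.
rewrite (perm_mem (msuppMX _ _)) => /mapP[m' _] /(congr1 (fun x : 'X_{1..n} => x i)).
rewrite !mnmDE !mnm1E eqxx mi; case: eqP => [ki|_]; last by [].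
by rewrite ki Pi in Pk.
Qed.

(** An invertible substitution carries the [z i] to the variables and reduces this to [var_regular].
    It serves for all n forms on free modules, whereas modulo the ideal regularity is available only
    for the first few. *)
Lemma linear_regular (z : 'I_n -> S) (Z : 'M[K]_n) (P : pred 'I_n) (k : 'I_n) f
  (g : 'I_n -> S) : Z \in unitmx -> (forall i, z i = \sum_j Z i j *: 'X_j) ->
  ~~ P k -> z k * f = \sum_(i | P i) z i * g i ->
  exists h : 'I_n -> S, f = \sum_(i | P i) z i * h i.
Proof.
move=> uZ zE Pk e.
pose psi := comp_mpoly [tuple \sum_j (invmx Z) i j *: 'X_j | i < n] : S -> S.
pose sig := comp_mpoly [tuple z i | i < n] : S -> S.
have sigX i : sig 'X_i = z i by rewrite /sig comp_mpolyXU -tnth_nth tnth_mktuple.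
have psiX i : psi 'X_i = \sum_j (invmx Z) i j *: 'X_j.
  by rewrite /psi comp_mpolyXU -tnth_nth tnth_mktuple.
have lin (A B : 'M[K]_n) i : A *m B = 1%:M ->
    \sum_j A i j *: (\sum_l B j l *: 'X_l) = 'X_i :> S.
  move=> AB; under eq_bigr => j _ do rewrite scaler_sumr.
  rewrite exchange_big /=.
  have -> : 'X_i = \sum_l (1%:M : 'M[K]_n) i l *: 'X_l :> S.
    rewrite (bigD1 i) //= mxE eqxx scale1r big1 ?addr0 // => l li.
    by rewrite mxE eq_sym (negbTE li) scale0r.
  apply: eq_bigr => l _; rewrite -AB mxE scaler_suml.
  by apply: eq_bigr => j _; rewrite scalerA.
have psiz i : psi (z i) = 'X_i.
  rewrite zE /psi raddf_sum /= -[RHS](lin _ _ i (mulmxV uZ)).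
  by apply: eq_bigr => j _; rewrite comp_mpolyZ; congr (_ *: _); apply: psiX.
have sigpsi h : sig (psi h) = h.
  apply: (@alg_endo_id (sig \o psi)) => [c|i] /=.
    by rewrite /psi /sig !comp_mpolyC.
  change (sig (psi 'X_i) = 'X_i).
  rewrite psiX /sig raddf_sum /= -[RHS](lin _ _ i (mulVmx uZ)).
  by apply: eq_bigr => j _; rewrite comp_mpolyZ -zE; congr (_ *: _); apply: sigX.
have e' : 'X_k * psi f = \sum_(i | P i) 'X_i * psi (g i).
  rewrite -psiz -rmorphM /= e raddf_sum /=.
  by apply: eq_bigr => i _; rewrite rmorphM /= -/psi psiz.
have [h hE] := var_regular Pk e'.
exists (sig \o h); rewrite -[LHS]sigpsi hE /sig raddf_sum /=.
by apply: eq_bigr => i _; rewrite rmorphM /= -/sig sigX.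
Qed.

End MPolyGeneralities.

(** * Upper bounds on the shifts *)

Section GradedComplex.
Variables (K : fieldType) (n : nat).
Local Notation S := {mpoly K[n]}.
Variable (C : graded_free_complex K n).
Local Notation F p := 'cV[S]_(rk C p).

Hypothesis phi_hom : forall p (m : 'I_(rk C p)) (l : 'I_(rk C p.+1)),
  phi C p m l \is (sh l - sh m)%N.-homog /\
  ((sh l < sh m)%N -> phi C p m l = 0) /\
  mcoeff 0%MM (phi C p m l) = 0.

Definition hvec p q (u : F p) :=
  forall l m, m \in msupp (u l 0) -> (mdeg m + sh l = q)%N.

(** The guard matters: for [sh l > q] the difference [q - sh l] truncates to 0, and the constant
    term would be kept. *)
Definition hproj p q (u : F p) : F p :=
  \col_l if (sh l <= q)%N then pihomog mdeg (q - sh l) (u l 0) else 0.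

Lemma hvec0 p q : hvec q (0 : F p).
Proof. by move=> l m; rewrite mxE msupp0. Qed.

Lemma hvecD p q (u v : F p) : hvec q u -> hvec q v -> hvec q (u + v).
Proof.
by move=> hu hv l m; rewrite mxE => /msuppD_le; rewrite mem_cat => /orP[/hu|/hv].
Qed.

Lemma hvecN p q (u : F p) : hvec q u -> hvec q (- u).
Proof. by move=> hu l m; rewrite mxE (perm_mem (msuppN _)) => /hu. Qed.

Lemma hvecB p q (u v : F p) : hvec q u -> hvec q v -> hvec q (u - v).
Proof. by move=> hu hv; apply/hvecD/hvecN. Qed.

Lemma hvec_sum p q (J : Type) (r : seq J) (P : pred J) (u : J -> F p) :
  (forall j, hvec q (u j)) -> hvec q (\sum_(j <- r | P j) u j).
Proof. by move=> hu; elim/big_ind: _ => [||//]; [apply: hvec0 | apply: hvecD]. Qed.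

Lemma hvecZ p q c z (u : F p) : z \is c.-homog -> hvec q u -> hvec (c + q) (z *: u).
Proof.
move=> /dhomogP hz hu l m; rewrite mxE => /msuppM_le/allpairsP[[a b] /= [/hz <- /hu <- ->]].
by rewrite mdegD addnA.
Qed.

Lemma hproj_hvec p q (u : F p) : hvec q (hproj q u).
Proof.
move=> l m; rewrite mxE; case: leqP => [le|_]; last by rewrite msupp0.
by move=> hm; rewrite (dhomog_mdeg (pihomogP mdeg _ _) hm) subnK.
Qed.

Lemma hproj_id p q (u : F p) : hvec q u -> hproj q u = u.
Proof.
move=> hu; apply/matrixP => l j; rewrite mxE (ord1 j).
case: leqP => [le|lt].
  by rewrite pihomog_dE //; apply/dhomogP => m /hu /(canRL (addnK _)).
apply/esym/eqP; rewrite -msupp_eq0; case E : (msupp _) => [//|m s].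
have /hu : m \in msupp (u l 0) by rewrite E mem_head.
by lia.
Qed.

Lemma hprojD p q (u v : F p) : hproj q (u + v) = hproj q u + hproj q v.
Proof.
apply/matrixP => l j; rewrite !mxE; case: leqP => _; last by rewrite addr0.
by rewrite pihomogD.
Qed.

Lemma hproj0 p q : hproj q (0 : F p) = 0.
Proof. by apply/matrixP => l j; rewrite !mxE raddf0; case: leqP. Qed.

Lemma hproj_sum p q (J : Type) (r : seq J) (P : pred J) (u : J -> F p) :
  hproj q (\sum_(j <- r | P j) u j) = \sum_(j <- r | P j) hproj q (u j).
Proof. by elim/big_rec2: _ => [|j x y _ <-]; [apply: hproj0 | apply: hprojD]. Qed.

Lemma hprojZ p q c z (u : F p) : z \is c.-homog ->
  hproj (c + q) (z *: u) = z *: hproj q u.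
Proof.
move=> hz; apply/matrixP => l j; rewrite !mxE.
have [le|lt] := leqP (sh l) q.
  by rewrite (leq_trans le) ?leq_addl // -addnBA // pihomogMl.
case: leqP => le; last by rewrite mulr0.
by rewrite mulr0 (pihomogMl_lt _ hz) //; lia.
Qed.

Lemma hvecZ1 p q z (u : F p) : z \is 1.-homog -> hvec q u -> hvec q.+1 (z *: u).
Proof. exact: (@hvecZ p q 1). Qed.

Lemma hvecC p q c (u : F p) : hvec q u -> hvec q (c%:MP *: u).
Proof. by apply: (@hvecZ p q 0); rewrite -alg_mpolyC rpredZ // dhomog1. Qed.

Lemma hprojZ1 p q z (u : F p) : z \is 1.-homog ->
  hproj q.+1 (z *: u) = z *: hproj q u.
Proof. exact: (@hprojZ p q 1). Qed.

(** A nonzero entry of [phi] has degree exactly [sh a - sh l], without truncation, so the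
    projections commute with the differential. This is what restricts exactness to single
    degrees. *)
Lemma hproj_phi p q (u : F p.+1) : hproj q (phi C p *m u) = phi C p *m hproj q u.
Proof.
apply/matrixP => l j; rewrite !mxE (ord1 j).
transitivity (\sum_a (if (sh l <= q)%N then
    pihomog mdeg (q - sh l) (phi C p l a * u a 0) else 0)).
  by case: leqP => _; [rewrite raddf_sum | rewrite big1].
apply: eq_bigr => a _; rewrite !mxE.
have [hom [lt0 _]] := phi_hom l a.
have [->|nz] := eqVneq (phi C p l a) 0; first by rewrite !mul0r raddf0; case: leqP.
have le : (sh l <= sh a)%N by rewrite leqNgt; apply/negP => /lt0 e; rewrite e eqxx in nz.
have [aq|qa] := leqP (sh a) q.
  rewrite (leq_trans le aq) -(pihomogMl _ _ hom); congr (pihomog _ _ _); lia.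
case: leqP => lq; last by rewrite mulr0.
by rewrite mulr0 (pihomogMl_lt _ hom) //; lia.
Qed.

Lemma hvec_phi p q (u : F p.+1) : hvec q u -> hvec q (phi C p *m u).
Proof. by move=> hu; rewrite -(hproj_id hu) -hproj_phi; apply: hproj_hvec. Qed.

Lemma phi_supp p (l : 'I_(rk C p)) (a : 'I_(rk C p.+1)) m :
  m \in msupp (phi C p l a) -> (mdeg m + sh l = sh a)%N /\ (0 < mdeg m)%N.
Proof.
have [hom [lt0 c0]] := phi_hom l a => hm; split; last first.
  rewrite lt0n mdeg_eq0; apply/eqP => m0; move: hm.
  by rewrite mcoeff_msupp m0 c0 eqxx.
rewrite (dhomog_mdeg hom hm) subnK // leqNgt; apply/negP => /lt0 e.
by rewrite e msupp0 in hm.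
Qed.

Lemma phi_mcoeff0 p (w : F p.+1) l : mcoeff 0%MM ((phi C p *m w) l 0) = 0.
Proof.
rewrite mxE raddf_sum big1 //= => a _.
have [_ [_ c0]] := phi_hom l a.
by rewrite rmorphM /= c0 mul0r.
Qed.

Definition basis_vec p (l : 'I_(rk C p)) : F p := delta_mx l 0.

Lemma hvec_basis p (l : 'I_(rk C p)) : hvec (sh l) (basis_vec l).
Proof.
move=> a m; rewrite mxE andbT; case: eqP => [->|_]; last by rewrite msupp0.
by rewrite msupp1 inE => /eqP ->; rewrite mdeg0.
Qed.

Arguments hvec_basis [p] l.

Hypothesis phi_exact : forall p (u : F p.+1),
  phi C p *m u = 0 <-> exists w : F p.+2, u = phi C p.+1 *m w.

Lemma phi_phi p (w : F p.+2) : phi C p *m (phi C p.+1 *m w) = 0.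
Proof. by apply/phi_exact; exists w. Qed.

Lemma hexact p q (u : F p.+1) : hvec q u -> phi C p *m u = 0 ->
  exists2 w : F p.+2, hvec q w & u = phi C p.+1 *m w.
Proof.
move=> hu /phi_exact[w uE]; exists (hproj q w); first exact: hproj_hvec.
by rewrite -hproj_phi -uE hproj_id.
Qed.

(** A zero column would make a basis vector a cycle, hence a boundary; by minimality no boundary has
    a nonzero constant term. *)
Lemma phi_col_neq0 p (l : 'I_(rk C p.+1)) : phi C p *m basis_vec l != 0.
Proof.
apply/eqP => /phi_exact[w e].
have := phi_mcoeff0 w l; rewrite -e mxE !eqxx mcoeff1 eqxx.
by move/eqP; rewrite oner_eq0.
Qed.

Section Chain.
Variables (I : S -> Prop) (z : 'I_n -> S) (Z : 'M[K]_n).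
Hypothesis uZ : Z \in unitmx.
Hypothesis zE : forall i, z i = \sum_j Z i j *: 'X_j.
Hypothesis rk0 : rk C 0 = 1%N.
Hypothesis sh0 : forall l : 'I_(rk C 0), sh l = 0%N.
Hypothesis phi0 : forall f : S, I f <->
  exists w : F 1, forall m : 'I_(rk C 0), f = (phi C 0 *m w) m ord0.
Variable r : nat.
Hypothesis regular_mod : forall (k : 'I_n) (f : S) (g : 'I_n -> S), (k < r)%N ->
  I (z k * f - \sum_(i : 'I_n | (i < k)%N) z i * g i) ->
  exists g' : 'I_n -> S, I (f - \sum_(i : 'I_n | (i < k)%N) z i * g' i).
Hypothesis artinian_mod : forall q (f : S), (2 <= q)%N -> f \is q.+1.-homog ->
  exists g : 'I_n -> S, I (f - \sum_(i : 'I_n | (i < r)%N) z i * g i).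

Let z_hom i : z i \is 1.-homog.
Proof. by rewrite zE rpred_sum // => j _; rewrite rpredZ // dhomogX; apply/eqP/mdeg1. Qed.

Lemma im_phi0 (u : F 0) : (forall m, I (u m 0)) <-> exists w, u = phi C 0 *m w.
Proof.
(* [rk C 0 = 1] is only an equation; it enters through the fact that [F 0] has a single index. *)
have one (m m' : 'I_(rk C 0)) : m = m'.
  by case: (rk C 0) rk0 m m' => // -[|//] _ m m'; rewrite (ord1 m) (ord1 m').
split=> [Iu|[w ->] m].
  have m0 : 'I_(rk C 0) by rewrite rk0; exact: ord0.
  have [w hw] := (phi0 _).1 (Iu m0); exists w; apply/matrixP => m j.
  by rewrite (ord1 j) (one m m0); apply: hw.
by apply/phi0; exists w => m'; rewrite (one m m').
Qed.

(* [koszul_exact k q p]: in degree [q.+1], the reduction of the complex modulo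
   [z_0, ..., z_(k-1)] is exact at [F p] (at [F 0]: has no homology). *)
Definition koszul_exact k q p : Prop :=
  match p return Prop with
  | 0 => forall u : F 0, hvec q.+1 u -> exists (w : F 1) (h : 'I_n -> F 0),
      [/\ hvec q.+1 w, forall i, hvec q (h i)
        & u = phi C 0 *m w + \sum_(i : 'I_n | (i < k)%N) z i *: h i]
  | p'.+1 => forall (u : F p'.+1) (g : 'I_n -> F p'),
      hvec q.+1 u -> (forall i, hvec q (g i)) ->
      phi C p' *m u = \sum_(i : 'I_n | (i < k)%N) z i *: g i ->
      exists (w : F p'.+2) (h : 'I_n -> F p'.+1),
      [/\ hvec q.+1 w, forall i, hvec q (h i)
        & u = phi C p'.+1 *m w + \sum_(i : 'I_n | (i < k)%N) z i *: h i]
  end.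

Lemma koszul_exact0 q p : koszul_exact 0 q p.+1.
Proof.
move=> u g hu _; rewrite big1 // => /(hexact hu)[w hw e].
exists w, (fun=> 0); split=> // [i|]; first exact: hvec0.
by rewrite big1 ?addr0.
Qed.

Let sum_ltS k (kn : (k < n)%N) (V : lmodType S) (x : 'I_n -> V) :
  \sum_(i : 'I_n | (i < k.+1)%N) z i *: x i =
  z (Ordinal kn) *: x (Ordinal kn) + \sum_(i : 'I_n | (i < k)%N) z i *: x i.
Proof.
rewrite (bigD1 (Ordinal kn)) //=; congr (_ + _); apply: eq_bigl => i.
by rewrite ltnS -val_eqE /= ltn_neqAle andbC.
Qed.

(** Subtracting z_k w from u removes the z_k-term of its image and only changes the coefficients of
    the earlier forms. What remains is a cycle modulo z_0, ..., z_(k-1), to which exactness for k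
    applies. *)
Let step_core k (kn : (k < n)%N) q p (u : F p.+1) (g : 'I_n -> F p) (w : F p.+1)
    (h : 'I_n -> F p) :
  koszul_exact k q p.+1 -> hvec q.+1 u -> (forall i, hvec q (g i)) ->
  phi C p *m u = \sum_(i : 'I_n | (i < k.+1)%N) z i *: g i ->
  hvec q w -> (forall i, hvec q (z (Ordinal kn) *: h i)) ->
  g (Ordinal kn) = phi C p *m w + \sum_(i : 'I_n | (i < k)%N) z i *: h i ->
  exists (w : F p.+2) (h : 'I_n -> F p.+1),
      [/\ hvec q.+1 w, forall i, hvec q (h i)
        & u = phi C p.+1 *m w + \sum_(i : 'I_n | (i < k.+1)%N) z i *: h i].
Proof.
move=> ex hu hg; rewrite (sum_ltS kn) => uE hw hh gE.
set zk := z (Ordinal kn) in uE hh *.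
have hzw : hvec q.+1 (zk *: w) by exact: (hvecZ1 (z_hom _) hw).
have [] := ex (u - zk *: w) (fun i => g i + zk *: h i).
- exact: hvecB.
- by move=> i; apply: hvecD.
- rewrite mulmxBr uE gE -scalemxAr scalerDr -!addrA addrC -!addrA addNr addr0.
  rewrite scaler_sumr -big_split /=; apply: eq_bigr => i _.
  by rewrite scalerDr !scalerA mulrC addrC.
move=> w' [h' [hw' hh' uE']].
exists w', (fun i => if i == Ordinal kn then w else h' i); split=> // [i|].
  by case: ifP.
rewrite (sum_ltS kn) eqxx -/zk -[LHS](subrK (zk *: w)) uE' addrAC -addrA.
congr (_ + (_ + _)); apply: eq_bigr => i ik; case: eqP => // e.
by rewrite e ltnn in ik.
Qed.

Lemma hregular (k : 'I_n) p q (x : F p) (g : 'I_n -> F p) : hvec q.+1 x ->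
  z k *: x = \sum_(i : 'I_n | (i < k)%N) z i *: g i ->
  exists2 h : 'I_n -> F p, forall i, hvec q (h i) &
    x = \sum_(i : 'I_n | (i < k)%N) z i *: h i.
Proof.
move=> hx e.
have /fin_all_exists[h hE] l : exists h : 'I_n -> S,
    x l 0 = \sum_(i : 'I_n | (i < k)%N) z i * h i.
  apply: (@linear_regular _ _ z Z (fun i => (i < k)%N) k _ (fun i => g i l 0) uZ zE).
    by rewrite ltnn.
  move/matrixP: e => /(_ l 0); rewrite mxE summxE => ->.
  by apply: eq_bigr => i _; rewrite mxE.
exists (fun i => hproj q (\col_l h l i)); first by move=> i; apply: hproj_hvec.
rewrite -(hproj_id hx) (_ : x = \sum_(i : 'I_n | (i < k)%N) z i *: \col_l h l i).
  by rewrite hproj_sum; apply: eq_bigr => i _; rewrite hprojZ1.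
apply/matrixP => l j; rewrite (ord1 j) hE summxE.
by apply: eq_bigr => i _; rewrite !mxE.
Qed.

Let zkh (k : 'I_n) q p (h : 'I_n -> F p) : (forall i, hvec q (h i)) ->
  forall i, hvec q.+1 (z k *: h i).
Proof. by move=> hh i; apply: hvecZ1. Qed.

(** This is the portion H_(p+1)(k) -> H_(p+1)(k+1) -> H_p(k) of the long exact sequence of
    multiplication by z_k. The coefficient of z_k in the image of [u] represents the connecting
    class, whose degree is one less. *)
Lemma koszul_exactS k q p : (k < n)%N -> koszul_exact k q p ->
  koszul_exact k q.+1 p.+1 -> koszul_exact k.+1 q.+1 p.+1.
Proof.
move=> kn ex ex1 u g hu hg e.
suff [w [h [hw hh gE]]] : exists (w : F p.+1) (h : 'I_n -> F p),
    [/\ hvec q.+1 w, forall i, hvec q (h i)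
      & g (Ordinal kn) = phi C p *m w + \sum_(i : 'I_n | (i < k)%N) z i *: h i].
  exact: (step_core ex1 hu hg e hw (zkh hh) gE).
case: p ex ex1 u g hu hg e => [|p] ex _ u g hu hg e; first exact: ex.
(* The differential kills the left-hand side, so z_k times the image of g_k lies in the submodule
   generated by the earlier forms. On the free module z_k can be cancelled, and g_k is a cycle
   modulo the earlier forms. *)
have {}e : z (Ordinal kn) *: (phi C p *m g (Ordinal kn)) =
    \sum_(i : 'I_n | (i < k)%N) z i *: - (phi C p *m g i).
  move/(congr1 (mulmx (phi C p))): e; rewrite phi_phi (sum_ltS kn) mulmxDr -scalemxAr.
  move/esym/(canRL (addrK _)); rewrite sub0r => ->.
  rewrite mulmx_sumr -sumrN; apply: eq_bigr => i _.
  by rewrite -scalemxAr scalerN.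
have [h hh gE] := hregular (k := Ordinal kn) (hvec_phi (hg _)) e.
exact: ex (hg _) hh gE.
Qed.

(** [F 0] may still have homology modulo the first k forms, so the long exact sequence does not
    settle this case. Instead z_k is cancelled in the quotient of S by I and the earlier forms,
    using [regular_mod]. *)
Lemma koszul_exact_le3 k q : (k <= r)%N -> (k <= n)%N -> (3 <= q)%N ->
  koszul_exact k q 1.
Proof.
elim: k => [|k IH] kr kn q3; first exact: koszul_exact0.
move=> u g hu hg e.
have I0 (f : S) : I f -> exists w : F 1, forall m : 'I_(rk C 0), f = (phi C 0 *m w) m ord0.
  by move/phi0.
case: q q3 IH hu hg e => [//|q] q3 IH hu hg e.
suff [w [h [hw hh gE]]] : exists (w : F 1) (h : 'I_n -> F 0),
    [/\ hvec q.+1 w, forall i, hvec q (h i)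
      & g (Ordinal kn) = phi C 0 *m w + \sum_(i : 'I_n | (i < k)%N) z i *: h i].
  by apply: (step_core _ hu hg e hw (zkh hh) gE); apply: IH => //; exact: ltnW.
have /fin_all_exists[g' hg'] (m : 'I_(rk C 0)) : exists g' : 'I_n -> S,
    I (g (Ordinal kn) m 0 - \sum_(i : 'I_n | (i < k)%N) z i * g' i).
  apply: (@regular_mod (Ordinal kn) _ (fun i => - g i m 0) kr).
  have : I ((phi C 0 *m u) m 0) by exact: ((im_phi0 _).2 (ex_intro _ u erefl)).
  rewrite e (sum_ltS kn) mxE [in X in _ + X]summxE mxE.
  by rewrite -sumrN; under [X in _ -> I (_ + X)]eq_bigr => i _ do rewrite mulrN opprK;
    under [X in I (_ + X) -> _]eq_bigr => i _ do rewrite mxE.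
pose gg i : F 0 := \col_m g' m i.
have /im_phi0[w wE] : forall m,
    I ((g (Ordinal kn) - \sum_(i : 'I_n | (i < k)%N) z i *: gg i) m 0).
  move=> m; move: (hg' m); rewrite mxE [in X in _ -> I (_ + X)]mxE summxE.
  by under [X in _ -> I (_ - X)]eq_bigr => i _ do rewrite !mxE.
exists (hproj q.+1 w), (fun i => hproj q (gg i)); split.
- exact: hproj_hvec.
- by move=> i; apply: hproj_hvec.
rewrite -(hproj_id (hg _)) -(subrK (\sum_(i : 'I_n | (i < k)%N) z i *: gg i) (g (Ordinal kn))).
rewrite wE hprojD hproj_phi hproj_sum; congr (_ + _).
by apply: eq_bigr => i _; rewrite hprojZ1.
Qed.

Lemma koszul_exact_r q : (2 <= q)%N -> koszul_exact r q 0.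
Proof.
move=> q2 u hu.
have /fin_all_exists[g' hg'] (m : 'I_(rk C 0)) : exists g' : 'I_n -> S,
    I (u m 0 - \sum_(i : 'I_n | (i < r)%N) z i * g' i).
  apply: (artinian_mod q2); apply/dhomogP => a /hu.
  by rewrite sh0 addn0.
pose gg i : F 0 := \col_m g' m i.
have /im_phi0[w wE] : forall m,
    I ((u - \sum_(i : 'I_n | (i < r)%N) z i *: gg i) m 0).
  move=> m; move: (hg' m); rewrite mxE [in X in _ -> I (_ + X)]mxE summxE.
  by under [X in _ -> I (_ - X)]eq_bigr => i _ do rewrite !mxE.
exists (hproj q.+1 w), (fun i => hproj q (gg i)); split.
- exact: hproj_hvec.
- by move=> i; apply: hproj_hvec.
rewrite -(hproj_id hu) -(subrK (\sum_(i : 'I_n | (i < r)%N) z i *: gg i) u).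
rewrite wE hprojD hproj_phi hproj_sum; congr (_ + _).
by apply: eq_bigr => i _; rewrite hprojZ1.
Qed.

Lemma koszul_exact_low k q p : (k <= r)%N -> (k <= n)%N -> (p + 3 <= q)%N ->
  koszul_exact k q p.+1.
Proof.
elim: k q p => [|k IH] q p kr kn pq; first exact: koszul_exact0.
case: p pq => [|p] pq; first exact: koszul_exact_le3.
case: q pq => [//|q] pq; apply: koszul_exactS => //; apply: IH; lia.
Qed.

(** At k = r the range comes from [koszul_exact_r] for p = 0 and from [koszul_exact_low] for larger
    p. Each further form preserves it, since [koszul_exactS] raises p and q together. *)
Lemma koszul_exact_high k q p : (r <= k)%N -> (k <= n)%N -> (p + 2 <= q)%N ->
  koszul_exact k q p.
Proof.
elim: k q p => [|k IH] q p rek kn pq.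
  case: p pq => [|p] pq; last exact: koszul_exact0.
  have r0 : r = 0%N by lia.
  by have := @koszul_exact_r q; rewrite r0; apply; lia.
move: rek; rewrite leq_eqVlt => /orP[/eqP e|rek].
  case: p pq => [|p] pq; last by apply: koszul_exact_low; lia.
  by rewrite -e; apply: koszul_exact_r; lia.
case: p pq => [|p] pq.
  move=> u /(IH _ _ _ (ltnW kn) pq)-[//|w [h [hw hh uE]]].
  exists w, (fun i : 'I_n => if (i < k)%N then h i else 0); split=> // [i|].
    by case: ifP => // _; apply: hvec0.
  rewrite (sum_ltS kn) /= ltnn scaler0 add0r uE; congr (_ + _).
  by apply: eq_bigr => i ->.
case: q pq => [//|q] pq; apply: koszul_exactS => //; apply: IH => //; lia.
Qed.

(** Modulo all n forms the differential is zero by minimality, so every basis vector is a cycle.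
    Exactness in its degree would make it a boundary plus multiples of the z_i, and such a vector
    has no constant term. *)
Theorem sh_le p (l : 'I_(rk C p)) : (r <= n)%N -> (sh l <= p + 2)%N.
Proof.
move=> rn; case: p l => [|p] l; first by rewrite sh0.
rewrite leqNgt; apply/negP => lt.
case E : (sh l) => [|q]; first by rewrite E in lt.
have [g [hg gE]] : exists g : 'I_n -> F p, (forall i, hvec q (g i)) /\
    phi C p *m basis_vec l = \sum_(i : 'I_n | (i < n)%N) z i *: g i.
  have /fin_all_exists[h hE] a : exists h : 'I_n -> S,
      (phi C p *m basis_vec l) a 0 = \sum_i z i * h i.
    have [h hE] : exists h : 'I_n -> S, (phi C p *m basis_vec l) a 0 = \sum_i 'X_i * h i.
      apply: (@var_idealP _ _ predT) => m hm.
      rewrite -colE mxE in hm; have [_] := phi_supp hm.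
      rewrite lt0n mdeg_eq0 => /eqP m0.
      have [/existsP[i mi]|/existsPn none] := boolP [exists i, m i != 0%N]; first by exists i.
      by case: m0; apply/mnmP => i; rewrite mnm0E; have := none i; rewrite negbK => /eqP.
    exists (fun i => \sum_j (invmx Z) j i *: h j); rewrite hE.
    under [RHS]eq_bigr => i _ do rewrite mulr_sumr.
    rewrite exchange_big /=; apply: eq_bigr => j _.
    transitivity ((\sum_i (invmx Z) j i *: z i) * h j); last first.
      by rewrite mulr_suml; apply: eq_bigr => i _; rewrite -scalerAl -scalerAr.
    congr (_ * _); under eq_bigr => i _ do rewrite zE scaler_sumr.
    rewrite exchange_big /= (bigD1 j) //= [X in _ + X]big1 => [|i ij].
      have /matrixP/(_ j j) := mulVmx uZ; rewrite !mxE eqxx => e.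
      by rewrite addr0 -[LHS]scale1r -[X in X *: _]e scaler_suml; apply: eq_bigr => i _; rewrite scalerA.
    have /matrixP/(_ j i) := mulVmx uZ; rewrite !mxE eq_sym (negbTE ij) mulr0n => e.
    by rewrite -[RHS](scale0r 'X_i) -e scaler_suml; apply: eq_bigr => l' _; rewrite scalerA.
  exists (fun i => hproj q (\col_a h a i)); split; first by move=> i; apply: hproj_hvec.
  have hb : hvec q.+1 (phi C p *m basis_vec l).
    by apply: hvec_phi; rewrite -E; apply: hvec_basis.
  rewrite -(hproj_id hb) (_ : phi C p *m basis_vec l = \sum_(i : 'I_n | (i < n)%N) z i *: \col_a h a i).
    by rewrite hproj_sum; apply: eq_bigr => i _; rewrite hprojZ1.
  apply/matrixP => a j; rewrite (ord1 j) hE summxE.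
  by apply: eq_big => [i|i _]; rewrite ?ltn_ord // !mxE.
have pq : (p.+1 + 2 <= q)%N by rewrite -ltnS -E.
have hl : hvec q.+1 (basis_vec l) by rewrite -E; apply: hvec_basis.
have [w [h [_ _]]] := @koszul_exact_high n q p.+1 rn (leqnn n) pq _ g hl hg gE.
move=> /matrixP/(_ l 0)/(congr1 (mcoeff 0%MM)).
rewrite mxE !eqxx mcoeff1 eqxx mxE mcoeffD phi_mcoeff0 add0r summxE raddf_sum big1 /=.
  by move/eqP; rewrite oner_eq0.
move=> i _; rewrite mxE rmorphM /=.
rewrite (_ : (z i)@_0%MM = 0) ?mul0r //; apply: memN_msupp_eq0; apply/negP.
by move/(dhomog_mdeg (z_hom i)); rewrite mdeg0.
Qed.

End Chain.
End GradedComplex.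
Arguments hvec_basis [K n C p] l.

(** * Lower bounds on the shifts *)

Section ShiftLowerBounds.
Variables (K : fieldType) (n : nat).
Local Notation S := {mpoly K[n]}.
Variable (C : graded_free_complex K n).
Local Notation F p := 'cV[S]_(rk C p).
Hypothesis phi_hom : forall p (m : 'I_(rk C p)) (l : 'I_(rk C p.+1)),
  phi C p m l \is (sh l - sh m)%N.-homog /\
  ((sh l < sh m)%N -> phi C p m l = 0) /\
  mcoeff 0%MM (phi C p m l) = 0.
Hypothesis phi_exact : forall p (u : F p.+1),
  phi C p *m u = 0 <-> exists w : F p.+2, u = phi C p.+1 *m w.
Variable I : S -> Prop.
Hypothesis rk0 : rk C 0 = 1%N.
Hypothesis sh0 : forall l : 'I_(rk C 0), sh l = 0%N.
Hypothesis phi0 : forall f : S, I f <->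
  exists w : F 1, forall m : 'I_(rk C 0), f = (phi C 0 *m w) m ord0.
Hypothesis I_low : forall q (f : S), (q < 2)%N -> f \is q.-homog -> I f -> f = 0.

Let phiI (w : F 1) (m : 'I_(rk C 0)) : I ((phi C 0 *m w) m 0).
Proof. exact: ((im_phi0 rk0 phi0 _).2 (ex_intro _ w erefl)). Qed.

Lemma sh1_ge (l : 'I_(rk C 1)) : (2 <= sh l)%N.
Proof.
rewrite leqNgt; apply/negP => lt; have /eqP := phi_col_neq0 phi_hom phi_exact l.
apply; apply/matrixP => m j; rewrite (ord1 j) [RHS]mxE; apply: (I_low lt); last exact: phiI.
apply/dhomogP => a /(hvec_phi phi_hom (hvec_basis l)).
by rewrite sh0 addn0.
Qed.

Lemma sh_lt p (l : 'I_(rk C p.+1)) : exists2 a : 'I_(rk C p), phi C p a l != 0 & (sh a < sh l)%N.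
Proof.
have [/existsP[a nz]|/existsPn none] := boolP [exists a, phi C p a l != 0].
  exists a => //; case E : (msupp (phi C p a l)) => [|m s].
    by rewrite -msupp_eq0 E in nz.
  have [|e m0] := @phi_supp _ _ _ phi_hom _ a l m; first by rewrite E mem_head.
  by rewrite -e; lia.
have /eqP[] := phi_col_neq0 phi_hom phi_exact l.
apply/matrixP => a j; rewrite -colE !mxE; apply/eqP.
by have := none a; rewrite negbK.
Qed.

Variables (N : nat) (Q : 'I_N -> S).
Hypothesis Q_span : forall f, f \is 2.-homog -> I f ->
  exists c : 'I_N -> K, f = \sum_k c k *: Q k.
Hypothesis Q_nolin : forall L : 'I_N -> S, (forall k, L k \is 1.-homog) ->
  \sum_k L k * Q k = 0 -> forall k, L k = 0.

(** A column of degree 3 is a linear syzygy of quadrics in I. Rewritten in the [Q k], its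
    coefficients vanish by [Q_nolin]. Their parts at a fixed monomial then give a constant relation
    between columns of [phi C 0], that is, a boundary with a nonzero constant term. *)
Lemma sh2_ge (l : 'I_(rk C 2)) : (4 <= sh l)%N.
Proof.
have [a nz /= lt] := sh_lt l; have ge2 := sh1_ge.
rewrite leqNgt; apply/negP => lt4.
have sl : sh l = 3 by have := ge2 a; lia.
have m0 : 'I_(rk C 0) by rewrite rk0; exact: ord0.
have hu b : phi C 1 b l != 0 -> sh b = 2.
  move=> bz; case E : (msupp (phi C 1 b l)) => [|m s].
    by rewrite -msupp_eq0 E in bz.
  have [|e m1] := @phi_supp _ _ _ phi_hom _ b l m; first by rewrite E mem_head.
  by have := ge2 b; lia.
have hlin b : phi C 1 b l \is 1.-homog.
  have [->|/hu b2] := eqVneq (phi C 1 b l) 0; first exact: rpred0.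
  by have [] := phi_hom b l; rewrite sl b2.
(* [A b] writes a generator of degree 2 through the [Q k]. Generators of other degrees do not meet
   column [l] and get the default 0. *)
have /fin_all_exists[A hA] b : exists c : 'I_N -> K,
    sh b = 2 -> phi C 0 m0 b = \sum_k c k *: Q k.
  case: (eqVneq (sh b) 2) => [b2|nb]; last by exists (fun=> 0) => e; rewrite e eqxx in nb.
  have [||c hc] := @Q_span (phi C 0 m0 b).
  - by have [] := phi_hom m0 b; rewrite b2 sh0.
  - by have := phiI (basis_vec b) m0; rewrite -colE mxE.
  by exists c.
have : (phi C 0 *m (phi C 1 *m basis_vec l)) m0 0 = 0.
  by rewrite (phi_phi phi_exact) mxE.
rewrite mxE => syz.
have {}syz : \sum_k (\sum_b A b k *: phi C 1 b l) * Q k = 0.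
  rewrite -[RHS]syz; under eq_bigr => k _ do rewrite mulr_suml.
  rewrite exchange_big /=; apply: eq_bigr => b _; rewrite -colE mxE.
  have [->|/hu/hA ->] := eqVneq (phi C 1 b l) 0.
    by rewrite mulr0 big1 // => k _; rewrite scaler0 mul0r.
  by rewrite mulr_suml; apply: eq_bigr => k _; rewrite -!scalerAl mulrC.
have zero := Q_nolin (fun k => rpred_sum _ (fun b _ => rpredZ _ (hlin b))) syz.
suff : phi C 1 a l = 0 by move/eqP; rewrite (negbTE nz).
apply/mpolyP => m; rewrite mcoeff0.
have [ma|] := boolP (m \in msupp (phi C 1 a l)); last exact: memN_msupp_eq0.
have [w hw] : exists w : F 2, \col_b ((phi C 1 b l)@_m)%:MP = phi C 1 *m w.
  apply/phi_exact; apply/matrixP => m' j.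
  have -> : m' = m0.
    by move: m' m0 {hA syz}; case: (rk C 0) rk0 => // -[|//] _ x y; rewrite (ord1 x) (ord1 y).
  rewrite !mxE; transitivity (\sum_k (\sum_b A b k *: phi C 1 b l)@_m *: Q k); last first.
    by apply: big1 => k _; rewrite zero mcoeff0 scale0r.
  under [RHS]eq_bigr => k _ do rewrite raddf_sum scaler_suml.
  rewrite exchange_big /=; apply: eq_bigr => b _; rewrite mxE mulrC mul_mpolyC.
  have [->|/hu/hA ->] := eqVneq (phi C 1 b l) 0.
    by rewrite mcoeff0 scale0r big1 // => k _; rewrite scaler0 mcoeff0 scale0r.
  by rewrite scaler_sumr; apply: eq_bigr => k _; rewrite mcoeffZ scalerA mulrC.
by have := phi_mcoeff0 phi_hom w a; rewrite -hw mxE mcoeffC eqxx mulr1.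
Qed.

Lemma sh_ge p (l : 'I_(rk C p)) : (2 <= p)%N -> (p + 2 <= sh l)%N.
Proof.
case: p l => [|[|p]] l // _; elim: p l => [|p IH] l; first exact: sh2_ge.
by have [a _] := sh_lt l; have := IH a; lia.
Qed.

End ShiftLowerBounds.

(** * Dimensions of the graded pieces of a resolution *)

Lemma card_monomials n b c : (0 < n)%N -> (c < b)%N ->
  #|[set m : 'X_{1..n < b} | mdeg m == c]| = 'C(c + n.-1, c).
Proof.
case: n => // n _ cb; rewrite -(size_basis n c) cardE -(size_map val).
apply/perm_size/uniq_perm.
- by rewrite map_inj_uniq ?enum_uniq //; apply: val_inj.
- exact: uniq_basis.
move=> m; rewrite -basis_cover; apply/mapP/idP => [[x + ->]|mc].
  by rewrite mem_enum inE.
have mb : (mdeg m < b)%N by rewrite (eqP mc).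
by exists (BMultinom mb) => //; rewrite mem_enum inE.
Qed.

Section EulerCharacteristic.
Variables (K : fieldType) (n : nat).
Local Notation S := {mpoly K[n]}.
Variable (C : graded_free_complex K n).
Local Notation F p := 'cV[S]_(rk C p).
Hypothesis phi_hom : forall p (m : 'I_(rk C p)) (l : 'I_(rk C p.+1)),
  phi C p m l \is (sh l - sh m)%N.-homog /\
  ((sh l < sh m)%N -> phi C p m l = 0) /\
  mcoeff 0%MM (phi C p m l) = 0.
Hypothesis phi_exact : forall p (u : F p.+1),
  phi C p *m u = 0 <-> exists w : F p.+2, u = phi C p.+1 *m w.
Variable q : nat.

(** Labels of the monomial basis of the degree-q part of [F p]; the bound on the monomials makes the
    type finite and excludes none of degree at most q. *)
Definition gr_index p : {set 'I_(rk C p) * 'X_{1..n < q.+1}} :=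
  [set x : 'I_(rk C p) * 'X_{1..n < q.+1} | (mdeg x.2 + sh x.1 == q)%N].

Local Notation gdim p := #|gr_index p|.

Definition gr_enc p (u : F p) : 'rV[K]_(gdim p) :=
  \row_(j < gdim p) (u (enum_val j).1 0)@_(enum_val j).2.
Definition gr_vec p (j : 'I_(gdim p)) : F p := 'X_[(enum_val j).2] *: basis_vec (enum_val j).1.
Definition gr_dec p (y : 'rV[K]_(gdim p)) : F p := \sum_j (y 0 j)%:MP *: gr_vec j.

Lemma gr_dec_hvec p (y : 'rV[K]_(gdim p)) : hvec q (gr_dec y).
Proof.
apply: hvec_sum => j; apply: hvecC.
have := enum_valP j; rewrite inE => /eqP e.
have := hvecZ _ (hvec_basis (enum_val j).1) (z := 'X_[(enum_val j).2]) (c := mdeg (enum_val j).2).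
by rewrite e; apply; rewrite dhomogX.
Qed.

Arguments gr_dec_hvec [p] y.

Lemma gr_decK p : cancel (@gr_dec p) (@gr_enc p).
Proof.
move=> y; apply/rowP => j; rewrite mxE summxE raddf_sum (bigD1 j) //= big1 => [|i ij].
  by rewrite !mxE !eqxx mulr1 mcoeffCM mcoeffX eqxx mulr1 addr0.
rewrite !mxE andbT mcoeffCM; case: eqP => [e|_]; last by rewrite mulr0 mcoeff0 mulr0.
rewrite mulr1 mcoeffX; case: eqP => [e'|_]; last by rewrite mulr0.
case/eqP: ij; apply: enum_val_inj; apply/eqP; rewrite -pair_eqE /= e eqxx /=.
by apply/eqP/val_inj.
Qed.

Lemma gr_enc_inj p (u v : F p) : hvec q u -> hvec q v -> gr_enc u = gr_enc v -> u = v.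
Proof.
move=> hu hv /rowP e; apply/matrixP => l j; rewrite (ord1 j); apply/mpolyP => m.
have [ml|ml] := eqVneq (mdeg m + sh l)%N q; last first.
  rewrite !memN_msupp_eq0 //; apply/negP.
    by move/hv/eqP; rewrite (negbTE ml).
  by move/hu/eqP; rewrite (negbTE ml).
have mq : (mdeg m < q.+1)%N by rewrite ltnS -ml leq_addr.
have xin : (l, BMultinom mq) \in gr_index p by rewrite inE /= ml.
by have := e (enum_rank_in xin (l, BMultinom mq)); rewrite !mxE enum_rankK_in.
Qed.

Lemma gr_encK p (u : F p) : hvec q u -> gr_dec (gr_enc u) = u.
Proof. by move=> hu; apply: gr_enc_inj (gr_dec_hvec _) hu _; rewrite gr_decK. Qed.

Lemma gr_encD p (u v : F p) : gr_enc (u + v) = gr_enc u + gr_enc v.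
Proof. by apply/rowP => j; rewrite !mxE raddfD. Qed.

Lemma gr_enc_sum p (J : finType) (c : J -> K) (u : J -> F p) :
  gr_enc (\sum_j (c j)%:MP *: u j) = \sum_j c j *: gr_enc (u j).
Proof.
apply/rowP => i; rewrite mxE !summxE raddf_sum; apply: eq_bigr => j _.
by rewrite !mxE /= mcoeffCM.
Qed.

Definition gr_phi p : 'M[K]_(gdim p.+1, gdim p) :=
  \matrix_j gr_enc (phi C p *m gr_vec j).

Lemma gr_phiE p (y : 'rV[K]_(gdim p.+1)) :
  y *m gr_phi p = gr_enc (phi C p *m gr_dec y).
Proof.
rewrite mulmx_sum_row mulmx_sumr.
under [X in _ = gr_enc X]eq_bigr => j _ do rewrite -scalemxAr.
by rewrite gr_enc_sum; apply: eq_bigr => j _; rewrite rowK.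
Qed.

Lemma gr_phi_ker p : (kermx (gr_phi p) :=: gr_phi p.+1)%MS.
Proof.
apply/eqmxP/andP; split; apply/rV_subP => y.
  move=> /sub_kermxP; rewrite gr_phiE => e.
  have {}e : phi C p *m gr_dec y = 0.
    apply: (gr_enc_inj (hvec_phi phi_hom (gr_dec_hvec _))); first exact: hvec0.
    by rewrite e; apply/rowP => j; rewrite !mxE mcoeff0.
  have [w hw wE] := hexact phi_hom phi_exact (gr_dec_hvec y) e.
  apply/submxP; exists (gr_enc w).
  by rewrite gr_phiE (gr_encK hw) -wE gr_decK.
move=> /submxP[x ->]; apply/sub_kermxP; rewrite !gr_phiE gr_encK; last first.
  exact: (hvec_phi phi_hom (gr_dec_hvec _)).
by rewrite (phi_phi phi_exact); apply/rowP => j; rewrite !mxE mcoeff0.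
Qed.

Lemma gdim_rank p : gdim p.+1 = (\rank (gr_phi p) + \rank (gr_phi p.+1))%N.
Proof. by rewrite -(gr_phi_ker p) mxrank_ker subnKC ?rank_leq_row. Qed.

Variable I : S -> Prop.
Hypothesis rk0 : rk C 0 = 1%N.
Hypothesis sh0 : forall l : 'I_(rk C 0), sh l = 0%N.
Hypothesis phi0 : forall f : S, I f <->
  exists w : F 1, forall m : 'I_(rk C 0), f = (phi C 0 *m w) m ord0.
Variables (W : finType) (b : W -> S).
Hypothesis b_hom : forall w, b w \is q.-homog.
Hypothesis b_span : forall f : S, f \is q.-homog ->
  exists y : W -> K, I (f - \sum_w y w *: b w).
Hypothesis b_free : forall y : W -> K, I (\sum_w y w *: b w) -> forall w, y w = 0.

(** The span of the [b w] is a complement of the image of [gr_phi 0]: [b_free] makes the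
    intersection trivial, [b_span] makes the sum everything. *)
Lemma gdim0_rank : gdim 0 = (#|W| + \rank (gr_phi 0))%N.
Proof.
(* [const_mx] fills the only coordinate of [F 0] without a transport along [rk C 0 = 1]. *)
pose bc w : F 0 := const_mx (b w).
have hbc w : hvec q (bc w).
  by move=> l m; rewrite mxE sh0 addn0 => /(dhomog_mdeg (b_hom w)).
pose B := \matrix_(i < #|W|) gr_enc (bc (enum_val i)).
have BE (y : 'rV_#|W|) : gr_dec (y *m B) =
    \sum_w (y 0 (enum_rank w))%:MP *: bc w.
  rewrite -[RHS]gr_encK; last first.
    by apply: hvec_sum => w; apply: hvecC.
  congr gr_dec; rewrite gr_enc_sum mulmx_sum_row (reindex (fun i : 'I_#|W| => enum_val i)) /=; last first.
    exact: onW_bij (enum_val_bij _).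
  by apply: eq_bigr => i _; rewrite enum_valK rowK.
have free (y : 'rV_#|W|) x : y *m B = x *m gr_phi 0 -> y = 0.
  rewrite gr_phiE => /(congr1 (@gr_dec _)); rewrite gr_encK; last first.
    exact: (hvec_phi phi_hom (gr_dec_hvec _)).
  rewrite BE => e; apply/rowP => i; rewrite mxE -(enum_valK i).
  apply: (b_free (y := fun w => y 0 (enum_rank w))).
  have m0 : 'I_(rk C 0) by rewrite rk0; exact: ord0.
  have := ((im_phi0 rk0 phi0 _).2 (ex_intro _ (gr_dec x) e)) m0.
  rewrite summxE; congr (I _); apply: eq_bigr => w _.
  by rewrite !mxE mul_mpolyC.
have cap0 : \rank (B :&: gr_phi 0)%MS = 0%N.
  apply/eqP; rewrite mxrank_eq0 -submx0; apply/rV_subP => v.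
  rewrite sub_capmx => /andP[/submxP[y yE] /submxP[x xE]].
  by rewrite yE (free y x) ?mul0mx ?sub0mx // -yE.
have rB : \rank B = #|W|.
  apply/eqP; rewrite -[_ == _]/(row_free B) -kermx_eq0 -submx0; apply/rV_subP => v.
  move=> /sub_kermxP e; rewrite (free v 0) ?sub0mx // e.
  by rewrite mul0mx.
have full : \rank (B + gr_phi 0)%MS = gdim 0.
  apply/eqP; rewrite -[_ == _]/(row_full _) -sub1mx; apply/rV_subP => v _.
  have m0 : 'I_(rk C 0) by rewrite rk0; exact: ord0.
  have one m : m = m0.
    by clear -rk0; case: (rk C 0) rk0 m m0 => // -[|//] _ x y; rewrite (ord1 x) (ord1 y).
  have [|y hy] := @b_span (gr_dec v m0 0).
    by apply/dhomogP => m /(gr_dec_hvec v); rewrite sh0 addn0.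
  pose yr := \row_(i < #|W|) y (enum_val i).
  have hyr : hvec q (gr_dec v - gr_dec (yr *m B)).
    by apply: hvecB; apply: gr_dec_hvec.
  have [w wE] : exists w, gr_dec v - gr_dec (yr *m B) = phi C 0 *m w.
    apply/(im_phi0 rk0 phi0) => m; rewrite (one m) BE.
    move: hy; congr (I _); rewrite !mxE; congr (_ - _).
    by rewrite summxE; apply: eq_bigr => x _; rewrite !mxE enum_rankK mul_mpolyC.
  have {}wE : gr_dec v = gr_dec (yr *m B) + phi C 0 *m hproj q w.
    rewrite -hproj_phi // -wE hproj_id //.
    by rewrite addrC subrK.
  have -> : v = yr *m B + gr_enc (hproj q w) *m gr_phi 0.
    apply: (can_inj (@gr_decK 0)); rewrite wE gr_phiE gr_encK; last exact: hproj_hvec.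
    apply: gr_enc_inj; last 1 first.
    - by rewrite gr_decK gr_encD gr_decK.
    - by apply: hvecD; [apply: gr_dec_hvec | apply: (hvec_phi phi_hom); apply: hproj_hvec].
    - exact: gr_dec_hvec.
  by rewrite addmx_sub_adds // submxMl.
by have := mxrank_sum_cap B (gr_phi 0); rewrite cap0 rB full addn0.
Qed.

Hypothesis sh_ge_p : forall p (l : 'I_(rk C p)), (p <= sh l)%N.

(** The rank identities telescope. What is left over is the rank of [gr_phi q], whose source, the
    degree-q part of [F q.+1], is zero because the shifts there are at least q + 1. *)
Lemma euler_gdim : \sum_(p < q.+1) (-1) ^+ p * (gdim p)%:Z = #|W|%:Z.
Proof.
have partial t : \sum_(p < t.+1) (-1) ^+ p * (gdim p)%:Z =
    #|W|%:Z + (-1) ^+ t * (\rank (gr_phi t))%:Z.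
  elim: t => [|t IH]; first by rewrite big_ord1 !expr0 !mul1r -PoszD (congr1 Posz gdim0_rank).
  rewrite big_ord_recr IH /= (congr1 Posz (gdim_rank t)) PoszD exprS; ring.
rewrite partial; suff -> : \rank (gr_phi q) = 0%N by rewrite mulr0 addr0.
apply/eqP; rewrite -leqn0 (leq_trans (rank_leq_row _)) // leqn0 cards_eq0.
apply/eqP/setP => x; rewrite !inE; apply/eqP => e.
by have := sh_ge_p x.1; move: e; set a := sh _; set c := mdeg _; lia.
Qed.

Hypothesis n_gt0 : (0 < n)%N.

Lemma gdimE p : gdim p = (\sum_(j < q.+1) betti C p j * 'C(q - j + n.-1, q - j))%N.
Proof.
have -> : gdim p = (\sum_(l < rk C p) \sum_(m : 'X_{1..n < q.+1} | (mdeg m + sh l == q)%N) 1)%N.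
  rewrite pair_big_dep -sum1_card; apply: eq_bigl => x; by rewrite inE.
have -> : (\sum_(j < q.+1) betti C p j * 'C(q - j + n.-1, q - j) =
    \sum_(l < rk C p) \sum_(j < q.+1 | sh l == j) 'C(q - j + n.-1, q - j))%N.
  rewrite (exchange_big_dep predT) //=; apply: eq_bigr => j _.
  by rewrite -sum_nat_const; apply: eq_bigl => l; rewrite inE.
apply: eq_bigr => l _; rewrite sum1_card.
have [le|lt] := leqP (sh l) q; last first.
  rewrite big1 => [|j /eqP e]; last by have := ltn_ord j; rewrite -e; lia.
  by apply: eq_card0 => m; rewrite unfold_in; apply/eqP => e; lia.
rewrite (big_pred1 (Ordinal (le : (sh l < q.+1)%N))) /= => [|j]; last by rewrite eq_sym.
rewrite -(@card_monomials n q.+1 (q - sh l)) ?ltnS ?leq_subr //.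
apply: eq_card => m; rewrite inE unfold_in /=.
set c := mdeg _; set a := sh _ in le *; apply/eqP/eqP; lia.
Qed.

End EulerCharacteristic.

(* Generating functions: multiplication by [1 - t] is the backward difference. *)
Definition bdiff (f : nat -> int) q : int := f q - (if q is q'.+1 then f q' else 0).

Definition conv (a f : nat -> int) q : int := \sum_(j < q.+1) a j * f (q - j)%N.

Lemma conv_bdiffr a f q : conv a (bdiff f) q = bdiff (conv a f) q.
Proof.
rewrite /conv /bdiff; case: q => [|q]; first by rewrite !big_ord1 !subr0.
rewrite big_ord_recr [in RHS]big_ord_recr /= subnn subr0 addrAC -sumrB.
congr (_ + _); apply: eq_bigr => i _.
by rewrite subSn ?mulrBr // -ltnS.
Qed.

Lemma conv_bdiffl a f q : conv (bdiff a) f q = bdiff (conv a f) q.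
Proof.
rewrite /conv /bdiff; case: q => [|q]; first by rewrite !big_ord1 !subr0.
rewrite big_ord_recl [in RHS]big_ord_recl /= subr0 -addrA -sumrB; congr (_ + _).
by apply: eq_bigr => i _; rewrite mulrBl.
Qed.

(** A power series with constant term 1 can be cancelled; by strong induction only the top term of
    each convolution is new. *)
Lemma conv_inj (a a' f : nat -> int) : f 0%N = 1 -> (forall q, conv a f q = conv a' f q) ->
  forall q, a q = a' q.
Proof.
move=> f0 e; apply: ltn_ind => q IH; have := e q.
rewrite /conv !big_ord_recr /= subnn f0 !mulr1.
by rewrite (eq_bigr (fun j : 'I_q => a' j * f (q - j)%N)) => [/addrI|i _] //; rewrite IH.
Qed.

Lemma bdiff_binomial n q :
  bdiff (fun m => ('C(m + n.+1, m))%:Z) q = ('C(q + n, q))%:Z.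
Proof.
rewrite /bdiff; case: q => [|q]; first by rewrite !bin0.
by rewrite addnS binS addSnnS PoszD addrK.
Qed.

Lemma alt_binomial_bdiff n q :
  bdiff (fun j => (-1) ^+ j * ('C(n, j))%:Z) q = (-1) ^+ q * ('C(n.+1, q))%:Z.
Proof.
rewrite /bdiff; case: q => [|q]; first by rewrite !bin0 subr0.
by rewrite binS PoszD exprS; ring.
Qed.

Lemma eq_conv a a' f f' : a =1 a' -> f =1 f' -> conv a f =1 conv a' f'.
Proof. by move=> ea ef q; apply: eq_bigr => j _; rewrite ea ef. Qed.

(** In generating functions, (1-t)^n / (1-t)^(n+3) = (1-t)^(-3). The induction moves one factor 1 -
    t across the convolution. *)
Lemma alt_binomial_conv n q :
  conv (fun j => (-1) ^+ j * ('C(n, j))%:Z) (fun m => ('C(m + n.+2, m))%:Z) q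
  = ('C(q.+2, 2))%:Z.
Proof.
elim: n q => [|n IH] q.
  rewrite /conv big_ord_recl big1 ?addr0 => [|i _]; last by rewrite bin0n mulr0 mul0r.
  rewrite bin0 subn0 expr0 !mul1r addn2; congr Posz.
  by rewrite -[RHS](@bin_sub q.+2 2) // !subSS subn0.
rewrite -IH -(eq_conv (alt_binomial_bdiff n) (fun=> erefl)) conv_bdiffl -conv_bdiffr.
exact/eq_conv/bdiff_binomial.
Qed.

Definition shift_seq (f : nat -> int) q : int := if q is q'.+1 then f q' else 0.

Lemma conv_shift a f q : conv (shift_seq a) f q = shift_seq (conv a f) q.
Proof.
rewrite /conv; case: q => [|q]; first by rewrite big_ord1 mul0r.
by rewrite big_ord_recl mul0r add0r.
Qed.

Lemma convD a b f q : conv (fun j => a j + b j) f q = conv a f q + conv b f q.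
Proof. by rewrite -big_split; apply: eq_bigr => j _; rewrite mulrDl. Qed.

Lemma convZ c a f q : conv (fun j => c * a j) f q = c * conv a f q.
Proof. by rewrite /conv mulr_sumr; apply: eq_bigr => j _; rewrite mulrA. Qed.

(** The coefficients of (1-t)^n (1 + n t + C(n,2) t^2) with n = d - 3. The second factor counts the
    basis monomials of degrees 0, 1, 2. *)
Definition betti_seq n : nat -> int :=
  let a j := (-1) ^+ j * ('C(n, j))%:Z in
  fun j => a j + (n%:Z * shift_seq a j + ('C(n, 2))%:Z * shift_seq (shift_seq a) j).

Lemma betti_seq_conv n q :
  conv (betti_seq n) (fun m => ('C(m + n.+2, m))%:Z) q =
  ('C(q.+2, 2) + n * 'C(q.+1, 2) + 'C(n, 2) * 'C(q, 2))%:Z.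
Proof.
rewrite /betti_seq convD convD !convZ !conv_shift alt_binomial_conv.
rewrite -addnA !PoszD !PoszM; congr (_ + (_ * _ + _ * _)).
  by case: q => [|q] //=; rewrite alt_binomial_conv.
by case: q => [|[|q]] //=; rewrite conv_shift //= alt_binomial_conv.
Qed.

(** * Betti numbers from the Hilbert function *)

Section BettiNumbers.
Variables (K : fieldType) (n : nat).
Local Notation S := {mpoly K[n.+3]}.
Variables (gens : seq S) (C : graded_free_complex K n.+3).
Hypothesis res : minimal_graded_free_resolution gens C.
Local Notation I := (in_ideal gens).
Variables (z : 'I_n.+3 -> S) (Z : 'M[K]_n.+3).
Hypothesis uZ : Z \in unitmx.
Hypothesis zE : forall i, z i = \sum_j Z i j *: 'X_j.
Hypothesis regular_mod : forall (k : 'I_n.+3) (f : S) (g : 'I_n.+3 -> S), (k < 3)%N ->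
  I (z k * f - \sum_(i : 'I_n.+3 | (i < k)%N) z i * g i) ->
  exists g' : 'I_n.+3 -> S, I (f - \sum_(i : 'I_n.+3 | (i < k)%N) z i * g' i).
Hypothesis artinian_mod : forall q (f : S), (2 <= q)%N -> f \is q.+1.-homog ->
  exists g : 'I_n.+3 -> S, I (f - \sum_(i : 'I_n.+3 | (i < 3)%N) z i * g i).
Hypothesis I_low : forall q (f : S), (q < 2)%N -> f \is q.-homog -> I f -> f = 0.
Variables (N : nat) (Q : 'I_N -> S).
Hypothesis Q_span : forall f, f \is 2.-homog -> I f ->
  exists c : 'I_N -> K, f = \sum_k c k *: Q k.
Hypothesis Q_nolin : forall L : 'I_N -> S, (forall k, L k \is 1.-homog) ->
  \sum_k L k * Q k = 0 -> forall k, L k = 0.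
Variables (W : nat -> finType) (b : forall q, W q -> S).
Hypothesis card_W : forall q,
  #|W q| = ('C(q.+2, 2) + n * 'C(q.+1, 2) + 'C(n, 2) * 'C(q, 2))%N.
Hypothesis b_hom : forall q (w : W q), b w \is q.-homog.
Hypothesis b_span : forall q (f : S), f \is q.-homog ->
  exists y : W q -> K, I (f - \sum_w y w *: b w).
Hypothesis b_free : forall q (y : W q -> K),
  I (\sum_w y w *: b w) -> forall w, y w = 0.

Lemma betti_eq0 p q :
  ~ ((p == 0%N) && (q == 0%N)) -> ~ ((p == 1%N) && (q == 2%N)) ->
  ~ ((1 <= p)%N && (q == p + 2)%N) -> betti C p q = 0%N.
Proof.
case: res => rk0 sh0 hom phi0 exact00 n1 n2 n3.
apply/eqP; rewrite cards_eq0; apply/eqP/setP => l; rewrite !inE; apply/eqP => lq.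
have le := sh_le hom exact00 uZ zE rk0 sh0 phi0 regular_mod artinian_mod l isT.
case: p l lq le n1 n2 n3 => [|[|p]] l lq le n1 n2 n3.
- by apply: n1; rewrite -lq sh0.
- have ge := sh1_ge hom exact00 rk0 sh0 phi0 I_low l; rewrite lq in le ge.
  have [e|e] : q = 2 \/ q = 3 by lia.
    by apply: n2; rewrite e.
  by apply: n3; rewrite e.
have := sh_ge hom exact00 rk0 sh0 phi0 I_low Q_span Q_nolin l isT.
rewrite lq in le *; move=> ge; apply: n3; rewrite /= eqn_leq le ge //.
Qed.

(** Convolved with the dimensions C(m + n + 2, m) of the pieces of S, both sides become the Hilbert
    function of S / I, by [euler_gdim] and [gdimE] on the left and [betti_seq_conv] on the right.
    Indices p > q contribute nothing since the shifts in [F p] are at least p. *)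
Lemma euler_betti q : \sum_(p < q.+1) (-1) ^+ p * (betti C p q)%:Z = betti_seq n q.
Proof.
case: res => rk0 sh0 hom phi0 exact00.
have sh_ge_p p (l : 'I_(rk C p)) : (p <= sh l)%N.
  case: p l => [//|[|p]] l.
    by have := sh1_ge hom exact00 rk0 sh0 phi0 I_low l; lia.
  by have := sh_ge hom exact00 rk0 sh0 phi0 I_low Q_span Q_nolin l isT; lia.
have big0 p j : (j < p)%N -> betti C p j = 0%N.
  move=> jp; apply/eqP; rewrite cards_eq0; apply/eqP/setP => l; rewrite !inE.
  by apply/eqP => e; have := sh_ge_p p l; rewrite e; lia.
pose chi j : int := \sum_(p < j.+1) (-1) ^+ p * (betti C p j)%:Z.
apply: (@conv_inj chi (betti_seq n) (fun m => ('C(m + n.+2, m))%:Z)) => [|{}q].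
  by rewrite bin0.
rewrite betti_seq_conv -card_W.
rewrite -(euler_gdim hom exact00 rk0 sh0 phi0 (@b_hom q) (@b_span q) (@b_free q) sh_ge_p).
have -> : conv chi (fun m => ('C(m + n.+2, m))%:Z) q =
    \sum_(j < q.+1) \sum_(p < q.+1)
      (-1) ^+ p * (betti C p j)%:Z * ('C(q - j + n.+2, q - j))%:Z.
  apply: eq_bigr => j _; rewrite -mulr_suml; congr (_ * _).
  rewrite /chi (big_ord_widen _ (fun p => (-1) ^+ p * (betti C p j)%:Z) (ltn_ord j)).
  rewrite big_mkcond; apply: eq_bigr => p _; case: ltnP => // jp.
  by rewrite big0 ?mulr0.
rewrite exchange_big /=; apply: eq_bigr => p _.
rewrite gdimE // (big_morph Posz PoszD (erefl (0 : int))) mulr_sumr.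
by apply: eq_bigr => j _; rewrite PoszM mulrA.
Qed.

Theorem betti_table :
  [/\ betti C 0 0 = 1%N,
      betti C 1 2 = n,
      (forall i : nat, (3 <= i)%N ->
         (betti C (i - 2) i)%:Z =
           ('C(n, i))%:Z - (n * 'C(n, i.-1))%:Z + ('C(n, 2) * 'C(n, i - 2))%:Z)
    & (forall p q : nat,
         ~ ((p == 0%N) && (q == 0%N)) ->
         ~ ((p == 1%N) && (q == 2%N)) ->
         ~ ((1 <= p)%N && (q == p + 2)%N) ->
         betti C p q = 0%N)].
Proof.
split; last exact: betti_eq0.
- have := euler_betti 0; rewrite big_ord1 expr0 mul1r /betti_seq /= bin0 !mulr0 addr0 mulr1 => e.
  by apply/eqP; rewrite -eqz_nat e.
- have := euler_betti 2; rewrite !big_ord_recl big_ord0 /=.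
  rewrite (@betti_eq0 0 2) // (@betti_eq0 2 2) //.
  rewrite /bump /betti_seq /= !bin0 bin1 expr0 expr1 (expr2 (-1)).
  (* The sequence gives n^2 - 2 C(n,2) for this Betti number, and 2 C(n,2) = n (n - 1). *)
  have := mul_bin_diag n 1; rewrite bin1.
  set c := 'C(n, 2); set B := betti C 1 2 => e1 e2.
  have {}e2 : n%:Z * n%:Z = (2 * c)%:Z + B%:Z by lia.
  by case: n e1 e2 => [|m]; lia.
move=> [|[|[|i]]] // _; have := euler_betti i.+3.
(* In degree i + 3 only the module of index i + 1 has generators, so the alternating sum has one
   term. *)
rewrite (bigD1 (inord i.+1)) //= big1 => [|p np]; last first.
  rewrite betti_eq0 ?mulr0 //; first by case/andP.
    by case/andP => _; lia.
  case/andP => _ /eqP e; case/eqP: np; apply: val_inj; rewrite /= inordK; lia.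
rewrite inordK ?addr0; last by lia.
rewrite !subSS subn0 /betti_seq /= => e.
apply: (@mulfI _ ((-1) ^+ i.+1)); first by rewrite signr_eq0.
rewrite e !PoszM !exprS; ring.
Qed.

End BettiNumbers.

(** * Wachspress coordinates *)

Section Vectors.
Variables (A B : comNzRingType) (f : {rmorphism A -> B}).
Implicit Types a b c p : v3 A.

Lemma map_dot3 a b : f (dot3 a b) = dot3 (map3 f a) (map3 f b).
Proof. by rewrite /dot3 !rmorphD !rmorphM. Qed.

Lemma map_det3 a b c : f (det3 a b c) = det3 (map3 f a) (map3 f b) (map3 f c).
Proof.
by rewrite /det3 map_dot3 /cross3 /map3 /c1 /c2 /c3 /= !rmorphB !rmorphM.
Qed.

Lemma map3_sub3 a b : map3 f (sub3 a b) = sub3 (map3 f a) (map3 f b).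
Proof. by rewrite /map3 /sub3 /mk3 /c1 /c2 /c3 /= !rmorphB. Qed.

Lemma map3_scale3 s a : map3 f (scale3 s a) = scale3 (f s) (map3 f a).
Proof. by rewrite /map3 /scale3 /mk3 /c1 /c2 /c3 /= !rmorphM. Qed.

Lemma map3_map3 (T : Type) (g : T -> A) (h : T -> B) (a : v3 T) :
  (forall t, f (g t) = h t) -> map3 f (map3 g a) = map3 h a.
Proof. by move=> e; rewrite /map3 /mk3 /c1 /c2 /c3 /= !e. Qed.

Lemma det3_cross a b c : det3 a b c = dot3 (cross3 a b) c.
Proof.
by move: a b c => [[a1 a2] a3] [[b1 b2] b3] [[? ?] ?]; rewrite /det3 /dot3 /cross3 /c1 /c2 /c3 /=; ring.
Qed.

Lemma dot3C a b : dot3 a b = dot3 b a.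
Proof. by rewrite /dot3; ring. Qed.

Lemma dot3_scalel s a b : dot3 (scale3 s a) b = s * dot3 a b.
Proof. by rewrite /dot3 /scale3 /c1 /c2 /c3 /=; ring. Qed.

Lemma det3_scale r s t a b c :
  det3 (scale3 r a) (scale3 s b) (scale3 t c) = r * s * t * det3 a b c.
Proof. by rewrite /det3 /cross3 /dot3 /scale3 /mk3 /c1 /c2 /c3 /=; ring. Qed.

Lemma dot3_subl a b c : dot3 (sub3 a b) c = dot3 a c - dot3 b c.
Proof. by rewrite /dot3 /sub3 /c1 /c2 /c3 /=; ring. Qed.

Lemma dot3_crossl a b : dot3 (cross3 a b) a = 0.
Proof. by rewrite /dot3 /cross3 /c1 /c2 /c3 /=; ring. Qed.

Lemma dot3_crossr a b : dot3 (cross3 a b) b = 0.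
Proof. by rewrite /dot3 /cross3 /c1 /c2 /c3 /=; ring. Qed.

Lemma big_add3 (J : Type) (r : seq J) (P : pred J) (F : J -> v3 A) :
  \big[@add3 A/mk3 0 0 0]_(j <- r | P j) F j =
  mk3 (\sum_(j <- r | P j) c1 (F j)) (\sum_(j <- r | P j) c2 (F j))
      (\sum_(j <- r | P j) c3 (F j)).
Proof.
elim: r => [|j r IH]; first by rewrite !big_nil.
by rewrite !big_cons IH; case: (P j).
Qed.

End Vectors.

Section VectorsDomain.
Variable (A : idomainType).
Implicit Types a b c p t : v3 A.

(** Each coordinate of p times the conclusion is an explicit combination of vanishing quantities,
    and some coordinate of p is nonzero. The same device proves [orthogonal_det3]. *)
Lemma orthogonal_parallel a p t : p <> mk3 0 0 0 ->
  dot3 a p = 0 -> cross3 p t = mk3 0 0 0 -> dot3 a t = 0.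
Proof.
move: a p t => [[a1 a2] a3] [[p1 p2] p3] [[t1 t2] t3] p0 ap [e1 e2 e3].
rewrite /dot3 /c1 /c2 /c3 /= in p0 ap e1 e2 e3 *.
have h1 : p1 * (a1 * t1 + a2 * t2 + a3 * t3) = 0.
  transitivity (t1 * (a1 * p1 + a2 * p2 + a3 * p3) + a2 * (p1 * t2 - p2 * t1)
    - a3 * (p3 * t1 - p1 * t3)); first by ring.
  by rewrite ap e2 e3; ring.
have h2 : p2 * (a1 * t1 + a2 * t2 + a3 * t3) = 0.
  transitivity (t2 * (a1 * p1 + a2 * p2 + a3 * p3) - a1 * (p1 * t2 - p2 * t1)
    + a3 * (p2 * t3 - p3 * t2)); first by ring.
  by rewrite ap e1 e3; ring.
have h3 : p3 * (a1 * t1 + a2 * t2 + a3 * t3) = 0.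
  transitivity (t3 * (a1 * p1 + a2 * p2 + a3 * p3) + a1 * (p3 * t1 - p1 * t3)
    - a2 * (p2 * t3 - p3 * t2)); first by ring.
  by rewrite ap e1 e2; ring.
move/eqP: h1; rewrite mulf_eq0 => /orP[/eqP z1|/eqP //].
move/eqP: h2; rewrite mulf_eq0 => /orP[/eqP z2|/eqP //].
move/eqP: h3; rewrite mulf_eq0 => /orP[/eqP z3|/eqP //].
by case: p0; rewrite z1 z2 z3.
Qed.

Lemma orthogonal_det3 a b c p : p <> mk3 0 0 0 ->
  dot3 a p = 0 -> dot3 b p = 0 -> dot3 c p = 0 -> det3 a b c = 0.
Proof.
move: a b c p => [[a1 a2] a3] [[b1 b2] b3] [[d1 d2] d3] [[p1 p2] p3] p0 ap bp cp.
rewrite /det3 /cross3 /dot3 /c1 /c2 /c3 /= in p0 ap bp cp *.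
set D := _ + _ + _.
have h1 : p1 * D = 0.
  transitivity ((a1 * p1 + a2 * p2 + a3 * p3) * (b2 * d3 - b3 * d2)
    + (b1 * p1 + b2 * p2 + b3 * p3) * (d2 * a3 - d3 * a2)
    + (d1 * p1 + d2 * p2 + d3 * p3) * (a2 * b3 - a3 * b2)); first by rewrite /D; ring.
  by rewrite ap bp cp; ring.
have h2 : p2 * D = 0.
  transitivity ((a1 * p1 + a2 * p2 + a3 * p3) * (b3 * d1 - b1 * d3)
    + (b1 * p1 + b2 * p2 + b3 * p3) * (d3 * a1 - d1 * a3)
    + (d1 * p1 + d2 * p2 + d3 * p3) * (a3 * b1 - a1 * b3)); first by rewrite /D; ring.
  by rewrite ap bp cp; ring.
have h3 : p3 * D = 0.
  transitivity ((a1 * p1 + a2 * p2 + a3 * p3) * (b1 * d2 - b2 * d1)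
    + (b1 * p1 + b2 * p2 + b3 * p3) * (d1 * a2 - d2 * a1)
    + (d1 * p1 + d2 * p2 + d3 * p3) * (a1 * b2 - a2 * b1)); first by rewrite /D; ring.
  by rewrite ap bp cp; ring.
move/eqP: h1; rewrite mulf_eq0 => /orP[/eqP z1|/eqP //].
move/eqP: h2; rewrite mulf_eq0 => /orP[/eqP z2|/eqP //].
move/eqP: h3; rewrite mulf_eq0 => /orP[/eqP z3|/eqP //].
by case: p0; rewrite z1 z2 z3.
Qed.

End VectorsDomain.

Section WachspressForms.
Variables (K : realFieldType) (n : nat) (v : nat -> K * K).
Local Notation d := n.+3.
Local Notation bv := (bv d v).
Local Notation nvec := (nvec d v).
Local Notation alpha := (alpha d v).

Definition vidx (i : nat) : 'I_d := inord (i %% d).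

Lemma val_vidx i : vidx i = (i %% d)%N :> nat.
Proof. by rewrite inordK ?ltn_pmod. Qed.

Lemma vidxD i : vidx (i + d) = vidx i.
Proof. by apply: val_inj; rewrite /= !val_vidx modnDr. Qed.

Lemma vidx_ord (i : 'I_d) : vidx i = i.
Proof. by apply: val_inj; rewrite /= val_vidx modn_small. Qed.

Lemma xvE i : xv K d i = 'X_(vidx i).
Proof. by rewrite /xv (big_pred1 (vidx i)) // => k; rewrite -val_vidx. Qed.

Lemma bvD i : bv (i + d) = bv i.
Proof. by rewrite /bv modnDr. Qed.

Lemma nvecD i : nvec (i + d) = nvec i.
Proof. by rewrite /nvec -addSn !bvD. Qed.

Lemma alphaD i : alpha (i + d) = alpha i.
Proof.
have e : (i + d + d).-1 = ((i + d).-1 + d)%N by lia.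
by rewrite /alpha e -addSn !bvD.
Qed.

Section Generic.
Variables (A : comNzRingType) (iota : K -> A) (x : nat -> A).

Definition gtau : v3 A :=
  \big[@add3 A/mk3 0 0 0]_(k < d) scale3 (x k) (map3 iota (bv k)).

Definition gLambda (k : nat) : v3 A :=
  sub3 (scale3 (x k.+1 * iota (alpha k.+1)^-1) (map3 iota (nvec k.+1)))
       (scale3 (x k * iota (alpha k)^-1) (map3 iota (nvec (k + d).-1))).

End Generic.

Lemma map_gLambda (A B : comNzRingType) (f : {rmorphism A -> B}) i i' x x' k :
  (forall c, f (i c) = i' c) -> (forall j, f (x j) = x' j) ->
  map3 f (gLambda i x k) = gLambda i' x' k.
Proof.
move=> ei ex; rewrite /gLambda /map3 /sub3 /scale3 /c1 /c2 /c3 /=.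
by rewrite !rmorphB !rmorphM !ei !ex.
Qed.

Lemma map_gtau (A B : comNzRingType) (f : {rmorphism A -> B}) i i' x x' :
  (forall c, f (i c) = i' c) -> (forall j, f (x j) = x' j) ->
  map3 f (gtau i x) = gtau i' x'.
Proof.
move=> ei ex; rewrite /gtau !big_add3 /map3 /mk3 /scale3 /c1 /c2 /c3 /= !rmorph_sum.
by congr (_, _, _); apply: eq_bigr => k _; rewrite rmorphM ei ex.
Qed.

Lemma LambdaE k : Lambda d v k = gLambda (@mpolyC d K) (xv K d) k.
Proof. by []. Qed.

Lemma tauE : tau d v = gtau (@mpolyC d K) (xv K d).
Proof. by []. Qed.

Section WachspressPoint.
Variable p : v3 K.
Local Notation L j := (dot3 (nvec j) p).
Hypothesis L_neq0 : forall j, L j != 0.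
Hypothesis alpha_neq0 : forall j, alpha j != 0.

(* The Wachspress coordinates of [p], divided by the product of all edge forms. *)
Definition wpoint (i : nat) : K := alpha i / (L (i + d).-1 * L i).

(** Both terms of the difference equal 1 / L_k after cancelling alpha and the other edge form. *)
Lemma wpoint_Lambda k : dot3 (gLambda id wpoint k) p = 0.
Proof.
have mapid (a : v3 K) : map3 id a = a by case: a => [[]].
rewrite /gLambda !mapid dot3_subl !dot3_scalel /wpoint.
have -> : (k.+1 + d).-1 = (k + d)%N by rewrite addSn.
rewrite nvecD; have := L_neq0 (k + d).-1.
have h1 := L_neq0 k; have h2 := L_neq0 k.+1; have := alpha_neq0 k; have := alpha_neq0 k.+1.
move: (L _) (L _) (L _) (alpha _) (alpha _) h1 h2 => a b c e g h1 h2 h3 h4 h5.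
by field; rewrite h1 h2 h3 h4 h5.
Qed.

Lemma alpha_bv k :
  scale3 (alpha k) (bv k) = cross3 (nvec (k + d).-1) (nvec k).
Proof.
have e : (k + d).-1.+1 = (k + d)%N by lia.
rewrite /alpha /nvec e bvD.
move: (bv _) (bv _) (bv _) => [[a1 a2] a3] [[b1 b2] b3] [[e1 e2] e3].
by rewrite /det3 /dot3 /cross3 /scale3 /mk3 /c1 /c2 /c3 /=; congr (_, _, _); ring.
Qed.

(** Since alpha_k v_k = n_(k-1) x n_k, the triple product formula turns p x (x_k v_k) into n_(k-1) /
    L_(k-1) - n_k / L_k, and the sum telescopes around the polygon. *)
Lemma wpoint_tau : cross3 p (gtau id wpoint) = mk3 0 0 0.
Proof.
have mapid (a : v3 K) : map3 id a = a by case: a => [[]].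
have term k : cross3 p (scale3 (wpoint k) (bv k)) =
    sub3 (scale3 (L (k + d).-1)^-1 (nvec (k + d).-1)) (scale3 (L k)^-1 (nvec k)).
  have -> : scale3 (wpoint k) (bv k) =
      scale3 (L (k + d).-1 * L k)^-1 (scale3 (alpha k) (bv k)).
    by rewrite /scale3 /wpoint /mk3 /c1 /c2 /c3 /=; congr (_, _, _); ring.
  rewrite alpha_bv; have := L_neq0 k; have := L_neq0 (k + d).-1.
  case: p (nvec _) (nvec _) => [[p1 p2] p3] [[a1 a2] a3] [[b1 b2] b3].
  rewrite /cross3 /scale3 /sub3 /dot3 /mk3 /c1 /c2 /c3 /= => h1 h2.
  by congr (_, _, _); field; rewrite h1 h2.
have tele (h : nat -> K) : (forall i, h (i + d)%N = h i) ->
    \sum_(k < d) (h (k + d).-1 - h k) = 0.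
  move=> hD; rewrite sumrB [X in X - _]big_ord_recl [X in _ - X]big_ord_recr /=.
  rewrite (eq_bigr (fun i : 'I_n.+2 => h i)) => [|i _].
    by rewrite [X in _ - X]addrC subrr.
  by rewrite -[RHS]hD; congr h; rewrite /bump; lia.
rewrite /gtau big_add3.
have -> : cross3 p (mk3 (\sum_(j < d) c1 (scale3 (wpoint j) (map3 id (bv j))))
     (\sum_(j < d) c2 (scale3 (wpoint j) (map3 id (bv j))))
     (\sum_(j < d) c3 (scale3 (wpoint j) (map3 id (bv j))))) =
  mk3 (\sum_(j < d) c1 (cross3 p (scale3 (wpoint j) (bv j))))
     (\sum_(j < d) c2 (cross3 p (scale3 (wpoint j) (bv j))))
     (\sum_(j < d) c3 (cross3 p (scale3 (wpoint j) (bv j)))).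
  rewrite /cross3 /mk3 /scale3 /c1 /c2 /c3 /=.
  by congr (_, _, _); rewrite !mulr_sumr -sumrB.
rewrite /mk3; congr (_, _, _).
- rewrite -[RHS](tele (fun k => (L k)^-1 * c1 (nvec k))) => [|i]; last by rewrite nvecD.
  by apply: eq_bigr => k _; rewrite term.
- rewrite -[RHS](tele (fun k => (L k)^-1 * c2 (nvec k))) => [|i]; last by rewrite nvecD.
  by apply: eq_bigr => k _; rewrite term.
rewrite -[RHS](tele (fun k => (L k)^-1 * c3 (nvec k))) => [|i]; last by rewrite nvecD.
by apply: eq_bigr => k _; rewrite term.
Qed.

Lemma wpointD i : wpoint (i + d) = wpoint i.
Proof.
have e : (i + d + d).-1 = ((i + d).-1 + d)%N by lia.
by rewrite /wpoint e !nvecD alphaD.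
Qed.

Lemma wpoint_mod i : wpoint (i %% d) = wpoint i.
Proof.
rewrite {2}(divn_eq i d); elim: (i %/ d)%N => [|q IH]; first by rewrite mul0n.
by rewrite mulSn -addnA addnC wpointD.
Qed.

Let ev : {mpoly K[d]} -> K := meval (fun i : 'I_d => wpoint i).

Let ev_xv i : ev (xv K d i) = wpoint i.
Proof. by rewrite xvE /ev mevalXU val_vidx wpoint_mod. Qed.

Lemma wpoint_gens f : f \in gensI d v -> f.@[fun i : 'I_d => wpoint i] = 0.
Proof.
have p0 : p <> mk3 0 0 0.
  move=> e; have /eqP := L_neq0 0; rewrite e; apply.
  by rewrite /dot3 /c1 /c2 /c3 /= !mulr0 !addr0.
have evL k : map3 ev (Lambda d v k) = gLambda id wpoint k.
  by apply: map_gLambda => [c|j]; [apply: mevalC | apply: ev_xv].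
have evt : map3 ev (tau d v) = gtau id wpoint.
  by apply: map_gtau => [c|j]; [apply: mevalC | apply: ev_xv].
rewrite mem_cat => /orP[/mapP[k _ ->]|/mapP[[[i j] k] _ ->]].
  rewrite [LHS]map_dot3 evL evt.
  exact: (orthogonal_parallel p0 (wpoint_Lambda k) wpoint_tau).
rewrite [LHS]map_det3 !evL.
exact: (orthogonal_det3 p0 (wpoint_Lambda _) (wpoint_Lambda _) (wpoint_Lambda _)).
Qed.

End WachspressPoint.

End WachspressForms.

(** * Independence of the normal monomials *)

Section NormalMonomials.
Variable n : nat.
Local Notation d := n.+3.
Implicit Types m : 'X_{1..d}.
Local Notation mu m i := (m (vidx n i)).

(* Vertices are numbered [1, ..., d]; normal monomials are those divisible neither by
   [x_1 x_j] (2 < j < d) nor by [x_i x_j x_k] (2 < i < j < k <= d). *)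
Definition normal_mnm m : Prop :=
  (forall j, (2 < j < d)%N -> (0 < mu m 1)%N -> mu m j = 0%N) /\
  (forall i j k, (2 < i < j)%N -> (j < k <= d)%N ->
     (0 < mu m j)%N -> (0 < mu m k)%N -> mu m i = 0%N).

(** The power of L_j in the denominator of the monomial at a Wachspress point: L_j occurs in x_j and
    in x_(j+1). *)
Definition edge_exp m j : nat := (mu m j + mu m j.+1)%N.

Lemma vidx_neq i j : (0 < i < j)%N -> (j <= d)%N -> vidx n i != vidx n j.
Proof.
move=> /andP[i0 ij] jd; rewrite -val_eqE /= !val_vidx (modn_small (leq_trans ij jd)).
move: jd; rewrite leq_eqVlt => /orP[/eqP ->|jd]; first by rewrite modnn -lt0n.
by rewrite modn_small // ltn_eqF.
Qed.

Lemma mdeg_vidx m : mdeg m = (\sum_(1 <= i < d.+1) mu m i)%N.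
Proof.
rewrite mdegE big_nat_recr //= big_add1 big_mkord addnC big_ord_recl.
congr (_ + _)%N; first by congr (m _); apply: val_inj; rewrite /= val_vidx modnn.
apply: eq_bigr => i _; congr (m _); apply: val_inj; rewrite /= val_vidx modn_small //.
by have := ltn_ord i; lia.
Qed.

Lemma eq_mnm_but2 m m' : mdeg m = mdeg m' -> mu m 1 = mu m' 1 ->
  (forall i, (2 < i <= d)%N -> mu m i = mu m' i) -> m = m'.
Proof.
rewrite !mdeg_vidx !(big_ltn (isT : (1 < d.+1)%N)) !(big_ltn (isT : (2 < d.+1)%N)).
move=> e e1 e3; rewrite e1 in e.
rewrite (@eq_big_nat _ _ _ 3 d.+1 (fun i => mu m i) (fun i => mu m' i)) in e; last first.
  by move=> i; rewrite ltnS; apply: e3.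
have e2 : mu m 2 = mu m' 2 by move: e => /addnI/addIn.
apply/mnmP => i; have [i0|ipos] := posnP i.
  have -> : i = vidx n d by apply: val_inj; rewrite /= val_vidx modnn.
  by rewrite e3 // leqnn.
rewrite -(vidx_ord i); have := ltn_ord i; move: ipos; move: (nat_of_ord i) => j j0 jd.
case: j j0 jd => [//|[|[|j]]] _ jd //.
by apply: e3; rewrite (ltnW jd).
Qed.

Lemma seq_max (T : eqType) (s : seq T) (g : T -> nat) x : x \in s ->
  exists2 y, y \in s & forall t, t \in s -> (g t <= g y)%N.
Proof.
move=> xs; case: (@ex_maxnP (fun k => has (fun t => g t == k) s) (\max_(t <- s) g t)).
- by exists (g x); apply/hasP; exists x.
- by move=> k /hasP[t ts /eqP <-]; apply: leq_bigmax_seq.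
move=> k /hasP[y ys /eqP gy] kmax; exists y => // t ts; rewrite gy.
by apply: kmax; apply/hasP; exists t.
Qed.

(** The pole orders along edge r, then along edge r', single out one monomial. Here r is the largest
    index in use, x_1 being counted at d, and r' is the largest index strictly between 2 and r used
    by a monomial of maximal order along r, or 1 if there is none. Normality then leaves no freedom
    in the other exponents. *)
Lemma normal_flag (M : seq 'X_{1..d}) k m1 : m1 \in M ->
  (forall m, m \in M -> normal_mnm m /\ mdeg m = k) ->
  exists r r' m0, [/\ (0 < r' < r)%N, (r <= d)%N, m0 \in M &
    forall m, m \in M -> m != m0 -> (edge_exp m r < edge_exp m0 r)%N \/
      edge_exp m r = edge_exp m0 r /\ (edge_exp m r' < edge_exp m0 r')%N].
Proof.
move=> m1M hM.
have mu_d1 m : mu m d.+1 = mu m 1 := congr1 m (vidxD n 1).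
(* For the largest index r in use, [nu m r] is the exponent along edge r (see [er]). Edge d joins
   v_d to v_1, hence the extra term at j = d. *)
pose nu m j := (mu m j + (j == d) * mu m 1)%N.
have [|none] := boolP (has (fun j => has (fun m => 0 < nu m j)%N M) (iota 3 n.+1)); last first.
  have zero m j : m \in M -> (2 < j <= d)%N -> nu m j = 0%N.
    move=> mM jd; apply/eqP; rewrite -leqn0 leqNgt; apply: contra none => pos.
    apply/hasP; exists j; first by rewrite mem_iota; lia.
    by apply/hasP; exists m.
  (* Only powers of x_2 are present; the degree being fixed, [M] has one element and any flag will
     do. *)
  exists 2, 1%N, m1; split=> // m mM /eqP[]; apply: eq_mnm_but2.
  - by have [_ ->] := hM _ mM; have [_ ->] := hM _ m1M.
  - have := zero m d mM; have := zero m1 d m1M; rewrite /nu eqxx; lia.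
  by move=> i id; have := zero m i mM id; have := zero m1 i m1M id; rewrite /nu; lia.
move=> some.
have [r [r3 rd [m2 m2M m2r] rmax]] : exists r, [/\ (2 < r)%N, (r <= d)%N,
    exists2 m, m \in M & (0 < nu m r)%N &
    forall m j, m \in M -> (r < j <= d)%N -> nu m j = 0%N].
  have := @ex_maxnP (fun j => (2 < j <= d)%N && has (fun m => 0 < nu m j)%N M) d.
  case=> [|j /andP[/andP[]]//|r /andP[/andP[r3 rd] /hasP[m mM mr]] rmax].
    have /hasP[j] := some; rewrite mem_iota => j3 hj; exists j; rewrite hj andbT; clear -j3; lia.
  exists r; split=> //; first by exists m.
  move=> m' j m'M jr; apply/eqP; rewrite -leqn0 leqNgt; apply/negP => pos.
  suff le : (j <= r)%N by move: jr; rewrite ltnNge le.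
  apply: rmax; apply/andP; split; first by clear -jr r3; lia.
  by apply/hasP; exists m'.
have er m : m \in M -> edge_exp m r = nu m r.
  move=> mM; rewrite /edge_exp /nu.
  have [->|nrd] := eqVneq r d; first by rewrite mu_d1 mul1n.
  have := rmax m r.+1 mM; rewrite /nu; clear -rd nrd; lia.
have mu1 m : m \in M -> r != d -> mu m 1 = 0%N.
  by move=> mM nrd; have := rmax m d mM; rewrite /nu eqxx; clear -rd nrd; lia.
have mu_gt m i : m \in M -> (r < i <= d)%N -> mu m i = 0%N.
  by move=> mM ir; have := rmax m i mM ir; rewrite /nu; clear; lia.
have [m3 m3M Emax] := seq_max (fun m => nu m r) m2M.
pose M' := [seq m <- M | nu m r == nu m3 r].
have m3M' : m3 \in M' by rewrite mem_filter eqxx.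
have Epos : (0 < nu m3 r)%N by apply: leq_trans (Emax _ m2M).
have M'P m : m \in M' -> m \in M /\ nu m r = nu m3 r.
  by rewrite mem_filter => /andP[/eqP ? ?].
suff [r' [m0 [r'r m0M' uniq_m0]]] : exists r' m0, [/\ (0 < r' < r)%N, m0 \in M' &
    forall m, m \in M' -> (edge_exp m0 r' <= edge_exp m r')%N -> m = m0].
  have [m0M nu0] := M'P _ m0M'.
  exists r, r', m0; split=> // m mM nm; rewrite !er // nu0.
  have := Emax m mM; rewrite leq_eqVlt => /orP[/eqP e|]; last by left.
  right; split=> //; rewrite ltnNge; apply: contra nm => le; apply/eqP.
  by apply: uniq_m0 le; rewrite mem_filter e eqxx.
have [some2|none2] := boolP (has (fun j => has (fun m => 0 < mu m j)%N M') (iota 3 (r - 3))).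
  have [j [j3 jr [m4 m4M' m4j] jmax]] : exists j, [/\ (2 < j)%N, (j < r)%N,
      exists2 m, m \in M' & (0 < mu m j)%N &
      forall m i, m \in M' -> (j < i < r)%N -> mu m i = 0%N].
    have := @ex_maxnP (fun j => (2 < j < r)%N && has (fun m => 0 < mu m j)%N M') r.
    case=> [|j /andP[/andP[_ /ltnW]]//|j /andP[/andP[j3 jr] /hasP[m mM mj]] jmax].
      have /hasP[j] := some2; rewrite mem_iota => j3 hj; exists j; rewrite hj andbT; clear -j3; lia.
    exists j; split=> //; first by exists m.
    move=> m' i m'M ij; apply/eqP; rewrite -leqn0 leqNgt; apply/negP => pos.
    suff le : (i <= j)%N by move: ij; rewrite ltnNge le.
    apply: jmax; apply/andP; split; first by clear -ij j3; lia.
    by apply/hasP; exists m'.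
  have [m0 m0M' m0max] := seq_max (fun m => mu m j) m4M'.
  (* Such a monomial has the form x_2^a x_j^b x_r^E with E fixed: x_1 is excluded by x_1 x_j, an
     index between 2 and j by x_i x_j x_r, and an index between j and r by the choice of j. *)
  have shape m : m \in M' -> (0 < mu m j)%N ->
      [/\ mu m 1 = 0%N, mu m r = nu m3 r & forall i, (2 < i < r)%N -> i != j -> mu m i = 0%N].
    move=> mM' mj; have [mM nur] := M'P _ mM'; have [[nf1 nf3] _] := hM _ mM.
    have jd : (2 < j < d)%N by rewrite j3 (leq_trans jr rd).
    have m10 : mu m 1 = 0%N.
      apply/eqP; rewrite -leqn0 leqNgt; apply/negP => p1.
      by rewrite (nf1 j jd p1) in mj.
    have mr : mu m r = nu m3 r by rewrite -nur /nu m10 muln0 addn0.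
    split=> // i ir ij; have [lij|lji] := ltnP i j.
      have ir' : (2 < i < j)%N by clear -ir lij; lia.
      have jr2 : (j < r <= d)%N by rewrite jr.
      by have := nf3 i j r ir' jr2 mj; rewrite mr; apply.
    by apply: (jmax m i mM'); clear -ir ij lji; lia.
  have j0 : (0 < mu m0 j)%N by apply: leq_trans (m0max _ m4M').
  have [s1 s2 s3] := shape _ m0M' j0.
  exists j, m0; split=> //; first by rewrite jr (ltn_trans _ j3).
  move=> m mM' le.
  have mj : (mu m0 j <= mu m j)%N.
    move: le; rewrite /edge_exp; have [e|nj] := eqVneq j.+1 r.
      rewrite e s2; have [_ <-] := M'P _ mM'; rewrite /nu; clear; lia.
    have jr' : (j < j.+1 < r)%N by rewrite ltnSn ltn_neqAle nj.
    by rewrite (jmax m j.+1) // ?(jmax m0 j.+1) // !addn0.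
  have [t1 t2 t3] := shape _ mM' (leq_trans j0 mj).
  have [mM _] := M'P _ mM'; have [m0M _] := M'P _ m0M'.
  apply: eq_mnm_but2.
  - by have [_ ->] := hM _ mM; have [_ ->] := hM _ m0M.
  - by rewrite s1 t1.
  move=> i id; have [->|ij] := eqVneq i j.
    by apply/eqP; rewrite eqn_leq mj m0max.
  have [ir|ri|->] := ltngtP i r.
  - have ir' : (2 < i < r)%N by clear -ir id; lia.
    by rewrite s3 ?t3.
  - have ri' : (r < i <= d)%N by clear -ri id; lia.
    by rewrite !mu_gt.
  by rewrite s2 t2.
have zero m i : m \in M' -> (2 < i < r)%N -> mu m i = 0%N.
  move=> mM' ir; apply/eqP; rewrite -leqn0 leqNgt; apply: contra none2 => pos.
  apply/hasP; exists i; first by rewrite mem_iota; clear -ir; lia.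
  by apply/hasP; exists m.
have [m0 m0M' m0max] := seq_max (fun m => mu m 1) m3M'.
(* Only x_1, x_2 and x_r remain, and the exponent of x_2 is constant on [M']. The order along edge 1
   therefore compares the exponents of x_1, which determine the monomial. *)
exists 1%N, m0; split=> // [|m mM' le]; first by rewrite (ltn_trans _ r3).
have [mM nm] := M'P _ mM'; have [m0M nm0] := M'P _ m0M'.
have deg m' : m' \in M' -> (mu m' 2 + nu m3 r)%N = k.
  move=> m'M'; have [m'M nm'] := M'P _ m'M'; have [_ <-] := hM _ m'M.
  rewrite mdeg_vidx !(big_ltn (isT : (1 < d.+1)%N)) !(big_ltn (isT : (2 < d.+1)%N)).
  rewrite (@big_cat_nat _ _ _ r) //=; last by rewrite ltnW.
  rewrite big_nat big1 => [|i ir]; last by apply: (zero _ _ m'M'); clear -ir; lia.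
  rewrite big_ltn ?ltnS // big_nat big1 => [|i ir]; last by apply: (mu_gt _ _ m'M); clear -ir; lia.
  rewrite -nm' /nu; have [_|nrd] := eqVneq r d.
    rewrite mul1n; clear; lia.
  by rewrite (mu1 m') //; clear; lia.
have e1 : mu m 1 = mu m0 1.
  have := m0max _ mM'; have := deg _ mM'; have := deg _ m0M'.
  by move: le; rewrite /edge_exp; clear; lia.
apply: eq_mnm_but2 => //.
- by have [_ ->] := hM _ mM; have [_ ->] := hM _ m0M.
move=> i id; have [ir|ri|->] := ltngtP i r.
- have ir' : (2 < i < r)%N by clear -ir id; lia.
  by rewrite !zero.
- have ri' : (r < i <= d)%N by clear -ri id; lia.
  by rewrite !mu_gt.
by move: nm nm0; rewrite /nu e1; clear; lia.
Qed.

End NormalMonomials.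

(** * Evaluation along a degenerating path *)

Lemma poly_nonroot (K : realFieldType) (p : {poly K}) : p != 0 -> exists s, p.[s] != 0.
Proof.
move=> p0; have [|/allPn[s _ ps]] := boolP (all (root p) [seq i%:R | i <- iota 0 (size p)]).
  move=> H; have := max_poly_roots p0 H; rewrite size_map size_iota ltnn => h.
  suff : false by []; apply: h.
  by rewrite map_inj_uniq ?iota_uniq // => i j /eqP; rewrite eqr_nat => /eqP.
by exists s.
Qed.

Lemma poly_zero_fun (K : realFieldType) (p : {poly K}) : (forall s, p.[s] = 0) -> p = 0.
Proof.
move=> h; apply/eqP/negPn/negP => /poly_nonroot[s].
by rewrite h eqxx.
Qed.

Section NormalIndependence.
Variables (K : realFieldType) (n : nat) (v : nat -> K * K).
Local Notation d := n.+3.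
Local Notation S := {mpoly K[d]}.
Local Notation nvec := (nvec d v).
Local Notation alpha := (alpha d v).
Local Notation wpoint := (wpoint n v).
Hypothesis alpha_neq0 : forall j, alpha j != 0.
Hypothesis nvec_indep : forall i j k : 'I_d, i != j -> j != k -> i != k ->
  det3 (nvec i) (nvec j) (nvec k) != 0.

Lemma nvec_mod j : nvec (j %% d) = nvec j.
Proof.
rewrite {2}(divn_eq j d); elim: (j %/ d)%N => [|q IH]; first by rewrite mul0n.
by rewrite mulSn -addnA addnC nvecD.
Qed.

Lemma vidx_modS j : vidx n (j %% d).+1 = vidx n j.+1.
Proof. by apply: val_inj; rewrite /= !val_vidx -addn1 modnDml addn1. Qed.

Lemma vidx_mod j : vidx n (j %% d) = vidx n j.
Proof. by apply: val_inj; rewrite /= !val_vidx modn_mod. Qed.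

Lemma edge_exp_vidx (m : 'X_{1..d}) j : edge_exp m (vidx n j) = edge_exp m j.
Proof. by rewrite /edge_exp vidx_ord val_vidx vidx_modS. Qed.

Lemma wpoint_monomial p (m : 'X_{1..d}) : (forall j, dot3 (nvec j) p != 0) ->
  (\prod_(i < d) wpoint p i ^+ m i) * \prod_(j < d) dot3 (nvec j) p ^+ edge_exp m j =
  \prod_(i < d) alpha i ^+ m i.
Proof.
move=> L0; pose H i := dot3 (nvec (i + d).-1) p ^+ m (vidx n i).
have cyc : \prod_(j < d) dot3 (nvec j) p ^+ m (vidx n j.+1) = \prod_(i < d) H i.
  rewrite [LHS]big_ord_recr [RHS]big_ord_recl mulrC /=; congr (_ * _).
    apply: eq_bigr => i _; rewrite /H /bump leq0n add1n.
    by have -> : (i.+1 + d).-1 = (i + d)%N by []; rewrite nvecD.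
  by rewrite /H -(vidx_mod d) modnn.
under [X in _ * X]eq_bigr => j _ do rewrite /edge_exp exprD.
rewrite big_split /= cyc -!big_split /=; apply: eq_bigr => i _.
rewrite /H vidx_ord /wpoint -!exprMn; congr (_ ^+ _).
by have := L0 i; have := L0 (i + d).-1 => h1 h2; field; rewrite h1 h2.
Qed.

(** The point p moves to the intersection of the edge lines R and R' so that L_R' vanishes to order
    1 and L_R to a much larger order M. The monomial m has there a pole of order M e_R + e_R', where
    e_R and e_R' are its edge exponents, and [normal_flag] makes a single term dominate. *)
Lemma normal_independent k f : f \is k.-homog ->
  (forall m, m \in msupp f -> normal_mnm m) ->
  (forall p, (forall j, dot3 (nvec j) p != 0) ->
     f.@[fun i : 'I_d => wpoint p i] = 0) -> f = 0.
Proof.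
move=> hf nf ev0; apply/eqP/negPn/negP => f0.
have [r [r' [m0 [r'r rd m0f flag]]]] : exists r r' m0, [/\ (0 < r' < r)%N, (r <= d)%N,
    m0 \in msupp f &
    forall m, m \in msupp f -> m != m0 -> (edge_exp m r < edge_exp m0 r)%N \/
      edge_exp m r = edge_exp m0 r /\ (edge_exp m r' < edge_exp m0 r')%N].
  apply: (normal_flag (mlead_supp f0)) => m mf; split; first exact: nf.
  exact: dhomog_mdeg hf mf.
have rr' : vidx n r' != vidx n r by apply: vidx_neq.
set R := vidx n r in rr' *; set R' := vidx n r' in rr' *.
(* A third edge line meets the lines R and R' in the points [a] and [b] that steer the path. *)
have [t /andP[tR tR']] : exists t : 'I_d, (t != R) && (t != R').
  case: (pickP (fun t : 'I_d => (t != R) && (t != R'))) => [t ht|h]; first by exists t.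
  have : (#|'I_d| <= #|[set R; R']|)%N.
    apply/subset_leq_card/subsetP => x _; rewrite !inE; have := h x.
    by move/negbT; rewrite negb_and !negbK.
  by rewrite card_ord cards2; case: (R != R').
have {}flag m : m \in msupp f -> m != m0 -> (edge_exp m R < edge_exp m0 R)%N \/
    edge_exp m R = edge_exp m0 R /\ (edge_exp m R' < edge_exp m0 R')%N.
  by rewrite !edge_exp_vidx; apply: flag.
pose q := cross3 (nvec R) (nvec R').
pose a := cross3 (nvec R) (nvec t); pose b := cross3 (nvec R') (nvec t).
have dot_det x y z : dot3 (nvec x) (cross3 (nvec y) (nvec z)) =
  det3 (nvec x) (nvec y) (nvec z) by [].
have dotRq : dot3 (nvec R) q = 0 by rewrite dot3C dot3_crossl.
have dotR'q : dot3 (nvec R') q = 0 by rewrite dot3C dot3_crossr.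
have dotRa : dot3 (nvec R) a = 0 by rewrite dot3C dot3_crossl.
have dotR'b : dot3 (nvec R') b = 0 by rewrite dot3C dot3_crossl.
(* 2k bounds every edge exponent, so M = 2k + 1 makes the weight [w] compare pairs of exponents
   lexicographically. *)
pose D := k.*2; pose M := D.+1.
have expD m j : m \in msupp f -> (edge_exp m j <= D)%N.
  move=> mf; rewrite /D -addnn -(dhomog_mdeg hf mf) mdegE.
  have le i : (m i <= \sum_i m i)%N by rewrite (bigD1 i) //= leq_addr.
  exact: leq_add.
(* [PL j] is L_j along q + s a + s^M b. Its order at s = 0 is M, 1 or 0 according as j is R, R' or
   another edge; the cofactor [U j] is nonzero at 0 because no three edge lines concur. *)
pose PL j : {poly K} := (dot3 (nvec j) q)%:P + (dot3 (nvec j) a)%:P * 'X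
  + (dot3 (nvec j) b)%:P * 'X^M.
pose h (j : 'I_d) : nat := if j == R then M else (j == R').
pose U (j : 'I_d) : {poly K} := if j == R then (dot3 (nvec R) b)%:P
  else if j == R' then (dot3 (nvec R') a)%:P else PL j.
have PLE (j : 'I_d) : PL j = 'X^(h j) * U j.
  rewrite /h /U /PL; have [->|jR] := eqVneq j R.
    by rewrite dotRq dotRa !polyC0 mul0r !add0r mulrC.
  have [->|jR'] := eqVneq j R'; last by rewrite expr0 mul1r.
  by rewrite dotR'q dotR'b !polyC0 mul0r add0r addr0 expr1 mulrC.
have U0 j : (U j).[0] != 0.
  rewrite /U; have [_|jR] := eqVneq j R.
    by rewrite hornerC dot_det nvec_indep // eq_sym.
  have [_|jR'] := eqVneq j R'.
    rewrite hornerC dot_det nvec_indep //; first by rewrite eq_sym.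
    by rewrite eq_sym.
  rewrite /PL !hornerE /= expr0n /= !mulr0 !addr0 dot_det.
  by rewrite nvec_indep // eq_sym.
pose w (m : 'X_{1..d}) := (\sum_(j < d) h j * edge_exp m j)%N.
have wE m : w m = (M * edge_exp m R + edge_exp m R')%N.
  rewrite /w (bigD1 R) //= (bigD1 R') //= big1 ?addn0 => [|j /andP[jR jR']].
    by rewrite /h eqxx (negbTE rr') eqxx mul1n.
  by rewrite /h (negbTE jR) (negbTE jR') mul0n.
have w_lt m : m \in msupp f -> m != m0 -> (w m < w m0)%N.
  move=> mf nm; rewrite !wE.
  have [lt|[-> lt]] := flag _ mf nm; last by rewrite ltn_add2l.
  have : (edge_exp m R' < M)%N by rewrite ltnS expD.
  by move: lt; clear; nia.
have w_le m : m \in msupp f -> (w m <= w m0)%N.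
  by move=> mf; have [->//|nm] := eqVneq m m0; apply/ltnW/w_lt.
pose cf (m : 'X_{1..d}) := f@_m * \prod_(i < d) alpha i ^+ m i.
(* [G] is f at the Wachspress point of p(s), with its poles cleared by s^(w m0) and the D-th powers
   of the [U j]. At s = 0 only the term of [m0] survives. *)
pose G : {poly K} := \sum_(m <- msupp f) (cf m)%:P * 'X^(w m0 - w m)
  * \prod_(j < d) U j ^+ (D - edge_exp m j).
have G0 : G.[0] != 0.
  rewrite /G horner_sum (big_rem m0) //= [X in _ + X]big_seq [X in _ + X]big1 ?addr0 => [|m].
    rewrite subnn expr0 mulr1 hornerM hornerC. rewrite horner_prod !mulf_neq0 //.
    - by rewrite -mcoeff_msupp.
    - by apply/prodf_neq0 => i _; rewrite expf_neq0.
    by apply/prodf_neq0 => i _; rewrite horner_exp expf_neq0.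
  rewrite mem_rem_uniq ?msupp_uniq // inE => /andP[nm mf].
  rewrite !hornerM hornerXn expr0n subn_eq0 leqNgt w_lt //=.
  by rewrite mulr0 mul0r.
(* The Wachspress point is defined only where no [PL j] vanishes; the extra product takes care of
   the other values of s. *)
suff /eqP : G * \prod_(j < d) PL j = 0.
  rewrite mulf_eq0 => /orP[/eqP e|]; first by rewrite e horner0 eqxx in G0.
  apply/negP/prodf_neq0 => j _; rewrite PLE mulf_neq0 ?expf_neq0 ?polyX_eq0 //.
  by apply/eqP => e; have := U0 j; rewrite e horner0 eqxx.
apply: poly_zero_fun => s; rewrite hornerM horner_prod.
have [/existsP[j /eqP e]|/existsPn nz] := boolP [exists j : 'I_d, (PL j).[s] == 0].
  by rewrite (bigD1 j) //= e mul0r mulr0.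
suff -> : G.[s] = 0 by rewrite mul0r.
pose p : v3 K := add3 (add3 q (scale3 s a)) (scale3 (s ^+ M) b).
have Lp j : dot3 (nvec j) p = (PL j).[s].
  by rewrite /PL !hornerE /dot3 /p /add3 /scale3 /c1 /c2 /c3 /=; ring.
have Lp0 j : dot3 (nvec j) p != 0.
  by rewrite -nvec_mod -(val_vidx n) Lp nz.
have s0 : s != 0.
  apply/eqP => s0; have := nz R; rewrite PLE /h eqxx s0 hornerM hornerXn expr0n /=.
  by rewrite mul0r eqxx.
have Us j : (U j).[s] != 0.
  by have := nz j; rewrite PLE hornerM mulf_eq0 negb_or => /andP[].
suff -> : G.[s] = s ^+ w m0 * (\prod_(j < d) (U j).[s] ^+ D) * f.@[fun i : 'I_d => wpoint p i].
  by rewrite ev0 // mulr0.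
rewrite mevalE mulr_sumr horner_sum big_seq [RHS]big_seq; apply: eq_bigr => m mf.
have LE : \prod_(j < d) dot3 (nvec j) p ^+ edge_exp m j =
    s ^+ w m * \prod_(j < d) (U j).[s] ^+ edge_exp m j.
  rewrite /w expr_sum -big_split /=; apply: eq_bigr => j _.
  by rewrite Lp PLE hornerM hornerXn exprMn exprM.
have UE : \prod_(j < d) (U j).[s] ^+ D =
    \prod_(j < d) (U j).[s] ^+ edge_exp m j * \prod_(j < d) (U j).[s] ^+ (D - edge_exp m j).
  by rewrite -big_split /=; apply: eq_bigr => j _; rewrite -exprD subnKC ?expD.
have -> : s ^+ w m0 = s ^+ (w m0 - w m) * s ^+ w m by rewrite -exprD subnK ?w_le.
rewrite UE !hornerM hornerC hornerXn horner_prod /cf -(wpoint_monomial _ Lp0) LE.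
under [X in _ * X = _]eq_bigr => j _ do rewrite horner_exp.
by ring.
Qed.

End NormalIndependence.

(** * Membership in a finitely generated ideal *)

Section Ideals.
Variables (K : fieldType) (n : nat) (gens : seq {mpoly K[n]}).
Local Notation S := {mpoly K[n]}.
Local Notation I := (in_ideal gens).

Lemma in_idealP (f : S) :
  I f <-> exists c : 'I_(size gens) -> S, f = \sum_i c i * gens`_i.
Proof.
split=> [[c [_ ->]]|[c ->]]; first by exists (fun i => c`_i).
exists [seq c i | i <- enum 'I_(size gens)]; split; first by rewrite size_map size_enum_ord.
apply: eq_bigr => i _; congr (_ * _).
by rewrite (nth_map i) ?size_enum_ord // nth_ord_enum.
Qed.

Lemma in_ideal0 : I 0.
Proof. by apply/in_idealP; exists (fun=> 0); rewrite big1 // => i _; rewrite mul0r. Qed.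

Lemma in_idealD f g : I f -> I g -> I (f + g).
Proof.
move=> /in_idealP[a ->] /in_idealP[b ->]; apply/in_idealP; exists (fun i => a i + b i).
by rewrite -big_split; apply: eq_bigr => i _; rewrite mulrDl.
Qed.

Lemma in_idealM h f : I f -> I (h * f).
Proof.
move=> /in_idealP[a ->]; apply/in_idealP; exists (fun i => h * a i).
by rewrite mulr_sumr; apply: eq_bigr => i _; rewrite mulrA.
Qed.

Lemma in_ideal_gen g : g \in gens -> I g.
Proof.
move=> gg; apply/in_idealP; have ig : (index g gens < size gens)%N by rewrite index_mem.
exists (fun i => (i == Ordinal ig)%:R); rewrite (bigD1 (Ordinal ig)) //= big1.
  by rewrite eqxx mul1r addr0 nth_index.
by move=> i /negbTE->; rewrite mul0r.
Qed.

Lemma in_idealN f : I f -> I (- f).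
Proof. by move=> /(in_idealM (-1)); rewrite mulN1r. Qed.

Lemma in_idealB f g : I f -> I g -> I (f - g).
Proof. by move=> If /in_idealN; apply: in_idealD. Qed.

Lemma in_idealZ c f : I f -> I (c *: f).
Proof. by move=> If; rewrite -mul_mpolyC; apply: in_idealM. Qed.

Lemma in_ideal_sum (J : Type) (r : seq J) (P : pred J) (F : J -> S) :
  (forall j, I (F j)) -> I (\sum_(j <- r | P j) F j).
Proof. by move=> IF; elim/big_ind: _ => [||//]; [apply: in_ideal0 | apply: in_idealD]. Qed.

Lemma in_ideal_morph (B : comPzRingType) (f : {rmorphism S -> B}) :
  {in gens, forall g, f g = 0} -> forall h, I h -> f h = 0.
Proof.
move=> f0 h /in_idealP[c ->]; rewrite rmorph_sum big1 //= => i _.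
by rewrite rmorphM /= (f0 gens`_i) ?mulr0 // mem_nth.
Qed.

Lemma in_ideal_pihomog : {in gens, forall g, exists k, g \is k.-homog} ->
  forall q f, I f -> I (pihomog mdeg q f).
Proof.
move=> hg q f /in_idealP[c ->]; rewrite pihomog_sum; apply: in_ideal_sum => i.
have gi : gens`_i \in gens by apply: mem_nth.
have [k hk] := hg _ gi; rewrite mulrC; have [le|lt] := leqP k q.
  by rewrite -(subnKC le) pihomogMl // mulrC; apply/in_idealM/in_ideal_gen.
by rewrite (pihomogMl_lt _ hk lt); apply: in_ideal0.
Qed.

End Ideals.

Lemma mnm_split n (m : 'X_{1..n}) k : mdeg m = k.+1 ->
  exists i m', m = (U_(i) + m')%MM /\ mdeg m' = k.
Proof.
move=> mk; have [/existsP[i mi]|/existsPn none] := boolP [exists i, m i != 0%N].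
  exists i, (m - U_(i))%MM; have e : (m = U_(i) + (m - U_(i)))%MM.
    by rewrite addmC submK // lep1mP.
  split=> //; have := congr1 mdeg e; rewrite mdegD mdeg1 mk add1n.
  by case.
suff m0 : m = 0%MM by rewrite m0 mdeg0 in mk.
by apply/mnmP => i; rewrite mnm0E; have := none i; rewrite negbK => /eqP.
Qed.

(** * One-parameter families of polynomials *)

Section PolyPaths.
Variables (K : realFieldType) (n : nat).
Local Notation S := {mpoly K[n]}.

Definition coef_homog k (E : {poly S}) := forall i, E`_i \is k.-homog.

Lemma coef_homogM k l E E' : coef_homog k E -> coef_homog l E' -> coef_homog (k + l) (E * E').
Proof. by move=> h h' i; rewrite coefM rpred_sum // => j _; apply: dhomogM. Qed.

Lemma coef_homogD k E E' : coef_homog k E -> coef_homog k E' -> coef_homog k (E + E').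
Proof. by move=> h h' i; rewrite coefD rpredD. Qed.

Lemma coef_homogB k E E' : coef_homog k E -> coef_homog k E' -> coef_homog k (E - E').
Proof. by move=> h h' i; rewrite coefB rpredB. Qed.

Lemma coef_homog_sum k (J : Type) (r : seq J) (P : pred J) (F : J -> {poly S}) :
  (forall j, coef_homog k (F j)) -> coef_homog k (\sum_(j <- r | P j) F j).
Proof. by move=> h i; rewrite coef_sum rpred_sum // => j _; apply: h. Qed.

Lemma coef_homogC k f : f \is k.-homog -> coef_homog k f%:P.
Proof. by move=> hf i; rewrite coefC; case: ifP => // _; apply: rpred0. Qed.

Lemma coef_homogXn k : coef_homog 0 ('X^k : {poly S}).
Proof. by move=> i; rewrite coefXn; case: eqP => _; [apply: dhomog1 | apply: rpred0]. Qed.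

Lemma coef_homogMXn k l E : coef_homog k E -> coef_homog k ('X^l * E).
Proof. by move=> hE; rewrite -[k]add0n; apply: coef_homogM; first exact: coef_homogXn. Qed.

Variable b : nat.

Lemma mcoeff_horner (E : {poly S}) m s :
  (map_poly (mcoeff m) E).[s] = (E.[s%:MP])@_m.
Proof.
rewrite (horner_coef_wide _ (size_poly _ _)) horner_coef raddf_sum /=.
apply: eq_bigr => i _; rewrite coef_map /= -rmorphXn /=.
by rewrite [in RHS]mulrC mul_mpolyC mcoeffZ mulrC.
Qed.

(* Linear independence of the monomials at [s = 0] persists for some [s <> 0]. *)
Lemma generic_span (E : 'X_{1..n < b} -> {poly S}) :
  (forall m, (E m)`_0 = 'X_[m]) -> (forall m i, msize (E m)`_i <= b)%N ->
  exists2 s, s != 0 & forall f : S, (msize f <= b)%N ->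
    exists y : 'X_{1..n < b} -> K, f = \sum_m y m *: (E m).[s%:MP].
Proof.
move=> E0 Eb; pose N := #|{: 'X_{1..n < b}}|.
pose mon (i : 'I_N) : 'X_{1..n < b} := enum_val i.
pose P : 'M[{poly K}]_N := \matrix_(i, j) map_poly (mcoeff (mon j)) (E (mon i)).
have detP0 : (\det P).[0] = 1.
  rewrite -horner_evalE -det_map_mx -[RHS](det1 _ N); congr (\det _).
  apply/matrixP => i j; rewrite !mxE /= horner_evalE mcoeff_horner mpolyC0.
  rewrite horner_coef0 E0 mcoeffX; congr (nat_of_bool _)%:R.
  by rewrite -bmeqP (inj_eq enum_val_inj).
(* The factor ['X] forces the chosen nonroot to be different from 0. *)
have [|s] := @poly_nonroot _ ('X * \det P).
  rewrite mulf_neq0 ?polyX_eq0 //; apply: contraTneq (oner_neq0 K) => e.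
  by rewrite -detP0 e horner0 eqxx.
rewrite hornerM hornerX mulf_eq0 negb_or => /andP[s0 dets].
exists s => // f fb; pose Ps := map_mx (horner_eval s) P.
have uPs : Ps \in unitmx by rewrite unitmxE unitfE det_map_mx.
pose a : 'rV[K]_N := \row_j f@_(mon j); pose z := a *m invmx Ps.
exists (fun m => z 0 (enum_rank m)).
have sizeE m : (msize (E m).[s%:MP] <= b)%N.
  rewrite horner_coef; apply: (leq_trans (msize_sum _ _ _)).
  apply/bigmax_leqP => i _; rewrite -rmorphXn mulrC mul_mpolyC.
  exact: leq_trans (msizeZ_le _ _) (Eb _ _).
have small (g : S) m : (msize g <= b)%N -> (b <= mdeg m)%N -> g@_m = 0.
  by move=> gb bm; apply/memN_msupp_eq0/msize_mdeg_ge/(leq_trans gb).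
apply/mpolyP => m; rewrite raddf_sum /=.
have [bm|mb] := leqP b (mdeg m).
  by rewrite small // big1 // => m' _; rewrite mcoeffZ small // mulr0.
have -> : f@_m = a 0 (enum_rank (BMultinom mb)) by rewrite mxE /mon enum_rankK.
have -> : a = z *m Ps by rewrite mulmxKV.
rewrite mxE (reindex (fun m : 'X_{1..n < b} => enum_rank m)) /=; last first.
  exact: onW_bij (enum_rank_bij _).
apply: eq_bigr => m' _; rewrite mcoeffZ !mxE /= /mon !enum_rankK horner_evalE.
by rewrite mcoeff_horner.
Qed.

End PolyPaths.

(** * Generic linear forms span *)

Section Spanning.
Variables (K : realFieldType) (n : nat) (v : nat -> K * K).
Local Notation d := n.+3.
Local Notation S := {mpoly K[d]}.
Local Notation bv := (bv d v).
Local Notation nvec := (nvec d v).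
Local Notation alpha := (alpha d v).
Local Notation I := (in_ideal (gensI d v)).

Definition ord1 : 'I_d := @Ordinal d 1 isT.
Definition ord2 : 'I_d := @Ordinal d 2 isT.
Definition mid (j : 'I_n) : 'I_d := @Ordinal d j.+3 (ltn_ord j).
(** Index 0 stands for the vertex v_d. The values 1, ..., d also serve as distinct scalars in
    [theta2]. *)
Definition pidx (i : 'I_d) : nat := if i == 0%N :> nat then d else i.

Definition basis_idx := option ('I_n + {p : 'I_n * 'I_n | (p.1 < p.2)%N}).
Definition basis_deg (b : basis_idx) : nat :=
  match b with None => 0 | Some (inl _) => 1 | Some (inr _) => 2 end.
Definition basis_mon (b : basis_idx) : S :=
  match b with
  | None => 1
  | Some (inl j) => 'X_(mid j)
  | Some (inr p) => 'X_(mid (val p).1) * 'X_(mid (val p).2)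
  end.

Lemma pidx_inj i j : pidx i = pidx j -> i = j.
Proof.
rewrite /pidx; have := ltn_ord i; have := ltn_ord j => hj hi e.
by apply: val_inj => /=; move: e; case: eqP; case: eqP; clear -hi hj; lia.
Qed.

Lemma vidx_pidx i : vidx n (pidx i) = i.
Proof.
rewrite /pidx; case: eqP => [i0|_]; last exact: vidx_ord.
by apply: val_inj; rewrite /= val_vidx modnn i0.
Qed.

Section Coefficients.
Variable c : 'I_d -> K.

Definition theta1 : S := \sum_(i | i != ord2) c i *: 'X_i.
(** The scalars [pidx i] are distinct, so [theta2 - (pidx j) theta1] has no x_j-term. The variable
    x_2 is left out of both forms since it is a parameter by itself. *)
Definition theta2 : S := \sum_(i | i != ord2) ((pidx i)%:R * c i) *: 'X_i.

Definition theta_ideal (f : S) : Prop := exists h0 h1 h2,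
  I (f - ('X_ord2 * h0 + theta1 * h1 + theta2 * h2)).

Definition spanned (f : S) : Prop :=
  exists y : basis_idx -> K, theta_ideal (f - \sum_b y b *: basis_mon b).

Lemma theta_idealD f g : theta_ideal f -> theta_ideal g -> theta_ideal (f + g).
Proof.
move=> [h0 [h1 [h2 If]]] [k0 [k1 [k2 Ig]]]; exists (h0 + k0), (h1 + k1), (h2 + k2).
by have := in_idealD If Ig; congr (I _); ring.
Qed.

Lemma theta_idealM f g : theta_ideal g -> theta_ideal (f * g).
Proof.
move=> [h0 [h1 [h2 /(in_idealM f) Ig]]]; exists (f * h0), (f * h1), (f * h2).
by move: Ig; congr (I _); ring.
Qed.

Lemma theta_idealZ a f : theta_ideal f -> theta_ideal (a *: f).
Proof. by move=> h; rewrite -mul_mpolyC; apply: theta_idealM. Qed.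

Lemma in_ideal_theta f : I f -> theta_ideal f.
Proof. by exists 0, 0, 0; rewrite !mulr0 !addr0 subr0. Qed.

Lemma theta_ideal_ord2 h : theta_ideal ('X_ord2 * h).
Proof. by exists h, 0, 0; rewrite !mulr0 !addr0 subrr; apply: in_ideal0. Qed.

Lemma theta_ideal1 h : theta_ideal (theta1 * h).
Proof. by exists 0, h, 0; rewrite !mulr0 addr0 add0r subrr; apply: in_ideal0. Qed.

Lemma theta_ideal2 h : theta_ideal (theta2 * h).
Proof. by exists 0, 0, h; rewrite !mulr0 !add0r subrr; apply: in_ideal0. Qed.

Lemma spannedD f g : spanned f -> spanned g -> spanned (f + g).
Proof.
move=> [y hy] [z hz]; exists (fun b => y b + z b).
have := theta_idealD hy hz; congr (theta_ideal _).
under [X in _ = _ - X]eq_bigr => b _ do rewrite scalerDl.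
by rewrite big_split /=; ring.
Qed.

Lemma spannedZ a f : spanned f -> spanned (a *: f).
Proof.
move=> [y hy]; exists (fun b => a * y b).
have := theta_idealZ a hy; rewrite scalerBr scaler_sumr; congr (theta_ideal (_ - _)).
by apply: eq_bigr => b _; rewrite scalerA.
Qed.

Lemma spanned_theta f : theta_ideal f -> spanned f.
Proof.
by exists (fun=> 0); rewrite big1 ?subr0 // => b _; rewrite scale0r.
Qed.

Lemma spanned0 : spanned 0.
Proof. exact/spanned_theta/in_ideal_theta/in_ideal0. Qed.

Lemma spanned_sum (J : Type) (r : seq J) (P : pred J) (F : J -> S) :
  (forall j, spanned (F j)) -> spanned (\sum_(j <- r | P j) F j).
Proof. by move=> h; elim/big_ind: _ => [||//]; [apply: spanned0 | apply: spannedD]. Qed.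

Lemma spanned_basis b : spanned (basis_mon b).
Proof.
exists (fun b' => (b' == b)%:R); rewrite (bigD1 b) //= big1 ?addr0 => [|b' /negbTE->].
  by rewrite eqxx scale1r subrr; apply/in_ideal_theta/in_ideal0.
by rewrite scale0r.
Qed.

Lemma basis_mon_homog b : basis_mon b \is (basis_deg b).-homog.
Proof.
have h (i : 'I_d) : ('X_i : S) \is 1.-homog by rewrite dhomogX; apply/eqP/mdeg1.
case: b => [[j|p]|] /=; [exact: h | | exact: dhomog1].
exact: (dhomogM (h (mid (val p).1)) (h (mid (val p).2))).
Qed.

Lemma msize_homog k (f : S) : f \is k.-homog -> (msize f <= k.+1)%N.
Proof.
by move=> hf; rewrite msizeE; apply/bigmax_leqP_seq => m mf _; rewrite (dhomog_mdeg hf).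
Qed.

(** A variable times a basis monomial has degree at most 3, so induction on the degree reduces
    spanning to a finite-dimensional space. *)
Lemma spanned_all : (forall f, (msize f <= 4)%N -> spanned f) -> forall f, spanned f.
Proof.
move=> low f; rewrite (mpolyE f); apply: spanned_sum => m; apply: spannedZ.
move: {2}(mdeg m) (erefl (mdeg m)) => k; elim: k m => [|k IH] m mk.
  by apply: low; rewrite msizeX mk.
have [i [m' [-> m'k]]] := mnm_split mk; have [y hy] := IH _ m'k.
rewrite mpolyXD -(subrK (\sum_b y b *: basis_mon b) 'X_[m']) mulrDr.
apply: spannedD; first exact/spanned_theta/theta_idealM.
rewrite mulr_sumr; apply: spanned_sum => b; rewrite -scalerAr; apply/spannedZ/low.
have hb : ('X_i * basis_mon b : S) \is (1 + basis_deg b).-homog.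
  by apply: dhomogM (basis_mon_homog b); rewrite dhomogX; apply/eqP/mdeg1.
apply: leq_trans (msize_homog hb) _.
by case: b {hb} => [[]|].
Qed.

End Coefficients.

(** From vertex k to vertex k + 1 the weight drops by exactly one for 2 <= k < d, so Lambda_k
    degenerates to its x_(k+1)-term. Weight 0 at vertex 1 makes tau degenerate to x_1 v_1. *)
Definition wt (i : 'I_d) : nat :=
  if i == 1%N :> nat then 0 else if i == 0%N :> nat then d else (d.*2 - i)%N.

Definition dilate s : S -> S := comp_mpoly [tuple (s ^+ wt i) *: 'X_i | i < d].
HB.instance Definition _ s := GRing.RMorphism.on (dilate s).

Lemma dilateX s i : dilate s 'X_i = s ^+ wt i *: 'X_i.
Proof. by rewrite /dilate comp_mpolyXU -tnth_nth tnth_mktuple. Qed.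

Lemma dilateC s c : dilate s c%:MP = c%:MP.
Proof. exact: comp_mpolyC. Qed.

Lemma dilateZ s c f : dilate s (c *: f) = c *: dilate s f.
Proof. exact: comp_mpolyZ. Qed.

Lemma dilateVK s : s != 0 -> cancel (dilate s) (dilate s^-1).
Proof.
move=> s0; apply: (alg_endo_id (phi := dilate s^-1 \o dilate s)) => [c|i] /=.
  by rewrite !dilateC.
change (dilate s^-1 (dilate s 'X_i) = 'X_i).
by rewrite dilateX dilateZ dilateX scalerA -exprMn mulfV // expr1n scale1r.
Qed.

(** In the dilated coordinates the linear forms do not depend on s and the basis monomials are only
    rescaled; only the generators of I(d) move. *)
Definition dspanned s f := spanned (fun i => s^-1 ^+ wt i) (dilate s^-1 f).

Definition iotaP (c : K) : {poly S} := (c%:MP)%:P.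
Definition Lambda_path k : v3 {poly S} :=
  sub3 (scale3 ((xv K d k.+1)%:P * iotaP (alpha k.+1)^-1) (map3 iotaP (nvec k.+1)))
       (scale3 ('X * (xv K d k)%:P * iotaP (alpha k)^-1) (map3 iotaP (nvec (k + d).-1))).
Definition tau_path : v3 {poly S} :=
  gtau n v iotaP (fun i => 'X^(wt (vidx n i)) * (xv K d i)%:P).

Lemma map_Lambda_path (f : {rmorphism {poly S} -> S}) t k :
  f 'X = t -> (forall g, f g%:P = g) ->
  map3 f (Lambda_path k) =
    sub3 (scale3 (xv K d k.+1 * ((alpha k.+1)^-1)%:MP) (map3 (@mpolyC d K) (nvec k.+1)))
         (scale3 (t * xv K d k * ((alpha k)^-1)%:MP)
            (map3 (@mpolyC d K) (nvec (k + d).-1))).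
Proof.
move=> fX fC; have fi (a : v3 K) : map3 f (map3 iotaP a) = map3 (@mpolyC d K) a.
  by apply: map3_map3 => c; apply: fC.
rewrite /Lambda_path map3_sub3; congr (sub3 _ _).
  by apply: (etrans (map3_scale3 f _ _)); rewrite fi (rmorphM f) !fC.
by apply: (etrans (map3_scale3 f _ _)); rewrite fi !(rmorphM f) fX !fC.
Qed.

Lemma dilate_Lambda s k : (1 < k < d)%N ->
  map3 (dilate s) (Lambda d v k) =
  scale3 ((s ^+ (d.*2 - k.+1))%:MP) (map3 (horner_eval s%:MP) (Lambda_path k)).
Proof.
move=> /andP[k1 kd].
have wk : wt (vidx n k) = (d.*2 - k.+1).+1%N.
  rewrite /wt !val_vidx modn_small // gtn_eqF // gtn_eqF 1?ltnW //.
  by clear -kd; lia.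
have wk1 : wt (vidx n k.+1) = (d.*2 - k.+1)%N.
  rewrite /wt !val_vidx; move: kd; rewrite leq_eqVlt => /orP[/eqP ->|kd].
    by rewrite modnn /=; clear; lia.
  by rewrite modn_small // gtn_eqF // ltnW.
rewrite LambdaE (@map_gLambda K n v _ _ (dilate s) _ (@mpolyC d K) _
  (fun j => (s ^+ wt (vidx n j))%:MP * xv K d j)); first last.
- by move=> j; rewrite xvE [LHS]dilateX mul_mpolyC.
- exact: dilateC.
rewrite (map_Lambda_path (f := horner_eval s%:MP) _ (hornerX _) (fun f => hornerC f _)).
rewrite /gLambda wk wk1 exprS mpolyCM.
move: (map3 _ _) (map3 _ _) (_%:MP) (xv _ _ _) (xv _ _ _) (_^-1)%:MP (_^-1)%:MP s%:MP.
move=> [[a1 a2] a3] [[b1 b2] b3] t x1 x2 e1 e2 t'.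
by rewrite /sub3 /scale3 /mk3 /c1 /c2 /c3 /=; congr (_, _, _); ring.
Qed.

Lemma map_tau_path (f : {rmorphism {poly S} -> S}) t :
  f 'X = t -> (forall g, f g%:P = g) ->
  map3 f tau_path = gtau n v (@mpolyC d K) (fun i => t ^+ wt (vidx n i) * xv K d i).
Proof.
move=> fX fC; apply: map_gtau => [c|j]; first exact: fC.
by rewrite (rmorphM f) (rmorphXn f) fX fC.
Qed.

Lemma dilate_tau s :
  map3 (dilate s) (tau d v) = map3 (horner_eval s%:MP) tau_path.
Proof.
rewrite (map_tau_path (f := horner_eval s%:MP) (hornerX _) (fun f => hornerC f _)) tauE.
apply: map_gtau => [c|j]; first exact: dilateC.
by rewrite xvE [LHS]dilateX -mul_mpolyC rmorphXn.
Qed.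

Definition quadric_path k : {poly S} := dot3 (Lambda_path k) tau_path.
Definition cubic_path i j k : {poly S} :=
  det3 (Lambda_path i) (Lambda_path j) (Lambda_path k).

Lemma dilate_quadric s k : (1 < k < d)%N ->
  dilate s (dot3 (Lambda d v k) (tau d v)) =
  (s ^+ (d.*2 - k.+1))%:MP * (quadric_path k).[s%:MP].
Proof.
move=> kd; rewrite -horner_evalE [LHS](map_dot3 (dilate s)).
rewrite [X in _ = _ * X](map_dot3 (horner_eval s%:MP)) -dot3_scalel.
exact: (f_equal2 (@dot3 S) (dilate_Lambda s kd) (dilate_tau s)).
Qed.

Lemma dilate_cubic s i j k : (1 < i < d)%N -> (1 < j < d)%N -> (1 < k < d)%N ->
  dilate s (det3 (Lambda d v i) (Lambda d v j) (Lambda d v k)) =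
  (s ^+ (d.*2 - i.+1) * s ^+ (d.*2 - j.+1) * s ^+ (d.*2 - k.+1))%:MP *
    (cubic_path i j k).[s%:MP].
Proof.
move=> id jd kd; rewrite -horner_evalE [LHS](map_det3 (dilate s)) !mpolyCM.
rewrite [X in _ = _ * X](map_det3 (horner_eval s%:MP)) -det3_scale.
exact: (f_equal3 (@det3 S) (dilate_Lambda s id) (dilate_Lambda s jd) (dilate_Lambda s kd)).
Qed.

Definition homog3 k (E : v3 {poly S}) :=
  [/\ coef_homog k (c1 E), coef_homog k (c2 E) & coef_homog k (c3 E)].

Lemma iotaP_homog c : coef_homog 0 (iotaP c).
Proof. by apply: coef_homogC; rewrite -alg_mpolyC rpredZ // dhomog1. Qed.

Lemma xvP_homog i : coef_homog 1 (xv K d i)%:P.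
Proof. by apply: coef_homogC; rewrite xvE dhomogX; apply/eqP/mdeg1. Qed.

Lemma scale3_homog k E (a : v3 K) : coef_homog k E -> homog3 k (scale3 E (map3 iotaP a)).
Proof.
by move=> h; split; rewrite -[k]addn0; apply: coef_homogM (iotaP_homog _).
Qed.

Lemma Lambda_path_homog k : homog3 1 (Lambda_path k).
Proof.
have [h1 h2 h3] : homog3 1 (scale3 ((xv K d k.+1)%:P * iotaP (alpha k.+1)^-1) (map3 iotaP (nvec k.+1))).
  exact/scale3_homog/(coef_homogM (xvP_homog _) (iotaP_homog _)).
have [l1 l2 l3] : homog3 1 (scale3 ('X * (xv K d k)%:P * iotaP (alpha k)^-1) (map3 iotaP (nvec (k + d).-1))).
  apply/scale3_homog/(@coef_homogM _ _ 1 0); last exact: iotaP_homog.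
  exact: (coef_homogMXn 1 (@xvP_homog k)).
by split; [exact: (coef_homogB h1 l1) | exact: (coef_homogB h2 l2) | exact: (coef_homogB h3 l3)].
Qed.

Lemma tau_path_homog : homog3 1 tau_path.
Proof.
have h (i : 'I_d) : homog3 1 (scale3 ('X^(wt (vidx n i)) * (xv K d i)%:P) (map3 iotaP (bv i))).
  exact/scale3_homog/(coef_homogMXn _ (@xvP_homog i)).
rewrite /tau_path /gtau (@big_add3 {poly S}).
split; apply: (@coef_homog_sum _ _ 1) => i; have [h1 h2 h3] := h i;
  [exact: h1 | exact: h2 | exact: h3].
Qed.

Lemma dot3_homog k l E E' : homog3 k E -> homog3 l E' -> coef_homog (k + l) (dot3 E E').
Proof.
move=> [a1 a2 a3] [b1 b2 b3]; apply: coef_homogD; last exact: (coef_homogM a3 b3).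
by apply: coef_homogD; [exact: (coef_homogM a1 b1) | exact: (coef_homogM a2 b2)].
Qed.

Lemma cross3_homog k l E E' : homog3 k E -> homog3 l E' -> homog3 (k + l) (cross3 E E').
Proof.
move=> [a1 a2 a3] [b1 b2 b3].
by split; [exact: (coef_homogB (coef_homogM a2 b3) (coef_homogM a3 b2))
  | exact: (coef_homogB (coef_homogM a3 b1) (coef_homogM a1 b3))
  | exact: (coef_homogB (coef_homogM a1 b2) (coef_homogM a2 b1))].
Qed.

Lemma quadric_path_homog k : coef_homog 2 (quadric_path k).
Proof. exact: (dot3_homog (Lambda_path_homog _) tau_path_homog). Qed.

Lemma cubic_path_homog i j k : coef_homog 3 (cubic_path i j k).
Proof.
apply: (dot3_homog (Lambda_path_homog _) (cross3_homog (Lambda_path_homog _) (Lambda_path_homog _))).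
Qed.

Lemma coef0_map (E : {poly S}) : E`_0 = horner_eval 0 E.
Proof. by rewrite horner_evalE horner_coef0. Qed.

Lemma Lambda_path0 k : map3 (horner_eval 0) (Lambda_path k) =
  scale3 ((alpha k.+1)^-1 *: xv K d k.+1) (map3 (@mpolyC d K) (nvec k.+1)).
Proof.
rewrite (map_Lambda_path (f := horner_eval (0 : S)) _ (hornerX _) (fun f => hornerC f _)).
rewrite !mul0r -mul_mpolyC [in RHS]mulrC.
by rewrite /sub3 /scale3 /mk3 /c1 /c2 /c3 /=; congr (_, _, _); rewrite mul0r subr0.
Qed.

Lemma tau_path0 : map3 (horner_eval 0) tau_path =
  scale3 'X_ord1 (map3 (@mpolyC d K) (bv 1)).
Proof.
rewrite (map_tau_path (f := horner_eval (0 : S)) (hornerX _) (fun f => hornerC f _)).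
have zero (i : 'I_d) : i != ord1 -> (0 : S) ^+ wt (vidx n i) = 0.
  rewrite vidx_ord -val_eqE /= /wt => /negbTE->; case: eqP => _; rewrite expr0n //.
  by have := ltn_ord i; rewrite -addnn; case: eqP => // e; move: e; clear; lia.
rewrite /gtau big_add3 /scale3 /mk3; congr (_, _, _); rewrite (bigD1 ord1) //= big1.
- by rewrite addr0 xvE (vidx_ord ord1) expr0 mul1r.
- by move=> i /zero e; rewrite e !mul0r.
- by rewrite addr0 xvE (vidx_ord ord1) expr0 mul1r.
- by move=> i /zero e; rewrite e !mul0r.
- by rewrite addr0 xvE (vidx_ord ord1) expr0 mul1r.
by move=> i /zero e; rewrite e !mul0r.
Qed.

Lemma quadric_path0 k : (quadric_path k)`_0 =
  ((alpha k.+1)^-1 * dot3 (nvec k.+1) (bv 1)) *: ('X_ord1 * xv K d k.+1).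
Proof.
rewrite coef0_map (map_dot3 (horner_eval 0)) Lambda_path0 tau_path0.
rewrite dot3_scalel dot3C dot3_scalel dot3C -(map_dot3 (@mpolyC d K)).
by rewrite -!mul_mpolyC mpolyCM; ring.
Qed.

Lemma cubic_path0 i j k : (cubic_path i j k)`_0 =
  ((alpha i.+1)^-1 * (alpha j.+1)^-1 * (alpha k.+1)^-1 *
     det3 (nvec i.+1) (nvec j.+1) (nvec k.+1)) *:
  (xv K d i.+1 * xv K d j.+1 * xv K d k.+1).
Proof.
rewrite coef0_map.
rewrite [LHS](map_det3 (horner_eval 0)).
rewrite (f_equal3 (@det3 S) (Lambda_path0 i) (Lambda_path0 j) (Lambda_path0 k)).
rewrite [LHS]det3_scale.
rewrite -[X in _ * X = _](map_det3 (@mpolyC d K)).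
rewrite -!mul_mpolyC !mpolyCM.
by ring.
Qed.

End Spanning.

(** * Closure properties of deformable polynomials *)

Section GenericSpanning.
Variables (K : realFieldType) (n : nat) (v : nat -> K * K).
Local Notation d := n.+3.
Local Notation S := {mpoly K[d]}.
Local Notation bv := (bv d v).
Local Notation nvec := (nvec d v).
Local Notation alpha := (alpha d v).
Hypothesis alpha_neq0 : forall j, alpha j != 0.
Hypothesis nvec_indep : forall i j k : 'I_d, i != j -> j != k -> i != k ->
  det3 (nvec i) (nvec j) (nvec k) != 0.
Hypothesis nvec_bv_neq0 : forall i k, (k %% d != i %% d)%N -> (k %% d != i.+1 %% d)%N ->
  dot3 (nvec i) (bv k) != 0.
Local Notation dspanned := (@dspanned K n v).
Local Notation quadric_path := (@quadric_path K n v).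
Local Notation cubic_path := (@cubic_path K n v).
Local Notation ord1 := (ord1 n).
Local Notation ord2 := (ord2 n).
Local Notation X i := ('X_i : S).

Lemma msizeM_leq (f g : S) : (msize (f * g) <= (msize f + msize g).-1)%N.
Proof.
have [->|f0] := eqVneq f 0; first by rewrite mul0r msize0.
have [->|g0] := eqVneq g 0; first by rewrite mulr0 msize0.
by rewrite msizeM.
Qed.

Lemma dilateM s (f g : S) : dilate s (f * g) = dilate s f * dilate s g.
Proof. exact: rmorphM. Qed.

Lemma dspannedD s f g : dspanned s f -> dspanned s g -> dspanned s (f + g).
Proof. by rewrite /dspanned rmorphD; apply: spannedD. Qed.

Lemma dspannedZ s a f : dspanned s f -> dspanned s (a *: f).
Proof. by rewrite /dspanned dilateZ; apply: spannedZ. Qed.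

Lemma dspanned_sum s (J : Type) (r : seq J) (P : pred J) (F : J -> S) :
  (forall j, dspanned s (F j)) -> dspanned s (\sum_(j <- r | P j) F j).
Proof. by rewrite /dspanned rmorph_sum; apply: spanned_sum. Qed.

Lemma dspanned_quadric s k h : s != 0 -> (1 < k < d.-1)%N ->
  dspanned s (h * (quadric_path k).[s%:MP]).
Proof.
move=> s0 kd; apply/spanned_theta/in_ideal_theta; rewrite dilateM; apply: in_idealM.
have kd' : (1 < k < d)%N by clear -kd; lia.
have := dilate_quadric v s kd'; set N := (_ - _)%N => e.
have -> : (quadric_path k).[s%:MP] =
    (s ^+ N)^-1 *: dilate s (dot3 (Lambda d v k) (tau d v)).
  by rewrite e mul_mpolyC scalerA mulVf ?scale1r // expf_neq0.
rewrite dilateZ dilateVK //; apply/in_idealZ/in_ideal_gen; rewrite mem_cat.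
apply/orP; left; apply/mapP; exists k => //.
by rewrite mem_iota; clear -kd; lia.
Qed.

Lemma dspanned_cubic s i j k : s != 0 -> (1 < i < d)%N -> (1 < j < d)%N -> (1 < k < d)%N ->
  i != j -> j != k -> i != k -> dspanned s (cubic_path i j k).[s%:MP].
Proof.
move=> s0 id jd kd ij jk ik; apply/spanned_theta/in_ideal_theta.
have := dilate_cubic v s id jd kd; set N := (_ * _ * _) => e.
have N0 : N != 0 by rewrite !mulf_neq0 ?expf_neq0.
have -> : (cubic_path i j k).[s%:MP] =
    N^-1 *: dilate s (det3 (Lambda d v i) (Lambda d v j) (Lambda d v k)).
  by rewrite e mul_mpolyC scalerA mulVf ?scale1r.
rewrite dilateZ dilateVK //; apply/in_idealZ/in_ideal_gen; rewrite mem_cat.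
apply/orP; right; apply/mapP; exists ((i, j), k) => //.
rewrite mem_filter /distinct3 /= ij jk ik /=; apply/allpairsP; exists ((i, j), k).
have mem l : (1 < l < d)%N -> l \in iota 0 d by rewrite mem_iota; clear; lia.
by split=> //; [apply/allpairsP; exists (i, j); split=> //; apply: mem | apply: mem].
Qed.

(* [f] is the value at [0] of a polynomial family of small degree whose other
   values lie in the dilated span. *)
Definition deformable (f : S) := exists E : {poly S},
  [/\ E`_0 = f, forall i, (msize E`_i <= 4)%N & forall s, s != 0 -> dspanned s E.[s%:MP]].

Lemma deformableD f g : deformable f -> deformable g -> deformable (f + g).
Proof.
move=> [E [E0 Es Ed]] [F [F0 Fs Fd]]; exists (E + F); split=> [|i|s s0].
- by rewrite coefD E0 F0.
- by rewrite coefD (leq_trans (msizeD_le _ _)) // geq_max Es Fs.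
by rewrite hornerD; apply: dspannedD; [apply: Ed | apply: Fd].
Qed.

Lemma deformableZ a f : deformable f -> deformable (a *: f).
Proof.
move=> [E [E0 Es Ed]]; exists (a%:MP *: E); split=> [|i|s s0].
- by rewrite coefZ E0 mul_mpolyC.
- by rewrite coefZ mul_mpolyC (leq_trans (msizeZ_le _ _)).
by rewrite hornerZ mul_mpolyC; apply/dspannedZ/Ed.
Qed.

Lemma deformable_const f : (msize f <= 4)%N -> (forall s, s != 0 -> dspanned s f) -> deformable f.
Proof.
move=> fs fd; exists f%:P; split=> [|i|s s0]; first by rewrite coefC.
  by rewrite coefC; case: eqP => // _; rewrite msize0.
by rewrite hornerC; apply: fd.
Qed.

Lemma deformable0 : deformable 0.
Proof.
apply: deformable_const => [|s s0]; first by rewrite msize0.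
by rewrite /dspanned rmorph0; apply: spanned0.
Qed.

Lemma deformable_sum (J : Type) (r : seq J) (P : pred J) (F : J -> S) :
  (forall j, P j -> deformable (F j)) -> deformable (\sum_(j <- r | P j) F j).
Proof. by move=> h; elim/big_ind: _ => [||//]; [apply: deformable0 | apply: deformableD]. Qed.

Lemma deformable_basis b : deformable (basis_mon K b).
Proof.
apply: deformable_const => [|s s0].
  apply: leq_trans (msize_homog (basis_mon_homog _ _)) _.
  by case: b => [[]|].
rewrite /dspanned; case: b => [[j|p]|] /=.
- by rewrite dilateX; apply: spannedZ; apply: (@spanned_basis _ _ _ _ (Some (inl j))).
- rewrite dilateM !dilateX -scalerAl -scalerAr scalerA; apply: spannedZ.
  exact: (@spanned_basis _ _ _ _ (Some (inr p))).
by rewrite rmorph1; apply: (@spanned_basis _ _ _ _ None).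
Qed.

Lemma deformable_ord2 h : (msize h <= 3)%N -> deformable (X ord2 * h).
Proof.
move=> hs; apply: deformable_const => [|s s0].
  by apply: (leq_trans (msizeM_leq _ _)); rewrite msizeX mdeg1 /=.
rewrite /dspanned dilateM dilateX -scalerAl; apply/spannedZ/spanned_theta.
exact: theta_ideal_ord2.
Qed.

(** This is [theta2 - a theta1] times h in dilated coordinates; with a = [pidx j] the x_j-term drops
    out. *)
Lemma deformable_theta (a : K) h : (msize h <= 3)%N ->
  deformable (\sum_(i | i != ord2) ((pidx i)%:R - a) *: (X i * h)).
Proof.
move=> hs; apply: deformable_const => [|s s0].
  apply: (leq_trans (msize_sum _ _ _)); apply/bigmax_leqP => i _.
  apply: (leq_trans (msizeZ_le _ _)); apply: (leq_trans (msizeM_leq _ _)).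
  by rewrite msizeX mdeg1 /=.
rewrite /dspanned; set c := fun i => s^-1 ^+ wt i.
have -> : dilate s^-1 (\sum_(i | i != ord2) ((pidx i)%:R - a) *: (X i * h)) =
    theta2 c * dilate s^-1 h + (- a) *: (theta1 c * dilate s^-1 h).
  rewrite rmorph_sum /theta1 /theta2 !mulr_suml scaler_sumr -big_split /=.
  apply: eq_bigr => i _; rewrite dilateZ dilateM dilateX.
  by rewrite -!mul_mpolyC !rmorphM !rmorphB rmorphN /=; ring.
apply: spannedD; first exact/spanned_theta/theta_ideal2.
exact/spannedZ/spanned_theta/theta_ideal1.
Qed.

Lemma deformable_theta1 h : (msize h <= 3)%N ->
  deformable (\sum_(i | i != ord2) 1 *: (X i * h)).
Proof.
move=> hs; have := deformableD (deformable_theta 0 hs) (deformableZ (-1) (deformable_theta 1 hs)).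
rewrite scaler_sumr -big_split /=; congr deformable; apply: eq_bigr => i _.
by rewrite scalerA -scalerDl; congr (_ *: _); ring.
Qed.

Lemma deformable_solve (a : 'I_d -> K) (F : 'I_d -> S) j :
  deformable (\sum_(i | i != ord2) a i *: F i) -> j != ord2 -> a j != 0 ->
  (forall i, i != ord2 -> i != j -> a i != 0 -> deformable (F i)) -> deformable (F j).
Proof.
move=> + j2 aj; rewrite (bigD1 j) //= => h rest.
have -> : F j = (a j)^-1 *: (a j *: F j + \sum_(i | (i != ord2) && (i != j)) a i *: F i)
    + (- (a j)^-1) *: \sum_(i | (i != ord2) && (i != j)) a i *: F i.
  by rewrite scalerDr scalerA mulVf // scale1r scaleNr addrK.
apply: deformableD; first exact: deformableZ.
apply/deformableZ/deformable_sum => i /andP[i2 ij].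
have [->|ai] := eqVneq (a i) 0; first by rewrite scale0r; apply: deformable0.
exact/deformableZ/rest.
Qed.

Lemma deformable_quadric (j : 'I_d) h : (2 < j)%N -> (msize h <= 2)%N ->
  deformable (X ord1 * X j * h).
Proof.
move=> j2 hs; have kd : (1 < j.-1 < d.-1)%N.
  by have := ltn_ord j; move: j2; move: (j : nat) => [//|i]; clear; lia.
have jE : j.-1.+1 = j by rewrite prednK // (leq_trans _ j2).
set co := (alpha j.-1.+1)^-1 * dot3 (nvec j.-1.+1) (bv 1).
(* The vertex v_1 lies on neither end of edge j when 2 < j < d. *)
have co0 : co != 0.
  rewrite mulf_neq0 ?invr_eq0 // jE; apply: nvec_bv_neq0.
    by rewrite !modn_small // neq_ltn (ltnW j2).
  have := ltn_ord j; rewrite leq_eqVlt => /orP[/eqP ->|jd]; first by rewrite modnn modn_small.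
  by rewrite !modn_small // neq_ltn ltnS (ltnW (ltnW j2)).
exists (co^-1%:MP *: (h *: quadric_path j.-1)); split=> [|i|s s0].
- rewrite !coefZ quadric_path0 -/co xvE jE vidx_ord -!mul_mpolyC.
  have e : (co^-1)%:MP * co%:MP = 1 :> S by rewrite -mpolyCM mulVf // mpolyC1.
  by rewrite -[RHS]mul1r -e; ring.
- rewrite !coefZ mul_mpolyC (leq_trans (msizeZ_le _ _)) //.
  apply: (leq_trans (msizeM_leq _ _)).
  have hq : (msize (quadric_path j.-1)`_i <= 3)%N by apply: (@msize_homog _ _ 2); apply: quadric_path_homog.
  by rewrite -subn1 leq_subLR (leq_add hs hq).
rewrite !hornerZ mul_mpolyC; apply/dspannedZ/dspanned_quadric => //.
Qed.

Lemma deformable_cubic (i j k : 'I_d) : i != ord1 -> i != ord2 -> j != ord1 -> j != ord2 ->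
  k != ord1 -> k != ord2 -> i != j -> j != k -> i != k ->
  deformable (X i * X j * X k).
Proof.
have ran (x : 'I_d) : x != ord1 -> x != ord2 -> (1 < (pidx x).-1 < d)%N /\ (pidx x).-1.+1 = pidx x.
  rewrite -!val_eqE /= /pidx; have := ltn_ord x.
  by move: (x : nat) => [|[|[|y]]] yd //= _ _; split; move: yd; clear; lia.
move=> i1 i2 j1 j2 k1 k2 ij jk ik.
have [ri ei] := ran _ i1 i2; have [rj ej] := ran _ j1 j2; have [rk ek] := ran _ k1 k2.
have neq (x y : 'I_d) : (pidx x).-1.+1 = pidx x -> (pidx y).-1.+1 = pidx y ->
    x != y -> (pidx x).-1 != (pidx y).-1.
  move=> ex ey; apply: contra => /eqP e; apply/eqP/pidx_inj.
  by rewrite -ex -ey e.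
have nvec_pidx (x : 'I_d) : nvec (pidx x) = nvec x.
  by rewrite -[LHS]nvec_mod; congr nvec; rewrite -(val_vidx n) vidx_pidx.
have := neq i k ei ek ik; have := neq j k ej ek jk; have := neq i j ei ej ij.
set p := (pidx i).-1 in ri ei *; set q := (pidx j).-1 in rj ej *; set r := (pidx k).-1 in rk ek *.
move=> pq qr pr.
set co := (alpha p.+1)^-1 * (alpha q.+1)^-1 * (alpha r.+1)^-1 *
  det3 (nvec p.+1) (nvec q.+1) (nvec r.+1).
have co0 : co != 0.
  by rewrite !mulf_neq0 ?invr_eq0 // ei ej ek !nvec_pidx nvec_indep.
exists (co^-1%:MP *: cubic_path p q r); split=> [|l|s s0].
- rewrite coefZ cubic_path0 -/co !xvE ei ej ek !vidx_pidx -mul_mpolyC.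
  have e : (co^-1)%:MP * co%:MP = 1 :> S by rewrite -mpolyCM mulVf // mpolyC1.
  by rewrite mulrA e mul1r.
- rewrite coefZ mul_mpolyC (leq_trans (msizeZ_le _ _)) //.
  by apply: (@msize_homog _ _ 3); apply: cubic_path_homog.
rewrite hornerZ mul_mpolyC; by apply/dspannedZ/dspanned_cubic.
Qed.

End GenericSpanning.

(** * Monomials of degree at most 3 are deformable *)

Section SpanningTheorem.
Variables (K : realFieldType) (n : nat) (v : nat -> K * K).
Local Notation d := n.+3.
Local Notation S := {mpoly K[d]}.
Local Notation bv := (bv d v).
Local Notation nvec := (nvec d v).
Local Notation alpha := (alpha d v).
Hypothesis alpha_neq0 : forall j, alpha j != 0.
Hypothesis nvec_indep : forall i j k : 'I_d, i != j -> j != k -> i != k ->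
  det3 (nvec i) (nvec j) (nvec k) != 0.
Hypothesis nvec_bv_neq0 : forall i k, (k %% d != i %% d)%N -> (k %% d != i.+1 %% d)%N ->
  dot3 (nvec i) (bv k) != 0.
Local Notation deformable := (@deformable K n v).
Local Notation ord1 := (ord1 n).
Local Notation ord2 := (ord2 n).
Local Notation X i := ('X_i : S).
Implicit Types i j k : 'I_d.

Let ord_cases i : i != ord1 -> i != ord2 -> i != ord0 -> (2 < i)%N.
Proof. by rewrite -!val_eqE /=; move: (i : nat) => [|[|[|]]]. Qed.

Let mX1 i : (msize (X i) <= 2)%N. Proof. by rewrite msizeX mdeg1. Qed.
Let mX2 i j : (msize (X i * X j) <= 3)%N.
Proof. by rewrite -mpolyXD msizeX mdegD !mdeg1. Qed.
Let m1 : (msize (1 : S) <= 1)%N. Proof. by rewrite msize1. Qed.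

Let quad j h (j2 : (2 < j)%N) := deformable_quadric alpha_neq0 nvec_bv_neq0 j2 (h := h).

Let eq_def f g : f = g -> deformable f -> deformable g. Proof. by move=> ->. Qed.

Let def_distinct1 j k : j != ord1 -> j != ord2 -> k != ord1 -> k != ord2 -> j != k ->
  deformable (X ord1 * X j * X k).
Proof.
move=> j1 j2 k1 k2 jk; have [j0|j0] := eqVneq j ord0; last exact: quad (ord_cases j1 j2 j0) (mX1 k).
apply: eq_def (quad (ord_cases k1 k2 _) (mX1 j)); first by ring.
by rewrite -j0 eq_sym.
Qed.

(** Without x_1 the product is, up to a scalar, the limit of a cubic generator. With x_1, one of the
    other two variables is not x_d and gives the limit x_1 x_j of a quadric. *)
Lemma deformable_distinct i j k : i != ord2 -> j != ord2 -> k != ord2 ->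
  i != j -> j != k -> i != k -> deformable (X i * X j * X k).
Proof.
move=> i2 j2 k2 ij jk ik.
have [i1|i1] := eqVneq i ord1.
  by rewrite i1 in ij ik *; apply: def_distinct1; rewrite // eq_sym.
have [j1|j1] := eqVneq j ord1.
  by rewrite j1 in ij jk *; apply: eq_def (def_distinct1 i1 i2 _ k2 ik); [ring | rewrite eq_sym].
have [k1|k1] := eqVneq k ord1.
  by rewrite k1 in ik jk *; apply: eq_def (def_distinct1 i1 i2 j1 j2 ij); ring.
exact: deformable_cubic.
Qed.

Let pidx_neq i j : i != j -> (pidx i)%:R - (pidx j)%:R != 0 :> K.
Proof. by move=> ij; rewrite subr_eq0 eqr_nat; apply: contra ij => /eqP/pidx_inj/eqP. Qed.

Let pidx_sub i j : (pidx i)%:R - (pidx j)%:R != 0 :> K -> i != j.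
Proof. by apply: contra => /eqP ->; rewrite subrr. Qed.

(** Multiplying [theta2 - (pidx i) theta1] by x_i x_j kills x_i^2 x_j and leaves x_i x_j^2 together
    with products of three distinct variables. *)
Lemma deformable_sqr i j : i != ord2 -> j != ord2 -> i != j -> deformable (X i * X j * X j).
Proof.
move=> i2 j2 ij; rewrite mulrC.
apply: (deformable_solve (deformable_theta v (pidx i)%:R (mX2 i j)) j2).
  by apply: pidx_neq; rewrite eq_sym.
move=> k k2 kj /pidx_sub ki; rewrite mulrA; apply: deformable_distinct => //.
Qed.

Lemma deformable_mon3 i j k : deformable (X i * X j * X k).
Proof.
have [->|i2] := eqVneq i ord2; first by rewrite -mulrA; apply: deformable_ord2.
have [->|j2] := eqVneq j ord2; first by rewrite [X i * _]mulrC -mulrA; apply: deformable_ord2.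
have [->|k2] := eqVneq k ord2; first by rewrite mulrC; apply: deformable_ord2.
have [<-|ij] := eqVneq i j.
  have [<-|ik] := eqVneq i k; last first.
    by apply: eq_def (deformable_sqr k2 i2 _); [ring | rewrite eq_sym].
  rewrite -mulrA; apply: (deformable_solve (deformable_theta1 v (mX2 i i)) i2 (oner_neq0 _)).
  by move=> j' j'2 j'i _; rewrite mulrA; apply: deformable_sqr.
have [<-|jk] := eqVneq j k; first exact: deformable_sqr.
have [<-|ik] := eqVneq i k; last exact: deformable_distinct.
by apply: eq_def (deformable_sqr j2 i2 _); [ring | rewrite eq_sym].
Qed.

Let mid_sub i (i2 : (2 < i)%N) : exists i' : 'I_n, i = mid i' /\ (i' = i - 3 :> nat)%N.
Proof.
have h : (i - 3 < n)%N by rewrite ltn_subLR.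
by exists (Ordinal h); split=> //; apply: val_inj; rewrite /= -{1}(subnK i2) addn3.
Qed.

Let def_mid2 i j : (2 < i)%N -> (i < j)%N -> deformable (X i * X j).
Proof.
move=> i2 ij; have [i' [ei vi]] := mid_sub i2.
have [j' [ej vj]] := mid_sub (ltn_trans i2 ij).
have lt : ((i', j').1 < (i', j').2)%N by rewrite /= vi vj ltn_sub2r // (leq_ltn_trans i2).
by have := deformable_basis v (Some (inr (exist _ (i', j') lt))); rewrite /= -ei -ej.
Qed.

Lemma deformable_pair i j : i != ord2 -> j != ord2 -> i != ord0 -> j != ord0 -> i != j ->
  deformable (X i * X j).
Proof.
move=> i2 j2 i0 j0 ij.
have m1' : (msize (1 : S) <= 2)%N by rewrite msize1.
have [i1|i1] := eqVneq i ord1.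
  rewrite i1 in ij *; rewrite -[_ * _]mulr1; apply: quad => //; apply: ord_cases => //.
  by rewrite eq_sym.
have [j1|j1] := eqVneq j ord1.
  by rewrite j1 mulrC -[_ * _]mulr1; apply: quad => //; apply: ord_cases.
have := ij; rewrite neq_ltn => /orP[lt|lt]; first exact: (def_mid2 (ord_cases _ _ _)).
by rewrite mulrC; apply: (def_mid2 (ord_cases _ _ _)).
Qed.

Let mX1' i : (msize (X i) <= 3)%N. Proof. exact: leq_trans (mX1 i) _. Qed.

(** The form [theta2 - d theta1] has no x_d-term: times x_k it reduces x_k^2 to distinct pairs. Then
    [theta1] times x_k reaches x_d x_k, and [theta1] times x_d reaches x_d^2. *)
Lemma deformable_mon2 i j : deformable (X i * X j).
Proof.
have [->|i2] := eqVneq i ord2; first exact: deformable_ord2.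
have [->|j2] := eqVneq j ord2; first by rewrite mulrC; apply: deformable_ord2.
have sq k : k != ord2 -> k != ord0 -> deformable (X k * X k).
  move=> k2 k0.
  apply: (deformable_solve (deformable_theta v _ (mX1' k)) k2 (pidx_neq k0)).
  by move=> l l2 lk /pidx_sub l0; apply: deformable_pair.
have x0 k : k != ord2 -> k != ord0 -> deformable (X ord0 * X k).
  move=> k2 k0.
  apply: (deformable_solve (deformable_theta1 v (mX1' k)) (isT : ord0 != ord2) (oner_neq0 _)).
  move=> l l2 l0 _; have [->|lk] := eqVneq l k; first exact: sq.
  exact: deformable_pair.
have [->|i0] := eqVneq i ord0; last first.
  have [->|j0] := eqVneq j ord0; first by rewrite mulrC; apply: x0.
  by have [<-|ij] := eqVneq i j; [apply: sq | apply: deformable_pair].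
have [->|j0] := eqVneq j ord0; last exact: x0.
apply: (deformable_solve (deformable_theta1 v (mX1' ord0)) (isT : ord0 != ord2) (oner_neq0 _)).
by move=> l l2 l0 _; rewrite mulrC; apply: x0.
Qed.

(** Besides x_2 and the basis variables there remain x_1 and x_d. The form [theta2 - d theta1]
    avoids x_d and yields x_1; [theta1] then yields x_d. *)
Lemma deformable_mon1 i : deformable (X i).
Proof.
have m1' : (msize (1 : S) <= 3)%N by rewrite msize1.
have xmid j : (2 < j)%N -> deformable (X j).
  by move=> /mid_sub[j' [-> _]]; apply: (deformable_basis v (Some (inl j'))).
have x1 : deformable (X ord1).
  rewrite -[X _]mulr1.
  apply: (deformable_solve (deformable_theta v _ m1') (isT : ord1 != ord2)
    (pidx_neq (isT : ord1 != ord0))).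
  by move=> l l2 l1 /pidx_sub l0; rewrite mulr1; apply/xmid/ord_cases.
have [->|i2] := eqVneq i ord2; first by rewrite -[X _]mulr1; apply: deformable_ord2.
have [->//|i1] := eqVneq i ord1.
have [->|i0] := eqVneq i ord0; last exact/xmid/ord_cases.
rewrite -[X _]mulr1.
apply: (deformable_solve (deformable_theta1 v m1') (isT : ord0 != ord2) (oner_neq0 _)).
move=> l l2 l0 _; rewrite mulr1; have [->//|l1] := eqVneq l ord1.
exact/xmid/ord_cases.
Qed.

Lemma deformable_low (m : 'X_{1..d}) : (mdeg m < 4)%N -> deformable 'X_[m].
Proof.
case e : (mdeg m) => [|[|[|[|//]]]] _.
- have -> : m = 0%MM by apply/eqP; rewrite -mdeg_eq0 e.
  by rewrite mpolyX0; apply: (deformable_basis v None).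
- have [i [m' [-> e1]]] := mnm_split e.
  have -> : m' = 0%MM by apply/eqP; rewrite -mdeg_eq0 e1.
  by rewrite addm0; apply: deformable_mon1.
- have [i [m' [-> e1]]] := mnm_split e; have [j [m'' [-> e2]]] := mnm_split e1.
  have -> : m'' = 0%MM by apply/eqP; rewrite -mdeg_eq0 e2.
  by rewrite addm0 mpolyXD; apply: deformable_mon2.
have [i [m' [-> e1]]] := mnm_split e; have [j [m'' [-> e2]]] := mnm_split e1.
have [k [m3 [-> e3]]] := mnm_split e2.
have -> : m3 = 0%MM by apply/eqP; rewrite -mdeg_eq0 e3.
by rewrite addm0 !mpolyXD mulrA; apply: deformable_mon3.
Qed.

Lemma dilate_mon s (m : 'X_{1..d}) : s != 0 ->
  exists2 a : K, a != 0 & dilate s 'X_[m] = a *: 'X_[m].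
Proof.
move=> s0; exists (\prod_i (s ^+ wt i) ^+ m i).
  by apply/prodf_neq0 => i _; rewrite !expf_neq0.
rewrite mpolyXE_id rmorph_prod -scaler_prod; apply: eq_bigr => i _.
by rewrite rmorphXn /= dilateX exprZn.
Qed.

Theorem spanned_generic :
  exists2 c : 'I_d -> K, forall i, c i != 0 & forall f, spanned v c f.
Proof.
have /fin_all_exists[E hE] (m : 'X_{1..d < 4}) := deformable_low (bmdeg m).
have [|s s0 span] := @generic_span K d 4 E (fun m => let: And3 h _ _ := hE m in h).
  by move=> m i; have [_ h _] := hE m; apply: h.
exists (fun i => s^-1 ^+ wt i) => [i|]; first by rewrite expf_neq0 // invr_eq0.
apply: spanned_all => f fs; rewrite (mpolyE f); rewrite big_seq; elim/big_ind: _ => [||m mf].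
- exact: spanned0.
- exact: spannedD.
apply: spannedZ.
have [y hy] := span 'X_[m] ltac:(by rewrite msizeX; apply: leq_trans (msize_mdeg_lt mf) fs).
have : dspanned v s 'X_[m].
  rewrite hy; apply: dspanned_sum => m'; apply: dspannedZ.
  by have [_ _ h] := hE m'; apply: h.
(* A dilation only rescales a monomial, so it can now be undone. *)
have [a a0 e] := @dilate_mon s^-1 m (ltac:(by rewrite invr_eq0)).
rewrite /dspanned e => /(spannedZ a^-1).
by rewrite scalerA mulVf // scale1r.
Qed.

End SpanningTheorem.

(** * Substitution of linear forms for variables *)

Section GradedSubstitution.
Variables (K : fieldType) (r n : nat) (th : 'I_r -> {mpoly K[n]}).
Hypothesis th_hom : forall i, th i \is 1.-homog.

Definition subst_forms : {mpoly K[r]} -> {mpoly K[n]} := comp_mpoly [tuple th i | i < r].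
HB.instance Definition _ := GRing.RMorphism.on subst_forms.

Lemma subst_formsX i : subst_forms 'X_i = th i.
Proof. by rewrite /subst_forms comp_mpolyXU -tnth_nth tnth_mktuple. Qed.

Lemma subst_formsZ a p : subst_forms (a *: p) = a *: subst_forms p.
Proof. exact: comp_mpolyZ. Qed.

Lemma subst_formsC a : subst_forms a%:MP = a%:MP.
Proof. exact: comp_mpolyC. Qed.

Lemma subst_forms_sum (J : Type) (s : seq J) (P : pred J) F :
  subst_forms (\sum_(j <- s | P j) F j) = \sum_(j <- s | P j) subst_forms (F j).
Proof. exact: rmorph_sum. Qed.

Lemma subst_forms_homog m : subst_forms 'X_[m] \is (mdeg m).-homog.
Proof.
rewrite mpolyXE_id rmorph_prod mdegE.
elim/big_rec2: _ => [|i k p _ hp]; first exact: dhomog1.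
apply: dhomogM => //; rewrite rmorphXn /= subst_formsX -[X in X.-homog]mul1n.
exact: dhomogMn.
Qed.

Lemma pihomog_subst k p :
  pihomog mdeg k (subst_forms p) = subst_forms (pihomog mdeg k p).
Proof.
rewrite [in LHS](mpolyE p) [in RHS](mpolyE p) subst_forms_sum !pihomog_sum subst_forms_sum.
apply: eq_bigr => m _.
rewrite subst_formsZ !pihomogZ subst_formsZ pihomogX; congr (_ *: _).
have hm := subst_forms_homog m; case: eqP => [<-|/eqP ne]; first exact: pihomog_dE.
by rewrite raddf0 (pihomog_ne0 ne hm).
Qed.

End GradedSubstitution.

Lemma mcoeff_pihomog (K : fieldType) n (p : {mpoly K[n]}) k m :
  (pihomog mdeg k p)@_m = if mdeg m == k then p@_m else 0.
Proof.
have pE : p@_m = \sum_(m' <- msupp p) p@_m' * (m' == m)%:R.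
  by rewrite {1}(mpolyE p) raddf_sum /=; apply: eq_bigr => m' _; rewrite mcoeffZ mcoeffX.
rewrite pihomogE raddf_sum /= big_mkcond pE.
have [e|ne] := eqVneq (mdeg m) k.
  apply: eq_bigr => m' _; rewrite mcoeffZ mcoeffX; case: eqP => // ne.
  by case: eqP => [e'|_]; rewrite ?mulr0 //; case: ne; rewrite e'.
apply: big1 => m' _; rewrite mcoeffZ mcoeffX; case: eqP => // e.
case: eqP => [e'|_]; last by rewrite mulr0.
by rewrite -e' e eqxx in ne.
Qed.

Lemma pihomog_bmnm (K : fieldType) n b (p : {mpoly K[n]}) k : (k < b)%N ->
  pihomog mdeg k p = \sum_(m : 'X_{1..n < b} | mdeg m == k) p@_m *: 'X_[m].
Proof.
move=> kb; apply/mpolyP => m; rewrite mcoeff_pihomog raddf_sum /=.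
case: eqP => [e|ne]; last first.
  rewrite big1 // => m' /eqP e; rewrite mcoeffZ mcoeffX.
  by case: eqP => [e'|_]; rewrite ?mulr0 //; case: ne; rewrite -e'.
have mb : (mdeg m < b)%N by rewrite e.
rewrite (bigD1 (BMultinom mb)) /=; last exact/eqP.
rewrite mcoeffZ mcoeffX eqxx mulr1 big1 ?addr0 // => m' /andP[_ ne].
rewrite mcoeffZ mcoeffX; case: eqP => [e'|_]; last by rewrite mulr0.
by case/eqP: ne; apply: val_inj.
Qed.

(** * Freeness over the three linear forms *)

Section StandardBasis.
Variable n : nat.
Local Notation d := n.+3.
Local Notation B := (basis_idx n).
Local Notation ord1 := (ord1 n).
Local Notation ord2 := (ord2 n).
Implicit Types b : B.

(* The facets of the simplicial complex of normal monomials, each with its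
   distinguished face, whose monomial is [basis_mon b]. *)
Definition facet b : 'I_d * 'I_d :=
  match b with
  | None => (ord1, ord0)
  | Some (inl j) => (mid j, ord0)
  | Some (inr p) => (mid (val p).1, mid (val p).2)
  end.
Definition face_mnm b : 'X_{1..d} :=
  match b with
  | None => 0%MM
  | Some (inl j) => U_(mid j)%MM
  | Some (inr p) => (U_(mid (val p).1) + U_(mid (val p).2))%MM
  end.
(** The monomials supported on the facet and divisible by its distinguished face, as in the Stanley
    decomposition of a shellable complex. Vertex 2 is a cone point, common to all facets, and the
    exponents [m] match those of the three linear forms in [beta_elt]. *)
Definition facet_mnm b (m : 'X_{1..3}) : 'X_{1..d} :=
  (U_((facet b).1) *+ m ord0 + U_(ord2) *+ m (inord 1) + U_((facet b).2) *+ m (inord 2)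
    + face_mnm b)%MM.

Lemma mdeg3 (m : 'X_{1..3}) : mdeg m = (m ord0 + m (inord 1) + m (inord 2))%N.
Proof.
rewrite mdegE !big_ord_recr big_ord0 /=; congr (m _ + m _ + m _)%N;
  by apply: val_inj; rewrite /= ?inordK.
Qed.

Lemma mdeg_face b : mdeg (face_mnm b) = basis_deg b.
Proof. by case: b => [[j|p]|] /=; rewrite ?mdegD ?mdeg1 ?mdeg0. Qed.

Lemma mdeg_facet_mnm b m : mdeg (facet_mnm b m) = (mdeg m + basis_deg b)%N.
Proof. by rewrite /facet_mnm !mdegD !mdegMn !mdeg1 !mul1n mdeg_face mdeg3. Qed.

Lemma facet_mnmE b m x : facet_mnm b m x =
  (((facet b).1 == x) * m ord0 + (ord2 == x) * m (inord 1) + ((facet b).2 == x) * m (inord 2)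
    + face_mnm b x)%N.
Proof. by rewrite /facet_mnm !mnmDE !mulmnE !mnm1E. Qed.

Lemma face_mnm_supp b x : face_mnm b x != 0%N -> x = (facet b).1 \/ x = (facet b).2.
Proof.
case: b => [[j|p]|] /=; rewrite ?mnmDE ?mnm1E ?mnm0E //.
  by have [<-|] := eqVneq (mid j) x; [left | rewrite eqxx].
have [<-|_] := eqVneq (mid (val p).1) x; first by left.
by have [<-|] := eqVneq (mid (val p).2) x; [right | rewrite eqxx].
Qed.

Lemma facet_mnm_supp b m x : facet_mnm b m x != 0%N ->
  [\/ x = (facet b).1, x = ord2 | x = (facet b).2].
Proof.
rewrite facet_mnmE; have [<-|_] := eqVneq (facet b).1 x; first by constructor 1.
have [<-|_] := eqVneq ord2 x; first by constructor 2.
have [<-|_] := eqVneq (facet b).2 x; first by constructor 3.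
by rewrite !mul0n !add0n => /face_mnm_supp[]; [constructor 1 | constructor 3].
Qed.

Lemma mid_inj : injective (@mid n).
Proof. by move=> i j /(congr1 val) /= [] /val_inj. Qed.

Lemma normal_facet_mnm b m : normal_mnm (facet_mnm b m).
Proof.
split=> [j /andP[j2 jd]|i j k /andP[i2 ij] /andP[jk kd]].
  have -> : vidx n 1 = ord1 by apply: val_inj; rewrite /= val_vidx.
  rewrite lt0n => h1; apply/eqP/negPn/negP => hj.
  have vj : vidx n j = j :> nat by rewrite val_vidx modn_small.
  have bN : b = None.
    by case/facet_mnm_supp: h1; case: b {hj} => [[?|?]|] //= /(congr1 val).
  case/facet_mnm_supp: hj; rewrite ?bN /= => /(congr1 val) /=; rewrite vj => e;
    by rewrite e in j2.
rewrite !lt0n => hj hk; apply/eqP/negPn/negP => hi.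
have ne (x y : nat) : (2 < x < y)%N -> (y <= d)%N -> vidx n x != vidx n y.
  by move=> /andP[x2 xy] yd; apply: vidx_neq; rewrite // xy (leq_trans _ x2).
have n2 (x : nat) : (2 < x <= d)%N -> vidx n x != ord2.
  move=> /andP[x2]; rewrite leq_eqVlt => /orP[/eqP ->|xd].
    by rewrite -val_eqE /= val_vidx modnn.
  by rewrite -val_eqE /= val_vidx modn_small // gtn_eqF.
have a x : (2 < x <= d)%N -> facet_mnm b m (vidx n x) != 0%N ->
    vidx n x = (facet b).1 \/ vidx n x = (facet b).2.
  by move=> /n2 x2 /facet_mnm_supp[e|e|e]; [left | rewrite e eqxx in x2 | right].
have jd := ltnW (leq_trans jk kd).
have eij := ne i j; have ejk := ne j k; have eik := ne i k.
rewrite i2 ij jd in eij; rewrite (ltn_trans i2 ij) jk kd in ejk.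
rewrite i2 (ltn_trans ij jk) kd in eik.
move: (eij isT isT) (ejk isT isT) (eik isT isT).
have Hi : (2 < i <= d)%N by rewrite i2 (leq_trans (ltnW ij) jd).
have Hj : (2 < j <= d)%N by rewrite (ltn_trans i2 ij) jd.
have Hk : (2 < k <= d)%N by rewrite (ltn_trans (ltn_trans i2 ij) jk) kd.
by have [->|->] := a i Hi hi; have [->|->] := a j Hj hj; have [->|->] := a k Hk hk;
  rewrite ?eqxx.
Qed.

(** The vertices 3, ..., d - 1 in the support recover [b], which is the key to injectivity. *)
Lemma facet_mnm_mid b m j : (facet_mnm b m (mid j) != 0%N) =
  match b with None => false | Some (inl i) => i == j
    | Some (inr p) => ((val p).1 == j) || ((val p).2 == j) end.
Proof.
have om i : (ord0 == mid i :> 'I_d) = false by [].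
have o1 i : (ord1 == mid i :> 'I_d) = false by [].
have o2 i : (ord2 == mid i :> 'I_d) = false by [].
have mm i i' : (mid i == mid i' :> 'I_d) = (i == i') by apply: (inj_eq mid_inj).
rewrite facet_mnmE; case: b => [[i|p]|] /=;
  rewrite ?(mnmDE, mnm1E, mnm0E) ?om ?o1 ?o2 ?mm ?mul0n //.
  by case: (i == j); rewrite ?mul0n // addn1.
by case: ((val p).1 == j); case: ((val p).2 == j); rewrite ?mul0n ?addn0 ?add0n ?addn1 // addnC.
Qed.

Lemma facet_mnm_inj b b' m m' : facet_mnm b m = facet_mnm b' m' -> b = b' /\ m = m'.
Proof.
move=> e; have bb : b = b'.
  have h j : _ = _ := etrans (esym (facet_mnm_mid b m j))
    (etrans (congr1 (fun x : 'X_{1..d} => x (mid j) != 0%N) e) (facet_mnm_mid b' m' j)).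
  move: h {e}; case: b => [[i|[[i1 i2] /= ip]]|]; case: b' => [[j|[[j1 j2] /= jp]]|] //= h.
  - by have := h i; rewrite eqxx => /esym/eqP ->.
  - have := h j1; have := h j2; rewrite !eqxx orbT => /eqP e1 /eqP e2.
    by exfalso; move: (jp); rewrite -e1 -e2 ltnn.
  - by have := h i; rewrite eqxx.
  - have := h i1; have := h i2; rewrite !eqxx orbT => /esym/eqP e1 /esym/eqP e2.
    by exfalso; move: (ip); rewrite -e1 -e2 ltnn.
  - have h1 := h i1; have h2 := h i2; have h3 := h j1; have h4 := h j2.
    rewrite !eqxx ?orbT /= in h1 h2 h3 h4.
    have [e1 e2] : i1 = j1 /\ i2 = j2.
      move: h1 h2 h3 h4 => /esym/orP[]/eqP/(congr1 val)/= a1 /esym/orP[]/eqP/(congr1 val)/= a2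
        /orP[]/eqP/(congr1 val)/= a3 /orP[]/eqP/(congr1 val)/= a4;
      by split; apply: val_inj => /=; move: (ip) (jp) a1 a2 a3 a4; clear; lia.
    by subst; congr (Some (inr _)); apply: val_inj.
  - by have := h i1; rewrite eqxx.
  - by have := h j; rewrite eqxx.
  by have := h j1; rewrite eqxx.
subst b'; split=> //.
have val x : facet_mnm b m x = facet_mnm b m' x by rewrite e.
have f2 : (facet b).1 != ord2 /\ (facet b).2 != ord2 by case: b {e val} => [[?|?]|].
have f12 : (facet b).1 != (facet b).2.
  case: b {e val f2} => [[?|[[i j] /= ij]]|] //=.
  by rewrite (inj_eq mid_inj) -val_eqE /= neq_ltn ij.
have face2 : face_mnm b ord2 = 0%N.
  by apply/eqP/negPn/negP => /face_mnm_supp[] e2; move: f2; rewrite e2 eqxx => -[].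
have v0 := val (facet b).1; have v1 := val ord2; have v2 := val (facet b).2.
rewrite !facet_mnmE !eqxx in v0 v1 v2.
have [/negbTE n1 /negbTE n2] := f2; have n3 := negbTE f12.
rewrite ![ord2 == _]eq_sym ![(facet b).2 == (facet b).1]eq_sym n1 n2 n3 face2 in v0 v1 v2.
apply/mnmP => x; have -> : x = inord x by rewrite inord_val.
have ord0E : inord 0 = ord0 :> 'I_3 by apply: val_inj; rewrite /= inordK.
have := ltn_ord x; case: (x : nat) => [|[|[|//]]] _; rewrite ?ord0E.
- by move: v0; clear; lia.
- by move: v1; clear; lia.
by move: v2; clear; lia.
Qed.

Definition graded_idx k : {set B * 'X_{1..3 < k.+1}} :=
  [set x : B * 'X_{1..3 < k.+1} | (mdeg x.2 + basis_deg x.1 == k)%N].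

Lemma card_ltn_pairs m : #|{: {p : 'I_m * 'I_m | (p.1 < p.2)%N}}| = 'C(m, 2).
Proof.
rewrite card_sig -bin2_sum big_mkord.
transitivity (\sum_(j < m) \sum_(i < m | (i < j)%N) 1)%N.
  rewrite -sum1_card pair_big_dep /=.
  rewrite (reindex (fun p : 'I_m * 'I_m => (p.2, p.1))) /=; last first.
    by exists (fun p => (p.2, p.1)) => -[].
  by apply: eq_bigl => -[i j].
apply: eq_bigr => j _.
by rewrite (big_ord_narrow (ltnW (ltn_ord j))) sum1_card card_ord.
Qed.

(** There are 1, n and C(n,2) basis monomials of degree e = 0, 1, 2, each with C(k + 2 - e, 2)
    monomials of degree k - e in three variables. *)
Lemma card_graded_idx k :
  #|graded_idx k| = ('C(k.+2, 2) + n * 'C(k.+1, 2) + 'C(n, 2) * 'C(k, 2))%N.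
Proof.
have cnt b : \sum_(m : 'X_{1..3 < k.+1} | (mdeg m + basis_deg b == k)%N) 1 =
    'C(k.+2 - basis_deg b, 2).
  rewrite sum1_card; have [le|lt] := leqP (basis_deg b) k; last first.
    rewrite bin_small; last by move: lt; clear; lia.
    by apply: eq_card0 => m; rewrite unfold_in; apply/eqP => e;
       move: e lt; move: (mdeg m) (basis_deg b); clear; lia.
  have -> : (k.+2 - basis_deg b = k - basis_deg b + 2)%N by rewrite -addn2 addnBAC.
  rewrite -[RHS]bin_sub ?leq_addl // addnK.
  rewrite -(@card_monomials 3 k.+1 (k - basis_deg b)) ?ltnS ?leq_subr //.
  apply: eq_card => m; rewrite inE unfold_in /=.
  by move: (mdeg m) (basis_deg b) le; clear => x y le; apply/eqP/eqP; lia.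
have -> : #|graded_idx k| = (\sum_(b : B) 'C(k.+2 - basis_deg b, 2))%N.
  rewrite -sum1_card (eq_bigr _ (fun b _ => esym (cnt b))) pair_big_dep /=.
  by apply: eq_bigl => x; rewrite inE.
rewrite (bigD1 None) //= subn0 (reindex_omap Some id) => [|[]] //=.
under eq_bigl => x do rewrite eqxx.
rewrite big_sumType /= !sum_nat_const.
by rewrite card_ord card_ltn_pairs subn1 subn2 /= addnA.
Qed.

End StandardBasis.

Section CoordinateRing.
Variables (K : realFieldType) (n : nat) (v : nat -> K * K).
Local Notation d := n.+3.
Local Notation S := {mpoly K[d]}.
Local Notation bv := (bv d v).
Local Notation nvec := (nvec d v).
Local Notation alpha := (alpha d v).
Local Notation I := (in_ideal (gensI d v)).
Hypothesis alpha_neq0 : forall j, alpha j != 0.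
Hypothesis nvec_indep : forall i j k : 'I_d, i != j -> j != k -> i != k ->
  det3 (nvec i) (nvec j) (nvec k) != 0.
Variable c : 'I_d -> K.
Hypothesis c_span : forall f, spanned v c f.
Local Notation B := (basis_idx n).
Local Notation bm := (@basis_mon K n).
Local Notation T := {mpoly K[3]}.
Local Notation ord2 := (ord2 n).

Definition vhomog k (a : v3 S) :=
  [/\ c1 a \is k.-homog, c2 a \is k.-homog & c3 a \is k.-homog].

Lemma const_homog (x : K) : (x%:MP : S) \is 0.-homog.
Proof. by rewrite -alg_mpolyC rpredZ // dhomog1. Qed.

Lemma vhomog_scale k f (a : v3 K) : f \is k.-homog -> vhomog k (scale3 f (Cv d a)).
Proof. by move=> hf; split; rewrite -[k]addn0; apply: dhomogM (const_homog _). Qed.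

Lemma xv_homog i : xv K d i \is 1.-homog.
Proof. by rewrite xvE dhomogX; apply/eqP/mdeg1. Qed.

Lemma Lambda_homog k : vhomog 1 (Lambda d v k).
Proof.
have h j (x : K) : xv K d j * x%:MP \is 1.-homog.
  by rewrite -[1%N]addn0; apply: dhomogM (xv_homog j) (const_homog x).
have [a1 a2 a3] := vhomog_scale (nvec k.+1) (h k.+1 (alpha k.+1)^-1).
have [b1 b2 b3] := vhomog_scale (nvec (k + d).-1) (h k (alpha k)^-1).
by split; [exact: (rpredB a1 b1) | exact: (rpredB a2 b2) | exact: (rpredB a3 b3)].
Qed.

Lemma tau_homog : vhomog 1 (tau d v).
Proof.
have h (i : 'I_d) : vhomog 1 (scale3 (xv K d i) (Cv d (bv i))).
  exact/vhomog_scale/xv_homog.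
rewrite /tau big_add3.
by split; apply: rpred_sum => i _; have [h1 h2 h3] := h i; [exact: h1 | exact: h2 | exact: h3].
Qed.

Lemma dot3_vhomog k l a b : vhomog k a -> vhomog l b -> dot3 a b \is (k + l).-homog.
Proof.
move=> [a1 a2 a3] [b1 b2 b3].
exact: (rpredD (rpredD (dhomogM a1 b1) (dhomogM a2 b2)) (dhomogM a3 b3)).
Qed.

Lemma cross3_vhomog k l a b : vhomog k a -> vhomog l b -> vhomog (k + l) (cross3 a b).
Proof.
move=> [a1 a2 a3] [b1 b2 b3].
by split; [exact: (rpredB (dhomogM a2 b3) (dhomogM a3 b2))
  | exact: (rpredB (dhomogM a3 b1) (dhomogM a1 b3))
  | exact: (rpredB (dhomogM a1 b2) (dhomogM a2 b1))].
Qed.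

Lemma quadric_homog k : dot3 (Lambda d v k) (tau d v) \is 2.-homog.
Proof. exact: (dot3_vhomog (Lambda_homog k) tau_homog). Qed.

Lemma cubic_homog i j k : det3 (Lambda d v i) (Lambda d v j) (Lambda d v k) \is 3.-homog.
Proof.
exact: (dot3_vhomog (Lambda_homog i) (cross3_vhomog (Lambda_homog j) (Lambda_homog k))).
Qed.

Lemma I_pihomog q f : I f -> I (pihomog mdeg q f).
Proof.
apply: in_ideal_pihomog => g; rewrite mem_cat => /orP[/mapP[k _ ->]|/mapP[[[i j] k] _ ->]].
  by exists 2; apply: quadric_homog.
by exists 3; apply: cubic_homog.
Qed.

Definition theta (j : 'I_3) : S := tnth [tuple 'X_ord2; theta1 c; theta2 c] j.

Lemma theta_homog j : theta j \is 1.-homog.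
Proof.
have X1 i : ('X_i : S) \is 1.-homog by rewrite dhomogX; apply/eqP/mdeg1.
rewrite /theta (tnth_nth 0); have := ltn_ord j; case: (j : nat) => [|[|[|//]]] _ /=.
- exact: X1.
- by apply: rpred_sum => i _; apply: rpredZ.
by apply: rpred_sum => i _; apply: rpredZ.
Qed.

Local Notation sub := (subst_forms theta).

(** The map to S from the free module on the basis monomials over a polynomial ring in three
    variables, acting through [theta]. By [Psi_surj] and [Psi_inj] it is bijective modulo I. *)
Definition Psi (t : B -> T) : S := \sum_b sub (t b) * bm b.

Definition beta_elt (x : B * 'X_{1..3}) : S := sub 'X_[x.2] * bm x.1.

Lemma beta_homog x : beta_elt x \is (mdeg x.2 + basis_deg x.1).-homog.
Proof. apply: dhomogM (basis_mon_homog _ _); exact: (subst_forms_homog theta_homog). Qed.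

Lemma pihomog_Psi k t :
  pihomog mdeg k (Psi t) =
  \sum_(x in graded_idx n k) (t x.1)@_(x.2 : 'X_{1..3}) *: beta_elt (x.1, x.2 : 'X_{1..3}).
Proof.
transitivity (\sum_b \sum_(m : 'X_{1..3 < k.+1} | (mdeg m + basis_deg b == k)%N)
   (t b)@_m *: beta_elt (b, m : 'X_{1..3})); last first.
  by rewrite pair_big_dep /=; apply: eq_bigl => x; rewrite inE.
rewrite /Psi pihomog_sum; apply: eq_bigr => b _; rewrite mulrC.
have [le|lt] := leqP (basis_deg b) k; last first.
  rewrite (pihomogMl_lt _ (basis_mon_homog K b) lt) big1 // => m /eqP e.
  by move: e lt; move: (basis_deg b) (mdeg m); clear; lia.
rewrite -{1}(subnKC le) (pihomogMl _ _ (basis_mon_homog K b)) (pihomog_subst theta_homog).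
rewrite (@pihomog_bmnm _ _ k.+1) ?ltnS ?leq_subr // subst_forms_sum mulr_sumr.
apply: eq_big => [m|m _].
  by move: le; move: (basis_deg b) (mdeg m); clear => x y le; apply/eqP/eqP; lia.
by rewrite subst_formsZ -scalerAr /beta_elt /= [X in _ *: X]mulrC.
Qed.

Lemma Psi_theta j t : theta j * Psi t = Psi (fun b => 'X_j * t b).
Proof.
rewrite /Psi mulr_sumr; apply: eq_bigr => b _.
by rewrite rmorphM /= subst_formsX mulrA.
Qed.

Lemma PsiD t t' : Psi t + Psi t' = Psi (fun b => t b + t' b).
Proof. by rewrite /Psi -big_split; apply: eq_bigr => b _; rewrite rmorphD mulrDl. Qed.

Lemma PsiN t : - Psi t = Psi (fun b => - t b).
Proof. by rewrite /Psi -sumrN; apply: eq_bigr => b _; rewrite rmorphN mulNr. Qed.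

Lemma Psi_sum (J : Type) (r : seq J) (P : pred J) (t : J -> B -> T) :
  \sum_(j <- r | P j) Psi (t j) = Psi (fun b => \sum_(j <- r | P j) t j b).
Proof.
rewrite /Psi exchange_big; apply: eq_bigr => b _.
by rewrite subst_forms_sum mulr_suml.
Qed.

Lemma sum_theta (h : 'I_3 -> S) : \sum_j theta j * h j =
  'X_ord2 * h ord0 + theta1 c * h (inord 1) + theta2 c * h (inord 2).
Proof.
rewrite !big_ord_recl big_ord0 addr0 addrA /theta !(tnth_nth 0) /=.
by congr (_ * h _ + _ * h _ + _ * h _); apply: val_inj; rewrite /= ?inordK.
Qed.

Lemma span_theta f : exists (h : 'I_3 -> S) (y : B -> K),
  I (f - \sum_j theta j * h j - \sum_b y b *: bm b).
Proof.
have [y [h0 [h1 [h2 If]]]] := c_span f.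
exists (fun j => tnth [tuple h0; h1; h2] j), y; rewrite sum_theta.
by move: If; rewrite !(tnth_nth 0) /= !inordK //=; congr I; rewrite addrAC.
Qed.

(** Graded Nakayama: taking the component of degree k of a relation from [span_theta] lowers the
    degree of the cofactors of the [theta j], to which induction applies. *)
Lemma Psi_surj_homog k f : f \is k.-homog -> exists t, I (f - Psi t).
Proof.
elim: k f => [|k IH] f hf.
  have [h [y /(I_pihomog 0)]] := span_theta f; rewrite !pihomogB pihomog_dE // !pihomog_sum.
  rewrite [X in _ - X - _]big1 ?subr0 => [Iy|j _]; last exact: pihomogMl_lt (theta_homog j) _.
  exists (fun b => if basis_deg b == 0%N then (y b)%:MP else 0).
  move: Iy; congr I; congr (_ - _); apply: eq_bigr => b _; rewrite pihomogZ.
  have hb := basis_mon_homog K b; case: eqP => [e|/eqP ne].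
    by rewrite e in hb; rewrite pihomog_dE // subst_formsC mul_mpolyC.
  by rewrite (pihomog_ne0 ne hb) scaler0 rmorph0 mul0r.
have [h [y /(I_pihomog k.+1)]] := span_theta f; rewrite !pihomogB pihomog_dE // !pihomog_sum.
have -> : \sum_j pihomog mdeg k.+1 (theta j * h j) = \sum_j theta j * pihomog mdeg k (h j).
  by apply: eq_bigr => j _; apply: (pihomogMl k (h j) (theta_homog j)).
move=> Iy; have /fin_all_exists[t ht] j := IH (pihomog mdeg k (h j)) (pihomogP _ _ _).
exists (fun b => \sum_j 'X_j * t j b + if basis_deg b == k.+1 then (y b)%:MP else 0).
have It : I (\sum_j theta j * (pihomog mdeg k (h j) - Psi (t j))).
  by apply: in_ideal_sum => j; apply: in_idealM.
have := in_idealD Iy It; congr I.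
under [X in _ + X]eq_bigr => j _ do rewrite mulrBr Psi_theta.
rewrite sumrB Psi_sum -PsiD.
have -> : \sum_b pihomog mdeg k.+1 (y b *: bm b) =
    Psi (fun b => if basis_deg b == k.+1 then (y b)%:MP else 0).
  apply: eq_bigr => b _; rewrite pihomogZ.
  have hb := basis_mon_homog K b; case: eqP => [e|/eqP ne].
    by rewrite e in hb; rewrite pihomog_dE // subst_formsC mul_mpolyC.
  by rewrite (pihomog_ne0 ne hb) scaler0 rmorph0 mul0r.
by ring.
Qed.

Lemma Psi_surj f : exists t, I (f - Psi t).
Proof.
have /fin_all_exists[t ht] (k : 'I_(msize f)) := Psi_surj_homog (pihomogP mdeg k f).
exists (fun b => \sum_k t k b); rewrite -Psi_sum.
rewrite {1}(@pihomog_partitionE _ _ mdeg (msize f) f) // -sumrB.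
exact: in_ideal_sum.
Qed.

Local Notation A k := (graded_idx n k).

Lemma beta_span k f : f \is k.-homog -> exists y : B * 'X_{1..3 < k.+1} -> K,
  I (f - \sum_(x in A k) y x *: beta_elt (x.1, x.2 : 'X_{1..3})).
Proof.
move=> hf; have [t /(I_pihomog k)] := Psi_surj f.
rewrite pihomogB pihomog_dE // pihomog_Psi => It.
by exists (fun x : B * 'X_{1..3 < k.+1} => (t x.1)@_(x.2 : 'X_{1..3})).
Qed.

Lemma I_wpoint f p : (forall j, dot3 (nvec j) p != 0) -> I f ->
  f.@[fun i : 'I_d => wpoint n v p i] = 0.
Proof.
move=> L0; apply: (in_ideal_morph (f := meval (fun i : 'I_d => wpoint n v p i))) => g gg.
exact: wpoint_gens.
Qed.

(** Elements of I vanish at all Wachspress points, so [normal_independent] makes the combination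
    zero in S itself, and distinct indices give distinct monomials. *)
Lemma nu_free k (y : B * 'X_{1..3 < k.+1} -> K) :
  I (\sum_(x in A k) y x *: 'X_[facet_mnm x.1 (x.2 : 'X_{1..3})]) ->
  forall x, x \in A k -> y x = 0.
Proof.
set f := \sum_(x in _) _ => If x xA.
have nu_inj (z w : B * 'X_{1..3 < k.+1}) :
    facet_mnm z.1 (z.2 : 'X_{1..3}) = facet_mnm w.1 (w.2 : 'X_{1..3}) -> z = w.
  by move: z w => [b m] [b' m'] /= /facet_mnm_inj[-> e]; congr (_, _); apply: val_inj.
have f0 : f = 0.
  apply: (normal_independent alpha_neq0 nvec_indep (k := k)).
  - apply: rpred_sum => z; rewrite inE => zk; apply: rpredZ.
    by rewrite dhomogX /= mdeg_facet_mnm.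
  - move=> m mf; have : m \in flatten
        [seq msupp (y z *: 'X_[facet_mnm z.1 (z.2 : 'X_{1..3})]) | z <- enum (A k)].
      move: mf; rewrite /f -big_enum => /msupp_sum_le.
      by rewrite filter_predT.
    move/flattenP => [s /mapP[z _ ->]] /msuppZ_le; rewrite msuppX inE => /eqP ->.
    exact: normal_facet_mnm.
  by move=> p L0; apply: I_wpoint.
have := congr1 (mcoeff (facet_mnm x.1 (x.2 : 'X_{1..3}))) f0.
rewrite mcoeff0 raddf_sum (bigD1 x) //= big1 => [|z /andP[_ zx]].
  by rewrite mcoeffZ mcoeffX eqxx mulr1 addr0.
rewrite mcoeffZ mcoeffX; case: eqP => [/nu_inj e|_]; last by rewrite mulr0.
by rewrite e eqxx in zx.
Qed.

(** The [nu i] are independent modulo I and are combinations of the [be j]. Both families have the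
    index set [graded_idx n k], so the transition matrix is square with trivial kernel, hence
    invertible, and independence passes to the [be j]. *)
Lemma beta_free k (y : B * 'X_{1..3 < k.+1} -> K) :
  I (\sum_(x in A k) y x *: beta_elt (x.1, x.2 : 'X_{1..3})) ->
  forall x, x \in A k -> y x = 0.
Proof.
pose N := #|A k|.
pose e (i : 'I_N) : B * 'X_{1..3 < k.+1} := enum_val i.
pose nu i : S := 'X_[facet_mnm (e i).1 ((e i).2 : 'X_{1..3})].
pose be i : S := beta_elt ((e i).1, (e i).2 : 'X_{1..3}).
have /fin_all_exists[C hC] (i : 'I_N) : exists C : 'I_N -> K, I (nu i - \sum_j C j *: be j).
  have [|y' hy] := @beta_span k (nu i).
    by rewrite dhomogX /= mdeg_facet_mnm; have := enum_valP i; rewrite inE.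
  by exists (fun j => y' (e j)); move: hy; rewrite big_enum_val.
pose M : 'M[K]_N := \matrix_(i, j) C i j.
have comb (z : 'rV[K]_N) : I (\sum_i z 0 i *: nu i - \sum_j (z *m M) 0 j *: be j).
  have : I (\sum_i z 0 i *: (nu i - \sum_j C i j *: be j)).
    by apply: in_ideal_sum => i; apply: in_idealZ.
  congr I; under eq_bigr => i _ do rewrite scalerBr scaler_sumr.
  rewrite sumrB; congr (_ - _); rewrite exchange_big; apply: eq_bigr => j _.
  by rewrite mxE scaler_suml; apply: eq_bigr => i _; rewrite mxE scalerA.
have freeM (z : 'rV[K]_N) : I (\sum_j (z *m M) 0 j *: be j) -> z = 0.
  move=> /(in_idealD (comb z)); rewrite subrK => Iz; apply/rowP => i; rewrite mxE.
  have J : I (\sum_(x in A k) z 0 (enum_rank_in (enum_valP i) x) *: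
      'X_[facet_mnm x.1 (x.2 : 'X_{1..3})]).
    rewrite big_enum_val; move: Iz; congr I; apply: eq_bigr => j _.
    by rewrite enum_valK_in.
  by have := nu_free J (enum_valP i); rewrite enum_valK_in.
have uM : M \in unitmx.
  rewrite -row_free_unit -kermx_eq0 -submx0; apply/rV_subP => z /sub_kermxP zM.
  rewrite (freeM z) ?sub0mx // big1 => [|j _]; first exact: in_ideal0.
  by rewrite zM mxE scale0r.
move=> Iy x xA; pose yr : 'rV[K]_N := \row_i y (e i).
have y0 : yr *m invmx M = 0.
  apply: freeM; rewrite mulmxKV //; move: Iy; rewrite big_enum_val; congr I.
  by apply: eq_bigr => i _; rewrite mxE.
have : yr = 0 by rewrite -(mulmxKV uM yr) y0 mul0mx.
move/rowP/(_ (enum_rank_in xA x)); rewrite !mxE.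
by rewrite /e enum_rankK_in.
Qed.

Lemma Psi_inj t : I (Psi t) -> forall b, t b = 0.
Proof.
move=> It b; apply/mpolyP => m; rewrite mcoeff0.
pose k := (mdeg m + basis_deg b)%N.
have mk : (mdeg m < k.+1)%N by rewrite ltnS leq_addr.
have := I_pihomog k It; rewrite pihomog_Psi => /beta_free/(_ (b, BMultinom mk)).
by apply; rewrite inE.
Qed.

(** Through [Psi] the quotient S / I is free over the polynomial ring in three variables, and
    [var_regular] applies in each coordinate [b]. *)
Lemma theta_regular (k : 'I_3) f (g : 'I_3 -> S) :
  I (theta k * f - \sum_(j : 'I_3 | (j < k)%N) theta j * g j) ->
  exists g' : 'I_3 -> S, I (f - \sum_(j : 'I_3 | (j < k)%N) theta j * g' j).
Proof.
move=> Ifg; have [t It] := Psi_surj f.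
have /fin_all_exists[s Is] j := Psi_surj (g j).
have J1 : I (theta k * (f - Psi t) - \sum_(j : 'I_3 | (j < k)%N) theta j * (g j - Psi (s j))).
  apply: in_idealB (in_idealM (theta k) It) (in_ideal_sum _ _ _) => j.
  exact: (in_idealM (theta j) (Is j)).
have J2 : I (Psi (fun b => 'X_k * t b - \sum_(j : 'I_3 | (j < k)%N) 'X_j * s j b)).
  have := in_idealB Ifg J1; congr I.
  rewrite -PsiD -PsiN -Psi_theta -Psi_sum.
  under [X in _ - (_ - X)]eq_bigr => j _ do rewrite mulrBr Psi_theta.
  by rewrite sumrB; ring.
have /fin_all_exists[h hh] b : exists h : 'I_3 -> T,
    t b = \sum_(j : 'I_3 | (j < k)%N) 'X_j * h j.
  apply: (@var_regular _ _ (fun j : 'I_3 => (j < k)%N) k _ (fun j => s j b)).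
    by rewrite ltnn.
  by apply/eqP; rewrite -subr_eq0; apply/eqP/(Psi_inj J2).
exists (fun j => Psi (fun b => h b j)); move: It; congr (I (_ - _)).
under [RHS]eq_bigr => j _ do rewrite Psi_theta.
by rewrite Psi_sum; apply: eq_bigr => b _; rewrite hh.
Qed.

End CoordinateRing.

(** * Completing the three forms to a coordinate system *)

Section LinearForms.
Variables (K : realFieldType) (n : nat) (v : nat -> K * K).
Local Notation d := n.+3.
Local Notation S := {mpoly K[d]}.
Local Notation nvec := (nvec d v).
Local Notation alpha := (alpha d v).
Local Notation I := (in_ideal (gensI d v)).
Hypothesis alpha_neq0 : forall j, alpha j != 0.
Hypothesis nvec_indep : forall i j k : 'I_d, i != j -> j != k -> i != k ->
  det3 (nvec i) (nvec j) (nvec k) != 0.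
Variable c : 'I_d -> K.
Hypothesis c_neq0 : forall i, c i != 0.
Hypothesis c_span : forall f, spanned v c f.
Local Notation theta := (theta c).
Local Notation ord2 := (ord2 n).
Local Notation ord1 := (ord1 n).

(** Rows of x_2, [theta1], [theta2], completed by the variables x_3, ..., x_(d-1) to a basis of the
    linear forms. *)
Definition param_mx : 'M[K]_d := \matrix_(i, j)
  match val i with
  | 0%N => (j == ord2)%:R
  | 1%N => (j != ord2)%:R * c j
  | 2%N => (j != ord2)%:R * ((pidx j)%:R * c j)
  | _ => (j == i)%:R
  end.

Definition param (i : 'I_d) : S := \sum_j param_mx i j *: 'X_j.

(** The column of vertex 2 isolates the row of x_2. The columns of vertices 1 and d give for the
    next two rows a system of determinant c_1 c_d (d - 1), nonzero in characteristic 0. *)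
Lemma param_mx_unit : param_mx \in unitmx.
Proof.
rewrite -row_free_unit -kermx_eq0 -submx0; apply/rV_subP => y /sub_kermxP yZ.
suff -> : y = 0 by rewrite sub0mx.
pose yc k : K := y 0 (inord k).
have col (j : 'I_d) : yc 0%N * (j == ord2)%:R + yc 1%N * ((j != ord2)%:R * c j) +
    yc 2%N * ((j != ord2)%:R * ((pidx j)%:R * c j)) + (if (j < 3)%N then 0 else y 0 j) = 0.
  have := congr1 (fun M : 'rV[K]_d => M 0 j) yZ; rewrite !mxE.
  rewrite !big_ord_recl !mxE /= !addrA => e0; rewrite -[RHS]e0 {e0}.
  congr (_ * _ + _ * _ + _ * _ + _); try by congr (y 0 _); apply: val_inj; rewrite /= inordK.
  case: ltnP => j3.
    rewrite big1 // => i _; rewrite mxE /=.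
    by case: eqP => [e|_]; [move: j3; rewrite e | rewrite mulr0].
  have jn : (j - 3 < n)%N by rewrite ltn_subLR // ltn_ord.
  have e : lift ord0 (lift ord0 (lift ord0 (Ordinal jn))) = j.
    by apply: val_inj; rewrite /= /bump; move: j3; clear; lia.
  rewrite (bigD1 (Ordinal jn)) //= big1 => [|i ne].
    by rewrite !mxE /= e eqxx mulr1 addr0.
  rewrite mxE /=; case: eqP => [e'|_]; last by rewrite mulr0.
  by case/eqP: ne; do 3!apply: (@lift_inj _ ord0); rewrite e e'.
have := col ord2; rewrite eqxx mulr1 !mul0r !mulr0 !addr0 => y0.
have c1 : (yc 1%N + yc 2%N) * c ord1 = 0.
  have := col ord1; rewrite y0 mul0r add0r addr0 /pidx.
  by rewrite (_ : (ord1 != ord2) = true) //= => <-; ring.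
have c0 : (yc 1%N + yc 2%N * d%:R) * c ord0 = 0.
  have := col ord0; rewrite y0 mul0r add0r addr0 /pidx.
  by rewrite (_ : (ord0 != ord2) = true) //= => <-; ring.
move/eqP: c1; rewrite mulf_eq0 (negbTE (c_neq0 _)) orbF => /eqP c1.
move/eqP: c0; rewrite mulf_eq0 (negbTE (c_neq0 _)) orbF => /eqP c0.
have y2 : yc 2%N = 0.
  apply/eqP; have : yc 2%N * (n.+2)%:R == 0.
    apply/eqP; transitivity (yc 1%N + yc 2%N * d%:R - (yc 1%N + yc 2%N)).
      by rewrite -(natr1 n.+2); ring.
    by rewrite c0 c1 subrr.
  by rewrite mulf_eq0 pnatr_eq0 orbF.
have y1 : yc 1%N = 0 by move: c1; rewrite y2 addr0.
apply/rowP => j; rewrite mxE; case: (ltnP j 3) => j3; last first.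
  by have := col j; rewrite y0 y1 y2 !mul0r !add0r ltnNge j3.
have -> : j = inord j by apply: val_inj; rewrite /= inordK.
by move: (j : nat) j3 => [|[|[|//]]] _.
Qed.

Lemma param_theta (i : 'I_d) (i3 : (i < 3)%N) : param i = theta (Ordinal i3).
Proof.
rewrite /param /theta (tnth_nth 0) /=.
have pick (a : 'I_d -> K) : \sum_j ((j != ord2)%:R * a j) *: ('X_j : S) =
    \sum_(j | j != ord2) a j *: 'X_j.
  rewrite [RHS]big_mkcond; apply: eq_bigr => j _.
  by case: (j != ord2); rewrite ?mul1r // mul0r scale0r.
under eq_bigr => j _ do rewrite mxE.
case: i i3 => [[|[|[|//]]] ? ?] /=; [|exact: pick | exact: pick].
rewrite (bigD1 ord2) //= scale1r big1 ?addr0 // => j /negbTE ->.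
by rewrite scale0r.
Qed.

Lemma sum_param (k : nat) (g : 'I_d -> S) : (k <= 3)%N ->
  \sum_(i : 'I_d | (i < k)%N) param i * g i =
  \sum_(j : 'I_3 | (j < k)%N) theta j * g (widen_ord (isT : 3 <= d)%N j).
Proof.
move=> k3; have kd : (k <= d)%N by apply: leq_trans k3 _.
rewrite (big_ord_narrow kd) (big_ord_narrow k3); apply: eq_bigr => i _; congr (_ * g _); last exact: val_inj.
have i3 : (i < 3)%N by apply: leq_trans k3.
by rewrite (param_theta (i := widen_ord _ i) i3); congr theta; apply: val_inj.
Qed.

Lemma param_regular (k : 'I_d) (f : S) (g : 'I_d -> S) : (k < 3)%N ->
  I (param k * f - \sum_(i : 'I_d | (i < k)%N) param i * g i) ->
  exists g' : 'I_d -> S, I (f - \sum_(i : 'I_d | (i < k)%N) param i * g' i).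
Proof.
move=> k3; rewrite sum_param ?(ltnW k3) // (param_theta k3).
case/(theta_regular alpha_neq0 nvec_indep c_span) => g' Ig'.
exists (fun i => g' (inord i)); rewrite sum_param ?(ltnW k3) //; move: Ig'; congr (I (_ - _)).
by apply: eq_bigr => j _; congr (_ * g' _); apply: val_inj; rewrite /= inordK.
Qed.

(** Basis monomials have degree at most 2, so in degree q + 1 >= 3 only the multiples of the linear
    forms survive. *)
Lemma param_artinian q (f : S) : (2 <= q)%N -> f \is q.+1.-homog ->
  exists g : 'I_d -> S, I (f - \sum_(i : 'I_d | (i < 3)%N) param i * g i).
Proof.
move=> q2 hf; have [h [y /(I_pihomog q.+1)]] := span_theta c_span f.
rewrite !pihomogB pihomog_dE // !pihomog_sum.
rewrite [X in _ - X]big1 ?subr0 => [If|b _]; last first.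
  rewrite pihomogZ (pihomog_ne0 _ (basis_mon_homog K b)) ?scaler0 //.
  by case: b => [[?|?]|] //=; move: q2; clear; lia.
exists (fun i => pihomog mdeg q (h (inord i))); rewrite sum_param //; move: If; congr (I (_ - _)).
apply: eq_big => [j|j _]; [by rewrite ltn_ord | rewrite (pihomogMl q (h j) (theta_homog c j)) /=].
by congr (_ * pihomog _ _ (h _)); apply: val_inj; rewrite /= inordK.
Qed.

Definition hilb_idx q : finType := 'I_#|graded_idx n q|.
Definition hilb_elt q (w : hilb_idx q) : S :=
  let x := enum_val w in beta_elt c (x.1, x.2 : 'X_{1..3}).

Lemma card_hilb_idx q :
  #|hilb_idx q| = ('C(q.+2, 2) + n * 'C(q.+1, 2) + 'C(n, 2) * 'C(q, 2))%N.
Proof. by rewrite card_ord card_graded_idx. Qed.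

Lemma hilb_homog q (w : hilb_idx q) : hilb_elt w \is q.-homog.
Proof.
have := beta_homog c ((enum_val w).1, (enum_val w).2 : 'X_{1..3}).
by have := enum_valP w; rewrite inE => /eqP ->.
Qed.

Lemma hilb_span q (f : S) : f \is q.-homog ->
  exists y : hilb_idx q -> K, I (f - \sum_w y w *: hilb_elt w).
Proof.
case/(beta_span c_span) => y hy; exists (fun w => y (enum_val w)).
by move: hy; rewrite big_enum_val.
Qed.

Lemma hilb_free q (y : hilb_idx q -> K) :
  I (\sum_w y w *: hilb_elt w) -> forall w, y w = 0.
Proof.
move=> Iy w; have wA := enum_valP w.
have J : I (\sum_(x in graded_idx n q) y (enum_rank_in wA x) *:
    beta_elt c (x.1, x.2 : 'X_{1..3})).
  by rewrite big_enum_val; move: Iy; congr I; apply: eq_bigr => j _; rewrite enum_valK_in.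
by have := beta_free alpha_neq0 nvec_indep c_span J wA; rewrite enum_valK_in.
Qed.

End LinearForms.

(** * The quadrics have no linear syzygies *)

Section LinearSyzygies.
Variables (K : realFieldType) (n : nat) (v : nat -> K * K).
Local Notation d := n.+3.
Local Notation S := {mpoly K[d]}.
Local Notation bv := (bv d v).
Local Notation nvec := (nvec d v).
Local Notation alpha := (alpha d v).
Local Notation I := (in_ideal (gensI d v)).
Hypothesis alpha_neq0 : forall j, alpha j != 0.
Hypothesis nvec_indep : forall i j k : 'I_d, i != j -> j != k -> i != k ->
  det3 (nvec i) (nvec j) (nvec k) != 0.
Hypothesis nvec_bv_neq0 : forall i k, (k %% d != i %% d)%N -> (k %% d != i.+1 %% d)%N ->
  dot3 (nvec i) (bv k) != 0.

Definition quadric (k : 'I_n) : S := dot3 (Lambda d v k.+2) (tau d v).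

Lemma gens_homog g : g \in gensI d v ->
  (exists k, g = quadric k) \/ g \is 3.-homog.
Proof.
rewrite mem_cat => /orP[/mapP[k]|/mapP[[[i j] k] _ ->]]; last by right; apply: cubic_homog.
rewrite mem_iota !subSS subn0 => /andP[k2 kn] ->; left.
have kn' : (k - 2 < n)%N by move: k2 kn; clear; lia.
by exists (Ordinal kn'); congr (dot3 (Lambda d v _) _); move: k2; clear; rewrite /=; lia.
Qed.

Lemma ideal_low q f : (q < 2)%N -> f \is q.-homog -> I f -> f = 0.
Proof.
move=> q2 hf /in_idealP[h e]; rewrite -(pihomog_dE hf) e pihomog_sum big1 // => i _.
rewrite mulrC; have [[k ->]|hg] := gens_homog (mem_nth 0 (ltn_ord i)).
  exact: (pihomogMl_lt _ (quadric_homog n v k.+2) q2).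
by apply: (pihomogMl_lt _ hg); apply: leq_trans q2 _.
Qed.

Lemma quadric_span f : f \is 2.-homog -> I f -> exists c : 'I_n -> K, f = \sum_k c k *: quadric k.
Proof.
move=> hf /in_idealP[h e]; rewrite -(pihomog_dE hf) e pihomog_sum.
elim/big_ind: _ => [|_ _ [a ->] [b ->]|i _].
- by exists (fun=> 0); rewrite big1 // => k _; rewrite scale0r.
- by exists (fun k => a k + b k); rewrite -big_split; apply: eq_bigr => k _; rewrite scalerDl.
rewrite mulrC; have [[k ->]|hg] := gens_homog (mem_nth 0 (ltn_ord i)).
  rewrite -[X in pihomog _ X](addn0 2) (pihomogMl 0 _ (quadric_homog n v k.+2)).
  rewrite (dhomog0_const (pihomogP mdeg 0 (h i))) mulrC mul_mpolyC.
  exists (fun j => (j == k)%:R * (pihomog mdeg 0 (h i))@_0%MM).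
  rewrite (bigD1 k) //= big1 ?addr0 ?eqxx ?mul1r // => j /negbTE ->.
  by rewrite mul0r scale0r.
exists (fun=> 0); rewrite (pihomogMl_lt _ hg) // big1 // => k _.
by rewrite scale0r.
Qed.

Local Notation E := 'rV[K]_d.
Let coord (x : E) (j : nat) : K := x 0 (vidx n j).
Let tauv (x : E) : v3 K := gtau n v id (coord x).
(** A bilinear form whose diagonal is the quadric Lambda_m . tau; its symmetrization is the polar
    form. *)
Let half m (x y : E) : K := dot3 (gLambda n v id (coord x) m) (tauv y).
Let e j : E := delta_mx 0 (vidx n j).

Let tauvD x y : tauv (x + y) = add3 (tauv x) (tauv y).
Proof.
rewrite /tauv /gtau !big_add3 /add3 /scale3 /mk3 /c1 /c2 /c3 /= -!big_split /=.
by congr (_, _, _); apply: eq_bigr => i _; rewrite /coord mxE mulrDl.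
Qed.

Let halfDl m x y z : half m (x + y) z = half m x z + half m y z.
Proof.
by rewrite /half /gLambda /dot3 /sub3 /scale3 /mk3 /c1 /c2 /c3 /= /coord !mxE; ring.
Qed.

Let halfDr m x y z : half m z (x + y) = half m z x + half m z y.
Proof. by rewrite /half tauvD /dot3 /add3 /mk3 /c1 /c2 /c3 /=; ring. Qed.

Let tauv_e j : tauv (e j) = bv j.
Proof.
rewrite /tauv /gtau big_add3 /scale3 /map3 /bv /mk3 /c1 /c2 /c3 /=.
have pick (a : nat -> K) : \sum_(i < d) coord (e j) i * a (i %% d)%N = a (j %% d)%N.
  rewrite (bigD1 (vidx n j)) //= /coord mxE vidx_ord !eqxx mul1r val_vidx modn_mod.
  rewrite big1 ?addr0 // => i /negbTE ij.
  by rewrite mxE vidx_ord ij andbF mul0r.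
rewrite (pick (fun i => (v i).1)) (pick (fun i => (v i).2)).
by rewrite (pick (fun=> 1)).
Qed.

Let half_e (m : 'I_n) j y : (0 < j <= d)%N -> half m.+2 (e j) y =
  (m.+3 == j)%:R * (dot3 (nvec j) (tauv y) / alpha j)
  - (m.+2 == j)%:R * (dot3 (nvec j.-1) (tauv y) / alpha j).
Proof.
move=> /andP[j0 jd].
have ce k : (0 < k <= d)%N -> coord (e j) k = (k == j)%:R.
  move=> /andP[k0 kd]; rewrite /coord mxE eqxx /=.
  case: (ltngtP k j) => [kj|jk|->]; last by rewrite eqxx.
    by rewrite (negbTE (vidx_neq _ jd)) // k0.
  by rewrite eq_sym (negbTE (vidx_neq _ kd)) // j0.
have mn := ltn_ord m.
rewrite /half /gLambda !ce; try by clear -mn; lia.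
have -> : (m.+2 + d).-1 = (m.+1 + d)%N by rewrite addSn.
rewrite nvecD; have mapid (a : v3 K) : map3 id a = a by case: a => [[]].
rewrite !mapid dot3_subl !dot3_scalel.
congr (_ - _); case: eqP => [<-|_]; rewrite ?mul0r //=; by rewrite !mul1r mulrC.
Qed.

Variable L : 'I_n -> S.
Hypothesis L_homog : forall k, L k \is 1.-homog.
Hypothesis L_syz : \sum_k L k * quadric k = 0.

Let lin k (x : E) : K := (L k).@[fun i => x 0 i].
(** [L] indexed by the subscript of Lambda and extended by 0 outside 2, ..., d - 2. These zeros
    start the recursions below. *)
Let lam m (x : E) : K := \sum_(k < n) (k.+2 == m)%:R * lin k x.

Let linD k x y : lin k (x + y) = lin k x + lin k y.
Proof.
rewrite /lin (dhomog1_sum (L_homog k)) !raddf_sum -big_split; apply: eq_bigr => i _ /=.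
by rewrite !mevalZ !mevalXU mxE mulrDr.
Qed.

Let syz_eval x : \sum_(k < n) lin k x * half k.+2 x x = 0.
Proof.
have := congr1 (meval (fun i => x 0 i)) L_syz; rewrite raddf_sum raddf0 => e0.
rewrite -[RHS]e0; apply: eq_bigr => k _; rewrite [RHS]mevalM; congr (_ * _).
have evx j : (xv K d j).@[fun i => x 0 i] = coord x j by rewrite xvE mevalXU.
rewrite /quadric [RHS]map_dot3 LambdaE tauE.
have evC (a : K) : (a%:MP : S).@[fun i => x 0 i] = a by apply: mevalC.
by rewrite (map_gLambda n v (i' := id) _ evC evx) (map_gtau n v (i' := id) evC evx).
Qed.

(* The full polarization of the cubic form [\sum_k L_k Q_k = 0]. *)
Let polar x y z : \sum_(k < n) (lin k x * (half k.+2 y z + half k.+2 z y)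
  + lin k y * (half k.+2 x z + half k.+2 z x) + lin k z * (half k.+2 x y + half k.+2 y x)) = 0.
Proof.
pose F w := \sum_(k < n) lin k w * half k.+2 w w.
transitivity (F (x + y + z) - F (x + y) - F (x + z) - F (y + z) + F x + F y + F z).
  rewrite /F -!sumrB -!big_split /=; apply: eq_bigr => k _.
  by rewrite !linD !halfDl !halfDr; ring.
by rewrite /F !syz_eval !subr0 !addr0.
Qed.

Local Notation N i p := (dot3 (nvec i) (bv p)).
(** For p = 1 or d, the sum over k of L_k(x) times the polar form of the k-th quadric at (e_j, e_p);
    see [rel_sum]. *)
Let rel p x j : K := (lam j.-1 x * N j p - lam j x * N j.-1 p) / alpha j.

(** Lambda_2, ..., Lambda_(d-2) involve only x_2, ..., x_(d-1). This is why e_1 and e_d are the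
    vectors to evaluate at. *)
Let half_end (k : 'I_n) p y : p = 1%N \/ p = d -> half k.+2 (e p) y = 0.
Proof.
move=> hp; have kn := ltn_ord k.
rewrite half_e; last by case: hp => ->; rewrite ?leqnn.
have -> : (k.+3 == p) = false by apply/eqP; case: hp => ->; clear -kn; lia.
have -> : (k.+2 == p) = false by apply/eqP; case: hp => ->; clear -kn; lia.
by rewrite !mul0r subr0.
Qed.

Let rel_sum p x j : p = 1%N \/ p = d -> (0 < j <= d)%N ->
  \sum_(k < n) lin k x * (half k.+2 (e j) (e p) + half k.+2 (e p) (e j)) = rel p x j.
Proof.
move=> hp hj; rewrite /rel /lam mulrBl !mulr_suml -sumrB; apply: eq_bigr => k _.
rewrite (half_end _ _ hp) addr0 half_e // tauv_e.
have -> : (k.+2 == j.-1) = (k.+3 == j) by case: j hj => [//|j _]; rewrite eqSS.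
by ring.
Qed.

Let rel_polar p i j : p = 1%N \/ p = d -> (0 < i <= d)%N -> (0 < j <= d)%N ->
  \sum_(k < n) lin k (e p) * (half k.+2 (e i) (e j) + half k.+2 (e j) (e i))
  + rel p (e i) j + rel p (e j) i = 0.
Proof.
move=> hp hi hj; rewrite -(rel_sum _ hp hj) -(rel_sum _ hp hi) -!big_split /=.
rewrite -[RHS](polar (e p) (e i) (e j)); apply: eq_bigr => k _.
by rewrite /=; ring.
Qed.

(** Polarizing at (e_p, e_p, e_j) produces this relation twice, the third term being zero; the field
    has characteristic 0. *)
Let rel_end p j : p = 1%N \/ p = d -> (0 < j <= d)%N -> rel p (e p) j = 0.
Proof.
move=> hp hj; have pd : (0 < p <= d)%N by case: hp => ->; rewrite ?leqnn.
have rp x : rel p x p = 0.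
  by rewrite -rel_sum // big1 // => k _; rewrite !(half_end _ _ hp) addr0 mulr0.
have := rel_polar hp pd hj; rewrite rp addr0.
under eq_bigr => k _ do rewrite [X in _ * X]addrC.
rewrite rel_sum // => /eqP; rewrite -mulr2n mulrn_eq0 /= => /eqP; exact.
Qed.

Let lam_out m x : (m < 2)%N || (n.+1 < m)%N -> lam m x = 0.
Proof.
move=> hm; rewrite /lam big1 // => k _; have kn := ltn_ord k.
by case: eqP => [e0|]; [move: hm kn; rewrite -e0; clear; lia | rewrite mul0r].
Qed.

Let lin_lam (k : 'I_n) x : lin k x = lam k.+2 x.
Proof.
rewrite /lam (bigD1 k) //= eqxx mul1r big1 ?addr0 // => j /negbTE jk.
by rewrite !eqSS val_eqE jk mul0r.
Qed.

Let N_neq0 i p : (0 < i < d)%N -> (0 < p <= d)%N -> p != i -> p != i.+1 -> N i p != 0.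
Proof.
move=> /andP[i0 id] /andP[p0 pd] pi pi1; apply: nvec_bv_neq0.
  move: pd; rewrite leq_eqVlt (modn_small id) => /orP[/eqP->|pd].
    by rewrite modnn eq_sym -lt0n.
  by rewrite (modn_small pd).
have [ei|ni] := eqVneq i.+1 d.
  have pd' : (p < d)%N by rewrite ltn_neqAle -ei pi1 ei.
  by rewrite ei modnn (modn_small pd') -lt0n.
have id' : (i.+1 < d)%N by rewrite ltn_neqAle ni.
rewrite (modn_small id'); move: pd; rewrite leq_eqVlt => /orP[/eqP->|pd].
  by rewrite modnn.
by rewrite (modn_small pd).
Qed.

(** The relation links consecutive values of [lam]; the recursion descends from the zero at index d
    - 1, with pivots n_(k+1) . v_1 that are nonzero for k + 1 < d. For e_d it ascends instead, see
    [lam_last]. *)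
Let lam_first k : lam k (e 1) = 0.
Proof.
have : (n.+2 <= k + n.+2)%N by rewrite leq_addl.
move: {2}(n.+2) => t; elim: t k => [|t IH] k ht.
  by apply: lam_out; move: ht; clear; lia.
have [/lam_out->//|/norP[k2 kn]] := boolP ((k < 2)%N || (n.+1 < k)%N).
rewrite -!leqNgt in k2 kn.
have k1 : lam k.+1 (e 1) = 0 by apply: IH; rewrite addSnnS.
have := rel_end (j := k.+1) (or_introl (erefl 1%N)); rewrite /rel /= k1 mul0r subr0.
move=> /(_ _)/eqP; rewrite mulf_eq0 invr_eq0 (negbTE (alpha_neq0 _)) orbF mulf_eq0.
rewrite (negbTE (N_neq0 _ _ _ _)) ?orbF; try by clear -k2 kn; lia.
by move=> h; apply/eqP/h; clear -kn; lia.
Qed.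

Let lam_last k : lam k (e d) = 0.
Proof.
elim: k => [|k IH]; first exact: lam_out.
have [/lam_out->//|/norP[k2 kn]] := boolP ((k.+1 < 2)%N || (n.+1 < k.+1)%N).
rewrite -!leqNgt in k2 kn.
have := rel_end (j := k.+1) (or_intror (erefl d)); rewrite /rel /= IH mul0r sub0r.
move=> /(_ _)/eqP; rewrite mulf_eq0 invr_eq0 (negbTE (alpha_neq0 _)) orbF oppr_eq0 mulf_eq0.
rewrite (negbTE (N_neq0 _ _ _ _)) ?orbF; try by clear -k2 kn; lia.
by move=> h; apply/eqP/h; clear -kn; lia.
Qed.

Let rel_eq p i j : p = 1%N \/ p = d -> (0 < i <= d)%N -> (0 < j <= d)%N ->
  rel p (e i) j + rel p (e j) i = 0.
Proof.
move=> hp hi hj; rewrite -[RHS](rel_polar hp hi hj) [X in _ = X + _ + _]big1 ?add0r // => k _.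
by case: hp => ->; rewrite lin_lam ?lam_first ?lam_last mul0r.
Qed.

(** By the Binet-Cauchy identity this is, up to sign, (n_i x n_j) . (v_d x v_1), a determinant of
    three distinct edge normals. *)
Let det_N i j : (0 < i < d)%N -> (0 < j < d)%N -> i != j -> N i d * N j 1 - N i 1 * N j d != 0.
Proof.
move=> /andP[i0 id] /andP[j0 jd] ij.
have := nvec_indep (i := Ordinal id) (j := Ordinal jd) (k := ord0).
rewrite -!val_eqE /= ij -!lt0n => /(_ isT j0 i0); apply: contra_neq => e0.
have -> : nvec 0 = cross3 (bv d) (bv 1) by rewrite /nvec -(bvD n v 0).
rewrite -[RHS]e0.
move: (nvec i) (nvec j) (bv d) (bv 1) => [[? ?] ?] [[? ?] ?] [[? ?] ?] [[? ?] ?].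
by rewrite /det3 /dot3 /cross3 /mk3 /c1 /c2 /c3 /=; ring.
Qed.

(* Induction on [i + j]: modulo earlier vanishing, the relations say that
   [lam i (e j) / alpha i * nvec i.-1 + lam j (e i) / alpha j * nvec j.-1]
   vanishes at [v_1] and [v_d], i.e. is a multiple of [nvec d]. *)
Let lam0 i j : (0 < j <= d)%N -> lam i (e j) = 0.
Proof.
have [s] := ubnP (i + j); elim: s i j => // s IH i j ijs hj.
have [/lam_out->//|/norP[i2 ni]] := boolP ((i < 2)%N || (n.+1 < i)%N).
rewrite -!leqNgt in i2 ni.
have hi : (0 < i <= d)%N by clear -i2 ni; lia.
have z1 : lam j.-1 (e i) = 0 by apply: IH hi; move: ijs hj; clear; lia.
have z2 : lam i.-1 (e j) = 0 by apply: IH hj; move: ijs hi; clear; lia.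
pose a := lam i (e j) / alpha i; pose b := lam j (e i) / alpha j.
have ab p : p = 1%N \/ p = d -> a * N i.-1 p + b * N j.-1 p = 0.
  move=> hp; apply/eqP; rewrite -oppr_eq0 -(rel_eq hp hi hj) /rel z1 z2 /a /b.
  by apply/eqP; ring.
suff : a = 0 by move/eqP; rewrite mulf_eq0 invr_eq0 (negbTE (alpha_neq0 _)) orbF => /eqP.
have e1 := ab 1%N (or_introl erefl); have ed := ab d (or_intror erefl).
have Nd : N i.-1 d != 0 by apply: N_neq0; clear -i2 ni; lia.
have [jout|/norP[j2 nj]] := boolP ((j < 2)%N || (n.+1 < j)%N).
  move/eqP: ed; rewrite /b (lam_out _ jout) !mul0r addr0 mulf_eq0 (negbTE Nd) orbF.
  by move/eqP.
rewrite -!leqNgt in j2 nj.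
have [ij|ij] := eqVneq i j.
  move/eqP: ed; rewrite /b -ij /a -ij -mulr2n mulrn_eq0 /= mulf_eq0 (negbTE Nd) orbF.
  by move/eqP.
have D : N i.-1 d * N j.-1 1 - N i.-1 1 * N j.-1 d != 0.
  by apply: det_N; [clear -i2 ni; lia | clear -j2 nj; lia | clear -i2 j2 ij; lia].
apply/eqP; rewrite -[a == 0](orbF) -[in X in _ || X](negbTE D) -mulf_eq0; apply/eqP.
transitivity ((a * N i.-1 d + b * N j.-1 d) * N j.-1 1 - (a * N i.-1 1 + b * N j.-1 1) * N j.-1 d).
  by ring.
by rewrite e1 ed !mul0r subrr.
Qed.

Lemma no_linear_syzygy k : L k = 0.
Proof.
rewrite (dhomog1_sum (L_homog k)) big1 // => i _.
have ai : exists2 j, (0 < j <= d)%N & vidx n j = i.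
  by exists (pidx i); [rewrite /pidx; have := ltn_ord i; case: eqP; clear; lia | apply: vidx_pidx].
have [j hj ji] := ai; have := lam0 k.+2 hj; rewrite -lin_lam /lin /e ji => l0.
suff -> : (L k)@_U_(i) = (L k).@[fun i' => (delta_mx 0 i : E) 0 i'] by rewrite l0 scale0r.
rewrite [in RHS](dhomog1_sum (L_homog k)) raddf_sum (bigD1 i) //= big1 => [|i' /negbTE ii].
  by rewrite mevalZ mevalXU mxE !eqxx mulr1 addr0.
by rewrite mevalZ mevalXU mxE ii andbF mulr0.
Qed.

End LinearSyzygies.

(** * Convex polygons *)

Section ConvexPolygon.
Variables (K : realFieldType) (n : nat) (v : nat -> K * K).
Local Notation d := n.+3.
Hypothesis convex_v : convex_polygon d v.

Lemma convex_nvec_bv i k : (k %% d != i %% d)%N -> (k %% d != i.+1 %% d)%N ->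
  dot3 (nvec d v i) (bv d v k) != 0.
Proof.
move=> ki ki1; rewrite -det3_cross.
have bvm j : bv d v (j %% d) = bv d v j by rewrite /bv modn_mod.
pose o j : 'I_d := Ordinal (ltn_pmod j (isT : 0 < d)%N).
have bvS : bv d v (o i).+1 = bv d v i.+1.
  by rewrite -(bvm (o i).+1) /= -[(i %% d).+1]addn1 modnDml addn1 bvm.
rewrite -(bvm i) -bvS -(bvm k) -[(i %% d)%N]/(val (o i)) -[(k %% d)%N]/(val (o k)).
have oki : o k != o i by [].
have oki1 : o k != ((o i).+1 %% d)%N :> nat by rewrite /= -[(_ %% _).+1]addn1 modnDml addn1.
by case: convex_v => h; [rewrite gt_eqF | rewrite lt_eqF] => //; apply: h.
Qed.

Lemma convex_alpha j : alpha d v j != 0.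
Proof.
(* [j + n.+2] is j - 1 modulo d: alpha_j tests v_(j+1) against the preceding edge. *)
have -> : alpha d v j = dot3 (nvec d v (j + n.+2)) (bv d v j.+1).
  by rewrite /alpha det3_cross addnS /= /nvec -[(j + n.+2).+1]addnS bvD.
apply: convex_nvec_bv; first by rewrite -addn1 eqn_modDl !modn_small.
by rewrite -addnS -addn1 eqn_modDl modnn modn_small.
Qed.

End ConvexPolygon.

(** * The Betti table of S / I(d) *)

Theorem theorem5p11 (K : realFieldType) (d : nat) (v : nat -> K * K)
  (C : graded_free_complex K d) :
  (4 <= d)%N ->
  convex_polygon d v ->
  no_three_edge_lines_concurrent d v ->
  minimal_graded_free_resolution (gensI d v) C ->
  [/\ betti C 0 0 = 1%N,
      betti C 1 2 = (d - 3)%N,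
      (forall i : nat, (3 <= i)%N ->
         (betti C (i - 2) i)%:Z =
           ('C(d - 3, i))%:Z - ((d - 3) * 'C(d - 3, i.-1))%:Z
           + ('C(d - 3, 2) * 'C(d - 3, i - 2))%:Z)
    & (forall p q : nat,
         ~ ((p == 0%N) && (q == 0%N)) ->
         ~ ((p == 1%N) && (q == 2%N)) ->
         ~ ((1 <= p)%N && (q == p + 2)%N) ->
         betti C p q = 0%N)].
Proof.
case: d C => [|[|[|n]]] C // _ convex_v indep res.
have alpha0 := convex_alpha convex_v; have nb0 := convex_nvec_bv convex_v.
have [c c0 span] := spanned_generic alpha0 indep nb0.
rewrite !subSS subn0.
exact: (betti_table res (param_mx_unit c0) (fun i => erefl)
  (fun k f g => @param_regular _ _ _ alpha0 indep c span k f g)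
  (fun q f => @param_artinian _ _ _ c span q f)
  (fun q f => @ideal_low _ _ _ q f)
  (fun f => @quadric_span _ _ _ f)
  (fun L => @no_linear_syzygy _ _ _ alpha0 indep nb0 L)
  (card_hilb_idx n) (fun q w => @hilb_homog _ _ c q w)
  (fun q f => @hilb_span _ _ _ c span q f)
  (fun q y => @hilb_free _ _ _ alpha0 indep c span q y)).
Qed.
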